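(* Let $1\le p\le 2$, $D>0$, $r>0$. Assume that the kernels are uniformly bounded, i.e. there is $B<\infty$ with $\|\boldsymbol{x}^{(m)}\|_2^2\le B$ almost surely for all $m=1,\dots,M$, and that the variables $\boldsymbol{x}^{(1)},\dots,\boldsymbol{x}^{(M)}$ are pairwise uncorrelated (Assumption (U), see context). Then the local Rademacher complexity of the class $H_p=H_{p,D,M}$ satisfies, for every $t\in[p,2]$, $$R_r(H_p)\le \sqrt{\frac{16}{n}\left\|\left(\sum_{j=1}^\infty\min\Big(rM^{1-\frac{2}{t^*}},\; e\,D^2\,{t^*}^2\,\lambda^{(m)}_j\Big)\right)_{m=1}^M\right\|_{\frac{t^*}{2}}}+\frac{\sqrt{Be}\,D\,M^{\frac{1}{t^*}}\,t^*}{n}.$$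
   Context: Let $M,n\ge 1$ be integers and let $\mathcal{H}_1,\dots,\mathcal{H}_M$ be the reproducing kernel Hilbert spaces of kernels $k_1,\dots,k_M$ on an input space $\mathcal{X}$, with feature maps $\phi_m:\mathcal{X}\to\mathcal{H}_m$. Put $\mathcal{H}=\mathcal{H}_1\times\cdots\times\mathcal{H}_M$ with the inner product $\langle \boldsymbol{u},\boldsymbol{v}\rangle=\sum_m\langle \boldsymbol{u}^{(m)},\boldsymbol{v}^{(m)}\rangle$. For a random input $X$ with values in $\mathcal{X}$ write $\boldsymbol{x}^{(m)}=\phi_m(X)$ and $\boldsymbol{x}=(\boldsymbol{x}^{(1)},\dots,\boldsymbol{x}^{(M)})$, a random element of $\mathcal{H}$ with $\mathbb{E}\|\boldsymbol{x}\|^2<\infty$; its law is denoted $P$. Let $\boldsymbol{x}_1,\dots,\boldsymbol{x}_n$ be i.i.d. copies of $\boldsymbol{x}$, and $\sigma_1,\dots,\sigma_n$ i.i.d. Rademacher signs independent of them. $\|\cdot\|_2$ also denotes the norm of each $\mathcal{H}_m$. For $\boldsymbol{w}=(\boldsymbol{w}^{(1)},\dots,\boldsymbol{w}^{(M)})\in\mathcal{H}$ let $\|\boldsymbol{w}\|_{2,p}=\big\|(\|\boldsymbol{w}^{(m)}\|_2)_{m=1}^M\big\|_p$, the $\ell_p$-norm of the vector of block norms, and $f_{\boldsymbol{w}}(\boldsymbol{x})=\langle\boldsymbol{w},\boldsymbol{x}\rangle$. The class is $H_{p,D,M}=\{f_{\boldsymbol{w}}:\ \|\boldsymbol{w}\|_{2,p}\le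 D\}$. With $Pf_{\boldsymbol{w}}^2=\mathbb{E}(f_{\boldsymbol{w}}(\boldsymbol{x}))^2$, the local Rademacher complexity is $$R_r(H_p)=\mathbb{E}\sup_{f_{\boldsymbol{w}}\in H_p:\,Pf_{\boldsymbol{w}}^2\le r}\Big\langle\boldsymbol{w},\frac1n\sum_{i=1}^n\sigma_i\boldsymbol{x}_i\Big\rangle .$$ $(\lambda_j^{(m)})_{j\ge1}$ are the eigenvalues (with multiplicity) of the uncentered covariance operator $J_m=\mathbb{E}\,\boldsymbol{x}^{(m)}\otimes\boldsymbol{x}^{(m)}$ on $\mathcal{H}_m$, where $(\boldsymbol{x}\otimes\boldsymbol{x})\boldsymbol{u}=\langle\boldsymbol{x},\boldsymbol{u}\rangle\boldsymbol{x}$. Assumption (U): for all $m\ne m'$, $\boldsymbol{w}\in\mathcal{H}_m$, $\boldsymbol{w}'\in\mathcal{H}_{m'}$, the real random variables $\langle\boldsymbol{w},\boldsymbol{x}^{(m)}\rangle$ and $\langle\boldsymbol{w}',\boldsymbol{x}^{(m')}\rangle$ are uncorrelated. $t^*\in[1,\infty]$ is the conjugate exponent of $t$: $1/t+1/t^*=1$. If $t=1$ ($t^*=\infty$) the right-hand side is read as $+\infty$. *)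

(* Defs.v *)
(* World: MathComp + MathComp-Analysis. *)
From HB Require Import structures.
From mathcomp Require Import all_boot all_order all_algebra sesquilinear.
From mathcomp Require Import all_classical all_reals all_analysis.

Set Implicit Arguments.
Unset Strict Implicit.
Unset Printing Implicit Defensive.
Import Order.TTheory GRing.Theory Num.Theory.
Import numFieldNormedType.Exports.

Local Open Scope classical_set_scope.
Local Open Scope ring_scope.

(* A real Hilbert space: a Banach space whose norm comes from an inner
   product. *)
Record hilbert (R : realType) := Hilbert {
  hilbert_sort :> completeNormedModType R;
  hdot : {dot hilbert_sort for idfun};
  hdot_norm : forall u : hilbert_sort, hdot u u = `|u| ^+ 2 }.

Arguments hdot {R h}.

(* [H] is (via the injective evaluation [ev]) a space of functions on [S] that
   contains every section k(., x) and has the reproducing property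
   f(x) = <f, k(., x)>; linearity of [ev] follows from the latter. *)
Definition is_rkhs (R : realType) (S : Type) (k : S -> S -> R)
    (H : hilbert R) : Prop :=
  exists ev : H -> S -> R, injective ev /\
    forall x, exists kx : H,
      (forall y, ev kx y = k y x) /\ (forall f : H, ev f x = hdot f kx).

Definition is_feature_map (R : realType) (S : Type) (k : S -> S -> R)
    (H : hilbert R) (phi : S -> H) : Prop :=
  forall x y, hdot (phi x) (phi y) = k x y.

Definition borel (T : topologicalType) : set (set T) := <<s @open T >>.

(* Random elements in the sense of Bochner: Borel measurable and almost surely
   with values in a separable subset; the spaces themselves are not assumed
   to be separable. *)
Definition random_element (d : measure_display) (Omega : measurableType d)
    (R : realType) (P : probability Omega R) (T : topologicalType)
    (Y : Omega -> T) : Prop :=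
  (forall A, borel A -> measurable (Y @^-1` A)) /\
  exists2 S : set T, countable S & {ae P, forall omega, closure S (Y omega)}.

Definition same_law (d : measure_display) (Omega : measurableType d)
    (R : realType) (P : probability Omega R) (T : topologicalType)
    (Y Z : Omega -> T) : Prop :=
  forall A, borel A -> P (Y @^-1` A) = P (Z @^-1` A).

(* Only used for families [F] such that every [F i] contains [setT], so that
   the product rule over all of [I] includes the one over each subfamily. *)
Definition mutually_independent (d : measure_display)
    (Omega : measurableType d) (R : realType) (P : probability Omega R)
    (I : finType) (F : I -> set (set Omega)) : Prop :=
  forall A : I -> set Omega, (forall i, F i (A i)) ->
    P (\bigcap_i A i) = (\prod_i fine (P (A i)))%:E.

Definition is_rademacher (d : measure_display) (Omega : measurableType d)
    (R : realType) (P : probability Omega R) (s : {RV P >-> R}) : Prop :=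
  P (s @^-1` [set 1]) = (2^-1)%:E /\ P (s @^-1` [set - 1]) = (2^-1)%:E.

(* The sigma-algebras generated by the x_i (left summand) and by the signs
   (right summand); their mutual independence says that the x_i are
   independent, the signs are independent, and the signs are jointly
   independent of the x_i. *)
Definition sample_algebras (d : measure_display) (Omega : measurableType d)
    (R : realType) (P : probability Omega R) (T : topologicalType) (n : nat)
    (xs : 'I_n -> Omega -> T) (sigma : 'I_n -> {RV P >-> R})
    (i : 'I_n + 'I_n) : set (set Omega) :=
  match i with
  | inl a => preimage_set_system setT (xs a) (@borel T)
  | inr b => preimage_set_system setT (sigma b : Omega -> R) measurable
  end.

Definition tensor (R : realType) (H : hilbert R) (x y u : H) : H :=
  hdot y u *: x.

(* J = E[Y (x) Y], the expectation of operators being taken weakly: <J u, v>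
   is the expectation of <(Y (x) Y) u, v>. *)
Definition is_covariance_operator (d : measure_display)
    (Omega : measurableType d) (R : realType) (P : probability Omega R)
    (H : hilbert R) (Y : Omega -> H) (J : H -> H) : Prop :=
  forall u v : H,
    'E_P[fun omega => hdot (tensor (Y omega) (Y omega) u) v]%E
      = (hdot (J u) v)%:E.

Definition has_dim (R : realType) (V : lmodType R) (E : set V) (k : nat) :
    Prop :=
  exists b : 'I_k -> V,
    [/\ forall i, E (b i),
        forall c : 'I_k -> R, \sum_i c i *: b i = 0 -> forall i, c i = 0
      & forall v, E v -> exists c : 'I_k -> R, v = \sum_i c i *: b i].

Definition eigenvectors (R : realType) (V : lmodType R) (J : V -> V) (mu : R) :
    set V := [set v | J v = mu *: v].

(* [lambda] enumerates the eigenvalues of [J] with multiplicity: each nonzero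
   value [mu] occurs exactly dim ker (J - mu) times.  (A value occurring k > 0
   times is thus an eigenvalue.)  Zero may occur any number of times, which
   pads the sequence when there are only finitely many nonzero eigenvalues. *)
Definition eigenvalue_seq (R : realType) (V : lmodType R) (J : V -> V)
    (lambda : nat -> R) : Prop :=
  forall mu : R, mu != 0 -> exists k : nat,
    has_dim (eigenvectors J mu) k /\ ([set j | lambda j = mu] #= `I_k)%card.

Section Product.
Context (R : realType) (M : nat) (H : 'I_M -> hilbert R).

Definition prod_space : topologicalType := prod_topology H.

Definition pdot (w v : prod_space) : R := \sum_m hdot (w m) (v m).

End Product.

Definition lpnorm (R : realType) (M : nat) (q : R) (a : 'I_M -> \bar R) :
    \bar R := ((\sum_(m < M) `|a m| `^ q) `^ q^-1)%E.

Definition norm2p (R : realType) (M : nat) (H : 'I_M -> hilbert R) (p : R)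
    (w : prod_space H) : \bar R := lpnorm p (fun m => `|w m|%:E).

(* The class H_{p,D,M}, as a set of functions on the product space. *)
Definition hclass (R : realType) (M : nat) (H : 'I_M -> hilbert R) (p D : R) :
    set (prod_space H -> R) :=
  [set pdot w | w in [set w : prod_space H | (norm2p p w <= D%:E)%E]].

Definition second_moment (d : measure_display) (Omega : measurableType d)
    (R : realType) (P : probability Omega R) (T : Type) (x : Omega -> T)
    (f : T -> R) : \bar R := 'E_P[fun omega => (f (x omega) ^+ 2)%R]%E.

Definition rademacher_mean (d : measure_display) (Omega : measurableType d)
    (R : realType) (M : nat) (H : 'I_M -> hilbert R) (n : nat)
    (xs : 'I_n -> Omega -> prod_space H) (sigma : 'I_n -> Omega -> R)
    (omega : Omega) : prod_space H :=
  fun m => n%:R^-1 *: \sum_i sigma i omega *: xs i omega m.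

Definition local_rademacher (d : measure_display) (Omega : measurableType d)
    (R : realType) (P : probability Omega R) (M : nat)
    (H : 'I_M -> hilbert R) (x : Omega -> prod_space H) (n : nat)
    (xs : 'I_n -> Omega -> prod_space H) (sigma : 'I_n -> Omega -> R)
    (F : set (prod_space H -> R)) (r : R) : \bar R :=
  (\int[P]_omega ereal_sup
     [set (pdot w (rademacher_mean xs sigma omega))%:E
       | w in [set w | F (pdot w) /\ second_moment P x (pdot w) <= r%:E]])%E.

Definition pairwise_uncorrelated (d : measure_display)
    (Omega : measurableType d) (R : realType) (P : probability Omega R)
    (M : nat) (H : 'I_M -> hilbert R) (x : Omega -> prod_space H) : Prop :=
  forall (m m' : 'I_M) (w : H m) (w' : H m'), m != m' ->
    covariance P (fun omega => hdot w (x omega m))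
                 (fun omega => hdot w' (x omega m')) = 0%E.

Definition spectral_sum (R : realType) (c a : R) (lambda : nat -> R) :
    \bar R := (\sum_(0 <= j <oo) (Num.min c (a * lambda j))%:E)%E.

(* The conjugate exponent of t in [1, 2] is infinite only when t = 1; the bound
   is then read as infinite. *)
Definition rademacher_bound (R : realType) (M n : nat) (D r B t : R)
    (lambda : 'I_M -> nat -> R) : \bar R :=
  match hoelder_conjugate t%:E with
  | s%:E =>
    let c := r * M%:R `^ (1 - 2 / s) in
    let a := expR 1 * D ^+ 2 * s ^+ 2 in
    let tail := Num.sqrt (B * expR 1) * D * M%:R `^ s^-1 * s / n%:R in
    (((16 / n%:R)%:E * lpnorm (s / 2)%R (fun m => spectral_sum c a (lambda m)))
       `^ 2^-1 + tail%:E)%E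
  | _ => +oo%E
  end.

(* Main.v *)
(* Write s for the conjugate exponent of t, x~ = x - E x, C_m for the covariance
   operator of x~^(m), c = r M^(1-2/s), a = e D^2 s^2, eta = c / a and
   T_m = (C_m + eta)^-1.  Bias and variance split the functional into
   <w, E x> times the mean of the signs and <w, zeta>, where zeta is the centred
   Rademacher mean.  Instead of truncating the spectrum of C_m, smooth it: since
   C_m T_m + eta T_m = 1, the part <w, C T zeta> is controlled by P f_w^2 <= r
   (by (U), the variance of f_w is sum_m <w_m, C_m w_m>) and <w, eta T zeta> by
   ||w||_{2,t} <= D and a moment bound of order s.  Both are governed by the
   effective dimension N_m = tr(C_m T_m).  In an eigenbasis u_j of J_m >= C_m,
   Cauchy-Schwarz gives <C T u_j, u_j> <= lambda_j / (lambda_j + eta), so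
   c N_m <= sum_j min(c, a lambda_j).
   That the eigenvectors of J_m span the range of x^(m) follows from the
   existence of an eigenvector for every nonzero covariance operator, obtained
   by power iteration.  Independence is only used for finitely many events: the
   inputs are replaced by conditional means over a finite partition into small
   cells, so that every expectation becomes a finite sum. *)
Require Import Defs.
From HB Require Import structures.
From mathcomp Require Import all_boot all_order all_algebra sesquilinear.
From mathcomp Require Import all_classical all_reals all_analysis.
From mathcomp Require Import measurable_realfun ring lra.
Import Order.TTheory GRing.Theory Num.Theory.
Import numFieldNormedType.Exports.
Set Implicit Arguments.
Unset Strict Implicit.
Unset Printing Implicit Defensive.
Local Open Scope classical_set_scope.
Local Open Scope ring_scope.

(** * Hilbert spaces *)

Lemma lipschitz_cts (R : realType) (V W : normedModType R) (f : V -> W) (K : R) :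
  (forall u v, `|f u - f v| <= K * `|u - v|) -> continuous f.
Proof.
move=> fK u; apply/cvgrPdist_le => /= e e0.
have K1 : 0 < `|K| + 1 by rewrite ltr_wpDl.
near=> v.
apply: (le_trans (fK u v)).
have h : `|u - v| <= e / (`|K| + 1).
  by near: v; apply: cvgr_dist_le => //; rewrite divr_gt0.
have : (`|K| + 1) * `|u - v| <= e by rewrite mulrC -ler_pdivlMr.
apply: le_trans; apply: ler_wpM2r => //.
by apply: (le_trans (ler_norm _)); rewrite lerDl.
Unshelve. all: by end_near. Qed.

Lemma sqdist_cvg (R : realType) (V : completeNormedModType R) (u : nat -> V)
    (g : nat -> R) :
  (forall k l, (k <= l)%N -> `|u k - u l| ^+ 2 <= g k) ->
  g @ \oo --> (0 : R) -> cvgn u.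
Proof.
move=> ug g0; apply/cauchy_cvgP/cauchy_exP => e e0.
have e2 : 0 < (e / 2) ^+ 2 by rewrite exprn_gt0// divr_gt0.
have [N _ gN] := cvgr_lt _ g0 _ e2.
exists (u N).
exists N => // n /= Nn.
rewrite -ball_normE /ball_ /=.
have := le_lt_trans (ug _ _ Nn) (gN N (leqnn _)).
rewrite (@ltr_pXn2r _ 2) ?nnegrE ?(divr_ge0 (ltW e0))// => h.
by lra.
Qed.

Lemma quad_discr (R : realFieldType) (A B C : R) : 0 <= A ->
  (forall t, 0 <= A * t ^+ 2 + 2 * B * t + C) -> B ^+ 2 <= A * C.
Proof.
move=> A0 h; have [A00|An0] := eqVneq A 0; last first.
  have Ap : 0 < A by rewrite lt_neqAle eq_sym An0.
  have := h (- B / A).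
  have -> : A * (- B / A) ^+ 2 + 2 * B * (- B / A) + C = (A * C - B ^+ 2) / A.
    by field.
  by rewrite pmulr_lge0 ?invr_gt0// subr_ge0.
have [->|B0] := eqVneq B 0; first by rewrite A00 mul0r expr0n.
have := h (- (C + 1) / (2 * B)).
rewrite A00 mul0r add0r.
have -> : 2 * B * (- (C + 1) / (2 * B)) + C = -1 by field.
by rewrite ler0N1.
Qed.

Record psd_form (R : realType) (V : lmodType R) (a : V -> V -> R) : Prop :=
  PsdForm {
    psdD : forall u v w, a (u + v) w = a u w + a v w;
    psdZ : forall t u v, a (t *: u) v = t * a u v;
    psdC : forall u v, a u v = a v u;
    psd_ge0 : forall u, 0 <= a u u }.

Section PsdForm.
Context (R : realType) (V : lmodType R) (a : V -> V -> R) (ha : psd_form a).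

Lemma psdDr u v w : a u (v + w) = a u v + a u w.
Proof. by rewrite psdC// psdD// !(psdC ha u). Qed.

Lemma psdZr t u v : a u (t *: v) = t * a u v.
Proof. by rewrite psdC// psdZ// (psdC ha u). Qed.

Lemma psdNl u v : a (- u) v = - a u v.
Proof. by rewrite -scaleN1r psdZ// mulN1r. Qed.

Lemma psdNr u v : a u (- v) = - a u v.
Proof. by rewrite -scaleN1r psdZr mulN1r. Qed.

Lemma psd0l v : a 0 v = 0.
Proof. by rewrite -(scale0r 0) psdZ// mul0r. Qed.

Lemma psd0r v : a v 0 = 0.
Proof. by rewrite psdC// psd0l. Qed.

Definition psdE := (psdD ha, psdDr, psdZ ha, psdZr, psdNl, psdNr, psd0l, psd0r).

Lemma psd_CS u v : a u v ^+ 2 <= a u u * a v v.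
Proof.
apply: quad_discr => [|t]; first exact: psd_ge0.
have := psd_ge0 ha (t *: u + v).
by rewrite !psdE (psdC ha v u); congr (_ <= _); ring.
Qed.

Lemma psd_suml (I : Type) (s : seq I) (Q : pred I) (f : I -> V) v :
  a (\sum_(i <- s | Q i) f i) v = \sum_(i <- s | Q i) a (f i) v.
Proof.
by apply: (big_morph (a^~ v)) => [x y|]; rewrite ?psdD// psd0l.
Qed.

Lemma psd_sumr (I : Type) (s : seq I) (Q : pred I) (f : I -> V) v :
  a v (\sum_(i <- s | Q i) f i) = \sum_(i <- s | Q i) a v (f i).
Proof. by rewrite psdC// psd_suml; apply: eq_bigr => i _; rewrite psdC. Qed.

End PsdForm.

Section Hdot.
Context (R : realType) (H : hilbert R).
Implicit Types u v w : H.

Lemma hdot_psd : psd_form (@hdot R H).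
Proof.
split=> [u v w|t u v|u v|u].
- exact: linearDl.
- exact: linearZl.
- by have := hermC (@hdot R H) u v; rewrite /= expr0 mul1r.
- by rewrite hdot_norm sqr_ge0.
Qed.

Lemma hdotC u v : hdot u v = hdot v u. Proof. exact: (psdC hdot_psd). Qed.

Definition hdotE := psdE hdot_psd.

Lemma hdotZl t u v : hdot (t *: u) v = t * hdot u v.
Proof. exact: (psdZ hdot_psd). Qed.

Lemma hdotZr t u v : hdot u (t *: v) = t * hdot u v.
Proof. exact: (psdZr hdot_psd). Qed.

Lemma hdotDl u v w : hdot (u + v) w = hdot u w + hdot v w.
Proof. exact: (psdD hdot_psd). Qed.

Lemma hdotBr u v w : hdot u (v - w) = hdot u v - hdot u w.
Proof. by rewrite !hdotE. Qed.

Lemma hdotBl u v w : hdot (u - v) w = hdot u w - hdot v w.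
Proof. by rewrite !hdotE. Qed.

Lemma hdot_CS u v : `|hdot u v| <= `|u| * `|v|.
Proof.
rewrite -(@ler_pXn2r _ 2)// ?nnegrE ?mulr_ge0//.
by rewrite real_normK ?num_real// exprMn -!hdot_norm; exact: psd_CS hdot_psd _ _.
Qed.

Lemma hdot_le u v : hdot u v <= `|u| * `|v|.
Proof. exact: le_trans (ler_norm _) (hdot_CS u v). Qed.

Lemma hdot_eqP u v : (forall w, hdot u w = hdot v w) -> u = v.
Proof.
move=> uv; apply/eqP; rewrite -subr_eq0 -normr_eq0 -sqrf_eq0 -hdot_norm.
by rewrite !hdotE !uv; apply/eqP; ring.
Qed.

Lemma hdot_cts u : continuous (fun v => hdot u v : R).
Proof.
apply: (@lipschitz_cts _ _ _ _ `|u|) => v w /=.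
by have := hdot_CS u (v - w); rewrite !hdotE.
Qed.

Lemma hdot_comp_cts (S : topologicalType) (f g : S -> H) :
  continuous f -> continuous g -> continuous (fun x => hdot (f x) (g x) : R).
Proof.
move=> cf cg x.
have pol v w : hdot v w = 4^-1 * (`|v + w| ^+ 2 - `|v - w| ^+ 2).
  by rewrite -!hdot_norm !hdotE (hdotC w v); field.
have cn (h : S -> H) : h y @[y --> x] --> h x ->
    `|h y| ^+ 2 @[y --> x] --> `|h x| ^+ 2.
  by move=> ch; rewrite expr2; under eq_fun do rewrite expr2;
    apply: cvgM; exact: cvg_norm.
under eq_fun do rewrite pol.
apply: cvgM; first exact: cvg_cst.
apply: cvgB; first by apply: (cn (f \+ g)); apply: cvgD; [exact: cf|exact: cg].
by apply: (cn (f \- g)); apply: cvgB; [exact: cf|exact: cg].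
Qed.

Lemma normB_sqr u v : `|u - v| ^+ 2 = `|u| ^+ 2 - 2 * hdot u v + `|v| ^+ 2.
Proof. by rewrite -!hdot_norm !hdotE (hdotC v u); ring. Qed.

End Hdot.

(* Minimise the energy [a v v - 2 l v]: by the parallelogram identity a
   minimising sequence is Cauchy. *)
Lemma lax_milgram (R : realType) (H : hilbert R) (a : H -> H -> R) (d K L : R)
    (l : H -> R) : psd_form a -> 0 < d ->
  (forall u, d * `|u| ^+ 2 <= a u u) -> (forall u, a u u <= K * `|u| ^+ 2) ->
  (forall u v, l (u + v) = l u + l v) -> (forall t u, l (t *: u) = t * l u) ->
  (forall u, `|l u| <= L * `|u|) ->
  exists v, forall u, a v u = l u.
Proof.
move=> ha d0 alo ahi lD lZ lL.
pose F v := a v v - 2 * l v.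
pose m := inf (range F).
have Flb v : - (L ^+ 2 / d) <= F v.
  have h1 : d * `|v| ^+ 2 - 2 * (L * `|v|) <= F v.
    by apply: lerB; [exact: alo|rewrite ler_pM2l//; apply: le_trans (ler_norm _) (lL v)].
  apply: le_trans h1; rewrite -subr_ge0.
  have -> : d * `|v| ^+ 2 - 2 * (L * `|v|) - - (L ^+ 2 / d)
     = (d * `|v| - L) ^+ 2 / d by field; rewrite gt_eqF.
  by rewrite divr_ge0 ?sqr_ge0// ltW.
have hinf : has_inf (range F).
  split; first by exists (F 0), 0.
  by exists (- (L ^+ 2 / d)) => _ [v _ <-].
have mF v : m <= F v by apply: ge_inf; [case: hinf|exists v].
have /choice[u uF] k : exists v, F v <= m + k.+1%:R^-1.
  have k0 : 0 < k.+1%:R^-1 :> R by rewrite invr_gt0.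
  have [_ [v _ <-] h] := inf_adherent k0 hinf.
  by exists v; exact: ltW.
have res k v : (a (u k) v - l v) ^+ 2 <= a v v * k.+1%:R^-1.
  apply: quad_discr => [|t]; first exact: psd_ge0.
  have := mF (t *: v + u k); have := uF k; rewrite /F !(psdE ha) lD lZ (psdC ha v (u k)).
  move: k.+1%:R^-1 => k1; clearbody m; lra.
have FB v w : a (v - w) (v - w) = 2 * F v + 2 * F w - 4 * F (2^-1 *: (v + w)).
  by rewrite /F !(psdE ha) lZ lD (psdC ha w v); field.
have cu : cvgn u.
  pose g (k : nat) : R := 4 * d^-1 * k.+1%:R^-1.
  apply: (@sqdist_cvg _ _ _ g); last first.
    rewrite -(mulr0 (4 * d^-1)); apply: cvgM; first exact: cvg_cst.
    exact: cvg_harmonic.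
  move=> k j kj; rewrite /g mulrAC ler_pdivlMr// mulrC.
  apply: (le_trans (alo _)); rewrite FB.
  have := mF (2^-1 *: (u k + u j)); have := uF k; have := uF j.
  have : j.+1%:R^-1 <= k.+1%:R^-1 :> R by rewrite lef_pV2 ?posrE// ler_nat.
  move: k.+1%:R^-1 j.+1%:R^-1 => k1 j1; clearbody F m; lra.
exists (limn u) => v; apply/eqP; rewrite -subr_eq0 -sqrf_eq0 eq_le sqr_ge0 andbT.
have ac : continuous (fun w => a w v : R).
  apply: (@lipschitz_cts _ _ _ _ (Num.sqrt (K * a v v))) => w w'.
  have K0 : 0 <= K * a v v.
    apply: le_trans (sqr_ge0 (d * `|v|)) _.
    have [->|v0] := eqVneq v 0; first by rewrite !(psdE ha) normr0 !mulr0 expr0n.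
    have dK : d <= K.
      by have := le_trans (alo v) (ahi v); rewrite ler_pM2r// exprn_gt0// normr_gt0.
    rewrite exprMn expr2 -mulrA; by apply: ler_pM (ltW d0) _ dK (alo v); rewrite mulr_ge0 ?sqr_ge0 ?ltW.
  rewrite -(@ler_pXn2r _ 2)// ?nnegrE ?mulr_ge0 ?sqrtr_ge0//.
  rewrite exprMn sqr_sqrtr// real_normK ?num_real//.
  have -> : a w v - a w' v = a (w - w') v by rewrite !(psdE ha).
  apply: (le_trans (psd_CS ha _ _)); rewrite mulrAC.
  by rewrite ler_wpM2r ?psd_ge0.
have h1 : (a (u k) v - l v) ^+ 2 @[k --> \oo] --> (a (limn u) v - l v) ^+ 2.
  apply: (@continuous_cvg _ _ _ _ _ _ (fun x : R => x ^+ 2)); first exact: exprn_continuous.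
  apply: cvgB; last exact: cvg_cst.
  by apply: (@continuous_cvg _ _ _ _ _ _ (fun w => a w v)) => //; exact: ac.
have h2 : a v v * k.+1%:R^-1 @[k --> \oo] --> 0.
  by rewrite -(mulr0 (a v v)); apply: cvgM; [exact: cvg_cst|exact: cvg_harmonic].
by apply: ler_cvg_to h1 h2 _; apply: nearW => k; exact: res.
Qed.

Lemma riesz (R : realType) (H : hilbert R) (L : R) (l : H -> R) :
  (forall u v, l (u + v) = l u + l v) -> (forall t u, l (t *: u) = t * l u) ->
  (forall u, `|l u| <= L * `|u|) -> exists v, forall u, hdot v u = l u.
Proof.
by apply: (@lax_milgram _ _ _ 1 1) => // [|u|u]; rewrite ?hdot_norm ?mul1r//; exact: hdot_psd.
Qed.

(** * Expectations of almost surely bounded functions *)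

Section Mean.
Context d (Omega : measurableType d) (R : realType) (P : probability Omega R).
Implicit Types (f g : Omega -> R) (A : set Omega).

Definition aebounded f : Prop :=
  measurable_fun setT f /\ exists b : R, {ae P, forall o, `|f o| <= b}.

Definition mean f : R := fine 'E_P[f]%E.

Lemma aeb_cst (c : R) : aebounded (cst c).
Proof. by split; [exact: measurable_cst|exists `|c|; exact: aeW]. Qed.

Lemma aebD f g : aebounded f -> aebounded g -> aebounded (fun o => f o + g o).
Proof.
move=> [mf [b fb]] [mg [c gc]]; split; first exact: measurable_funD.
exists (b + c); apply: filterS2 fb gc => o fo go.
exact: le_trans (ler_normD _ _) (lerD fo go).
Qed.

Lemma aebM f g : aebounded f -> aebounded g -> aebounded (fun o => f o * g o).
Proof.
move=> [mf [b fb]] [mg [c gc]]; split; first exact: measurable_funM.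
exists (b * c); apply: filterS2 fb gc => o fo go.
by rewrite normrM ler_pM.
Qed.

Lemma aebZ c f : aebounded f -> aebounded (fun o => c * f o).
Proof. exact: aebM (aeb_cst c). Qed.

Lemma aebN f : aebounded f -> aebounded (fun o => - f o).
Proof. by move=> hf; under eq_fun do rewrite -mulN1r; exact: aebZ. Qed.

Lemma aebB f g : aebounded f -> aebounded g -> aebounded (fun o => f o - g o).
Proof. by move=> hf hg; apply: aebD => //; exact: aebN. Qed.

Lemma aeb_sum (I : Type) (s : seq I) (F : I -> Omega -> R) :
  (forall i, aebounded (F i)) -> aebounded (fun o => \sum_(i <- s) F i o).
Proof.
move=> hF; elim: s => [|i s ih].
  by under eq_fun do rewrite big_nil; exact: aeb_cst.
by under eq_fun do rewrite big_cons; exact: aebD.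
Qed.

Lemma aeb_indic A : measurable A -> aebounded (\1_A : Omega -> R).
Proof.
move=> mA; split; first exact: measurable_indic.
exists 1; apply: aeW => o; rewrite indicE.
by case: (_ \in _); rewrite ?normr1// normr0 ler01.
Qed.

Lemma aeb_integrable f : aebounded f -> P.-integrable setT (EFin \o f).
Proof.
move=> [mf [b fb]]; apply/integrableP; split; first exact/measurable_EFinP.
apply: (@le_lt_trans _ _ (\int[P]_x (cst `|b|%:E x))%E).
  apply: ae_ge0_le_integral => //.
  - by apply: measurableT_comp => //; exact/measurable_EFinP.
  - by move=> o _ /=; rewrite lee_fin.
  - apply: filterS fb => o fo _ /=; rewrite lee_fin.
    exact: le_trans fo (ler_norm _).
by rewrite integral_cst//= probability_setT mule1 ltry.
Qed.

Lemma meanE f : aebounded f -> 'E_P[f]%E = (mean f)%:E.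
Proof.
move=> hf; rewrite /mean fineK// expectation.unlock.
exact: integrable_fin_num (aeb_integrable hf).
Qed.

Lemma meanD f g : aebounded f -> aebounded g ->
  mean (fun o => f o + g o) = mean f + mean g.
Proof.
move=> hf hg; apply: EFin_inj; rewrite -(meanE (aebD hf hg)) EFinD -!meanE//.
by rewrite expectation.unlock; exact: integralD_EFin (aeb_integrable hf) (aeb_integrable hg).
Qed.

Lemma meanZ c f : aebounded f -> mean (fun o => c * f o) = c * mean f.
Proof.
move=> hf; apply: EFin_inj; rewrite -(meanE (aebZ c hf)) EFinM -!meanE//.
rewrite expectation.unlock; under eq_integral do rewrite EFinM.
by apply: integralZl => //; exact: aeb_integrable.
Qed.

Lemma mean_cst (c : R) : mean (fun=> c) = c.
Proof. by rewrite /mean expectation_cst. Qed.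

Lemma meanN f : aebounded f -> mean (fun o => - f o) = - mean f.
Proof.
by move=> hf; under eq_fun do rewrite -mulN1r; rewrite meanZ// mulN1r.
Qed.

Lemma meanB f g : aebounded f -> aebounded g ->
  mean (fun o => f o - g o) = mean f - mean g.
Proof. by move=> hf hg; rewrite meanD ?meanN//; exact: aebN. Qed.

Lemma mean_sum (I : Type) (s : seq I) (F : I -> Omega -> R) :
  (forall i, aebounded (F i)) ->
  mean (fun o => \sum_(i <- s) F i o) = \sum_(i <- s) mean (F i).
Proof.
move=> hF; elim: s => [|i s ih].
  by under eq_fun do rewrite big_nil; rewrite big_nil mean_cst.
under eq_fun do rewrite big_cons; rewrite big_cons -ih; apply: meanD => //.
exact: aeb_sum.
Qed.

Lemma mean_indic A : measurable A -> mean \1_A = fine (P A).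
Proof. by move=> mA; rewrite /mean expectation_indic. Qed.

Lemma mean_ae_eq f g : aebounded f -> aebounded g ->
  {ae P, forall o, f o = g o} -> mean f = mean g.
Proof.
move=> [mf _] [mg _] fg; rewrite /mean expectation.unlock; congr fine.
apply: ae_eq_integral => //; [exact/measurable_EFinP|exact/measurable_EFinP|].
by apply: filterS fg => o -> _.
Qed.

Lemma mean_ge0 f : aebounded f -> {ae P, forall o, 0 <= f o} -> 0 <= mean f.
Proof.
move=> hf f0; have -> : mean f = mean (fun o => `|f o|).
  apply: mean_ae_eq => //; last by apply: filterS f0 => o fo; rewrite ger0_norm.
  case: hf => mf [b fb]; split; first exact: measurableT_comp.
  by exists b; apply: filterS fb => o fo; rewrite normr_id.
by rewrite /mean expectation.unlock fine_ge0// integral_ge0// => o _; rewrite lee_fin.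
Qed.

Lemma mean_le f g : aebounded f -> aebounded g ->
  {ae P, forall o, f o <= g o} -> mean f <= mean g.
Proof.
move=> hf hg fg; rewrite -subr_ge0 -meanB//; apply: mean_ge0; first exact: aebB.
by apply: filterS fg => o; rewrite subr_ge0.
Qed.

Lemma mean_norm_le f (b : R) : aebounded f -> {ae P, forall o, `|f o| <= b} ->
  `|mean f| <= b.
Proof.
move=> hf fb; rewrite ler_norml -{1}(mean_cst (- b)) -{2}(mean_cst b).
by apply/andP; split; apply: mean_le => //; try exact: aeb_cst;
  apply: filterS fb => o; rewrite ler_norml => /andP[].
Qed.

Lemma mean_cvg (f_ : nat -> Omega -> R) f (b : R) :
  (forall k, measurable_fun setT (f_ k)) ->
  (forall k, {ae P, forall o, `|f_ k o| <= b}) -> measurable_fun setT f ->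
  {ae P, forall o, f_ k o @[k --> \oo] --> f o} ->
  mean (f_ k) @[k --> \oo] --> mean f.
Proof.
move=> mf_ fb mf cf.
have [||||intf _ h] := @dominated_convergence _ Omega R P setT measurableT
  (fun k o => (f_ k o)%:E) (EFin \o f) (cst `|b|%:E) _ _ _ (aeb_integrable (aeb_cst _)).
- by move=> k; exact/measurable_EFinP.
- exact/measurable_EFinP.
- by apply: filterS cf => o fo _; apply: cvg_EFin; [exact: nearW|exact: fo].
- apply: filterS (ae_foralln fb) => o fo k _; rewrite lee_fin.
  exact: le_trans (fo k) (ler_norm b).
rewrite /mean expectation.unlock; apply: fine_cvg.
by rewrite fineK//; exact: integrable_fin_num.
Qed.

End Mean.

(** * Eigenvectors of covariance operators *)

Section PsdOperator.
Context (R : realType) (H : hilbert R) (A : H -> H).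
Hypothesis hA : psd_form (fun u v => hdot (A u) v).

Lemma opD u v : A (u + v) = A u + A v.
Proof. by apply: hdot_eqP => w; rewrite hdotE (psdD hA). Qed.

Lemma opZ t u : A (t *: u) = t *: A u.
Proof. by apply: hdot_eqP => w; rewrite hdotE (psdZ hA). Qed.

Lemma opB u v : A (u - v) = A u - A v.
Proof. by rewrite -scaleN1r opD opZ scaleN1r. Qed.

Lemma op0 : A 0 = 0.
Proof. by rewrite -(scale0r 0) opZ !scale0r. Qed.

Lemma op_sym u v : hdot (A u) v = hdot u (A v).
Proof. by rewrite (psdC hA) hdotC. Qed.

Context (K : R) (AK : forall u, hdot (A u) u <= K * `|u| ^+ 2).

Lemma op_sqr u : `|A u| ^+ 2 <= K * hdot (A u) u.
Proof.
have [->|n0] := eqVneq (A u) 0.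
  by rewrite normr0 expr0n/= psd0l ?mulr0//; exact: hdot_psd.
have p0 : 0 < `|A u| ^+ 2 by rewrite exprn_gt0// normr_gt0.
rewrite -(ler_pM2r p0) -{1 2}hdot_norm -expr2.
apply: (le_trans (psd_CS hA u (A u))).
by rewrite mulrAC (mulrC (K * _)); apply: ler_wpM2l; [exact: psd_ge0 hA u|exact: AK].
Qed.

Lemma op_norm u : `|A u| <= K * `|u|.
Proof.
have [->|n0] := eqVneq (A u) 0.
  have [->|u0] := eqVneq u 0; first by rewrite !normr0 mulr0.
  rewrite normr0; have := le_trans (psd_ge0 hA u) (AK u).
  by rewrite !pmulr_lge0 ?exprn_gt0 ?normr_gt0.
have p0 : 0 < `|A u| by rewrite normr_gt0.
have [K0|K0] := leP 0 K; last first.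
  have := le_trans (sqr_ge0 _) (op_sqr u); rewrite nmulr_rge0// => h0.
  have e0 : hdot (A u) u = 0 by apply/eqP; rewrite eq_le h0 (psd_ge0 hA).
  by have := op_sqr u; rewrite e0 mulr0 leNgt exprn_gt0.
rewrite -(ler_pM2r p0) -expr2; apply: (le_trans (op_sqr u)).
by rewrite -mulrA; apply: ler_wpM2l => //; rewrite (mulrC `|u|); exact: hdot_le.
Qed.

Lemma op_cts : continuous A.
Proof.
apply: (@lipschitz_cts _ _ _ _ K) => u v; rewrite -opB; exact: op_norm.
Qed.

End PsdOperator.

Section PowerIteration.
Context (R : realType) (H : hilbert R) (A : H -> H).
Hypothesis hA : psd_form (fun u v => hdot (A u) v).
Hypothesis A1 : forall u, hdot (A u) u <= `|u| ^+ 2.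

Let A1' u : hdot (A u) u <= 1 * `|u| ^+ 2. Proof. by rewrite mul1r. Qed.

Lemma iter_sym n u v : hdot (iter n A u) v = hdot u (iter n A v).
Proof.
by elim: n u v => //= n ih u v; rewrite op_sym// ih -iterS iterSr.
Qed.

Lemma iter_add k l u : hdot (iter k A u) (iter l A u) = hdot (iter (k + l) A u) u.
Proof. by rewrite -iter_sym -iterD addnC. Qed.

Lemma iterSS n u : hdot (iter n.+2 A u) u = hdot (iter n A (A u)) (A u).
Proof. by rewrite iterS op_sym// iterSr. Qed.

Lemma iter_psd n : psd_form (fun u v => hdot (iter n A u) v).
Proof.
split=> [u v w|t u v|u v|].
- by elim: n u v w => [|n ih] u v w; rewrite ?hdotE// !iterSr opD// ih.
- by elim: n u v => [|n ih] u v; rewrite ?hdotE// !iterSr opZ// ih.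
- by rewrite iter_sym hdotC.
- have [n2] := ubnP n; elim: n2 n => // n2 ih [|[|n]] n_lt u.
  + by rewrite /= hdot_norm sqr_ge0.
  + exact: psd_ge0 hA u.
  + by rewrite iterSS; apply: ih; exact: ltnW.
Qed.

Lemma iter_noninc n u : hdot (iter n.+1 A u) u <= hdot (iter n A u) u.
Proof.
have [n2] := ubnP n; elim: n2 n u => // n2 ih [|[|n]] u n_lt.
- by rewrite /= hdot_norm.
- rewrite /= op_sym// hdot_norm; have := op_sqr hA A1' u; by rewrite mul1r.
- by rewrite !iterSS; apply: ih; exact: ltnW.
Qed.

Lemma iter_le k l u : (k <= l)%N -> hdot (iter l A u) u <= hdot (iter k A u) u.
Proof.
move=> kl; rewrite -(subnK kl); elim: (l - k)%N => // i ih.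
exact: le_trans (iter_noninc _ _) ih.
Qed.

Lemma iter_cvg u : cvgn (fun k => iter k A u).
Proof.
pose m k := hdot (iter k A u) u.
pose L := inf (range (fun k => m k.*2)).
have cm : (fun k => m k.*2) @ \oo --> L.
  apply: nonincreasing_cvgn.
    by move=> k l kl; apply: iter_le; rewrite leq_double.
  by exists 0 => _ [k _ <-]; exact: psd_ge0 (iter_psd _) u.
have Lm k : L <= m k.*2.
  apply: ge_inf; last by exists k.
  by exists 0 => _ [j _ <-]; exact: psd_ge0 (iter_psd _) u.
apply: (@sqdist_cvg _ _ _ (fun k => m k.*2 - L)); last first.
  by rewrite -(subrr L); apply: cvgB => //; exact: cvg_cst.
move=> k l kl; rewrite normB_sqr -!hdot_norm !iter_add !addnn.
have := iter_le u (_ : (k + l <= l.*2)%N); rewrite -addnn leq_add2r => /(_ kl).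
have := Lm l; rewrite /m addnn; lra.
Qed.

Lemma iter_lim_fixed u : A (limn (fun k => iter k A u)) = limn (fun k => iter k A u).
Proof.
set v := limn _.
have h1 : iter k.+1 A u @[k --> \oo] --> v.
  have := @iter_cvg u; rewrite -(@cvg_shiftS _ (fun k => iter k A u)); exact.
have h2 : A (iter k A u) @[k --> \oo] --> A v.
  apply: (@continuous_cvg _ _ _ _ _ _ A); last exact: iter_cvg.
  exact: (op_cts hA A1').
exact: (cvg_unique _ h2 h1).
Qed.

Lemma iter_dyadic i u : `|u| <= 1 ->
  hdot (A u) u ^+ (2 ^ i) <= hdot (iter (2 ^ i) A u) u.
Proof.
move=> u1; elim: i => [|i ih]; first by rewrite expr1.
rewrite expnS mulnC exprM; apply: (@le_trans _ _ (hdot (iter (2 ^ i) A u) u ^+ 2)).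
  by rewrite ler_pXn2r ?nnegrE ?exprn_ge0 ?(psd_ge0 hA) ?(psd_ge0 (iter_psd _) u).
rewrite muln2 -addnn -iter_add hdot_norm -(real_normK (num_real _)).
rewrite ler_pXn2r ?nnegrE//; apply: (le_trans (hdot_CS _ _)).
by rewrite ler_piMr.
Qed.

End PowerIteration.

Lemma bernoulli_ineq (R : realFieldType) (x : R) k : 0 <= x <= 1 ->
  1 - x *+ k <= (1 - x) ^+ k.
Proof.
move=> /andP[x0 x1]; elim: k => [|k ih]; first by rewrite subr0 expr0.
rewrite exprS; apply: (@le_trans _ _ ((1 - x) * (1 - x *+ k))).
  rewrite mulrS; have : 0 <= x * (x *+ k) by rewrite mulr_ge0 ?mulrn_wge0.
  by lra.
by apply: ler_wpM2l => //; rewrite subr_ge0.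
Qed.

Section BoundedElement.
Context d (Omega : measurableType d) (R : realType) (P : probability Omega R).
Context (H : hilbert R).

Record bounded_element (Y : Omega -> H) (b : R) : Prop := BoundedElement {
  be_meas : forall g : H -> R, continuous g ->
    measurable_fun setT (fun o => g (Y o));
  be_bnd : {ae P, forall o, `|Y o| <= b} }.

Definition cov_op (Y : Omega -> H) (A : H -> H) : Prop :=
  forall u v, mean P (fun o => hdot (Y o) u * hdot (Y o) v) = hdot (A u) v.

Lemma ae_witness (Q : Omega -> Prop) : {ae P, forall o, Q o} -> exists o, Q o.
Proof.
move=> h; apply: contrapT => /forallNP nQ.
have : P setT = 0%E.
  apply: measure_negligible => //; case: h => N [mN N0 sN].
  exists N; split => //; apply: subset_trans sN => o _; exact: nQ.
by rewrite probability_setT => /eqP; rewrite onee_eq0.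
Qed.

Lemma be_bnd_ge0 Y b : bounded_element Y b -> 0 <= b.
Proof. by move=> /be_bnd /ae_witness [w]; apply: le_trans. Qed.

Lemma be_aeb Y b (g : H -> R) (c : R) : bounded_element Y b -> continuous g ->
  (forall h, `|h| <= b -> `|g h| <= c) -> aebounded P (fun o => g (Y o)).
Proof.
move=> [mY bY] cg gc; split; first exact: mY.
by exists c; apply: filterS bY => o; exact: gc.
Qed.

Lemma be_hdot Y b u : bounded_element Y b -> aebounded P (fun o => hdot (Y o) u).
Proof.
move=> hY; apply: (@be_aeb _ _ (fun h => hdot h u) (b * `|u|) hY).
  by under eq_fun do rewrite hdotC; exact: hdot_cts.
by move=> h hb; apply: le_trans (hdot_CS _ _) _; rewrite ler_wpM2r.
Qed.

Lemma be_hdot2 Y b u v : bounded_element Y b ->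
  aebounded P (fun o => hdot (Y o) u * hdot (Y o) v).
Proof. by move=> hY; apply: aebM; exact: be_hdot hY. Qed.

Section CovOp.
Context (Y : Omega -> H) (b : R) (hY : bounded_element Y b).
Context (A : H -> H) (hA : cov_op Y A).

Lemma cov_psd : psd_form (fun u v => hdot (A u) v).
Proof.
split=> [u v w|t u v|u v|u]; rewrite -!hA.
- rewrite -meanD; [|exact: be_hdot2 hY|exact: be_hdot2 hY].
  by congr mean; apply/funext => o; rewrite hdotE mulrDl.
- rewrite -meanZ; last exact: be_hdot2 hY.
  by congr mean; apply/funext => o; rewrite hdotE mulrA.
- by congr mean; apply/funext => o; rewrite mulrC.
- apply: mean_ge0; first exact: be_hdot2 hY.
  by apply: aeW => o; rewrite -expr2 sqr_ge0.
Qed.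

Lemma cov_bnd u : hdot (A u) u <= b ^+ 2 * `|u| ^+ 2.
Proof.
rewrite -hA -(mean_cst P (b ^+ 2 * _)).
apply: mean_le; [exact: be_hdot2 hY|exact: aeb_cst|].
apply: filterS (be_bnd hY) => o bo; rewrite -expr2 -exprMn.
rewrite -(real_normK (num_real _)) ler_pXn2r ?nnegrE ?mulr_ge0 ?(be_bnd_ge0 hY)//.
by apply: (le_trans (hdot_CS _ _)); rewrite ler_wpM2r.
Qed.

End CovOp.

(* Power iteration [B ^ n] with [B = A / rho], [rho] the top of the spectrum:
   if it converged to 0 everywhere, then [E <B ^ n Y, Y> -> 0], whereas this
   expectation stays above [rho]. *)
Lemma cov_eigenvector Y b A : bounded_element Y b -> cov_op Y A ->
  (exists u, hdot (A u) u != 0) ->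
  exists2 rho : R, rho != 0 & exists2 v, v != 0 & A v = rho *: v.
Proof.
move=> hY hA [u0 u0A].
have pA := cov_psd hY hA; have bA := cov_bnd hY hA.
pose S := [set hdot (A u) u | u in [set u : H | `|u| <= 1]].
have supS : has_sup S.
  split; first by exists (hdot (A 0) 0), 0 => //=; rewrite normr0.
  exists (b ^+ 2) => _ [u /= u1 <-]; apply: (le_trans (bA u)).
  by rewrite ler_piMr ?sqr_ge0// exprn_ile1.
pose rho := sup S.
have Arho u : hdot (A u) u <= rho * `|u| ^+ 2.
  have [->|nu] := eqVneq u 0; first by rewrite op0// !hdotE normr0 expr0n mulr0.
  have pu : 0 < `|u| by rewrite normr_gt0.
  rewrite -ler_pdivrMr ?exprn_gt0//; apply: ub_le_sup; first by case: supS.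
  exists (`|u|^-1 *: u); first by rewrite /= normrZ ger0_norm ?invr_ge0// mulVf ?gt_eqF.
  by rewrite opZ// !hdotE mulrA mulrC -expr2 exprVn.
have rho0 : 0 < rho.
  have nu : u0 != 0.
    by apply: contra_neq u0A => ->; rewrite op0// hdotE.
  have : 0 < rho * `|u0| ^+ 2.
    by apply: lt_le_trans (Arho u0); rewrite lt_neqAle eq_sym u0A (psd_ge0 pA).
  by rewrite pmulr_lgt0 ?exprn_gt0 ?normr_gt0.
pose B u := rho^-1 *: A u.
have pB : psd_form (fun u v => hdot (B u) v).
  split=> [u v w|t u v|u v|u]; rewrite /B !hdotE.
  - by rewrite (psdD pA) mulrDr.
  - by rewrite (psdZ pA) mulrCA.
  - by rewrite (psdC pA).
  - by rewrite mulr_ge0 ?(psd_ge0 pA)// invr_ge0 ltW.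
have B1 u : hdot (B u) u <= `|u| ^+ 2.
  by rewrite /B !hdotE ler_pdivrMl.
have [[u lu]|] := pselect (exists u, limn (fun k => iter k B u) != 0).
  exists rho; first by rewrite gt_eqF.
  exists (limn (fun k => iter k B u)) => //.
  by rewrite -{2}(iter_lim_fixed pB B1 u) /B scalerA mulfV ?gt_eqF// scale1r.
move=> /forallNP lim0; exfalso.
have g0 u : hdot (iter k B u) u @[k --> \oo] --> 0.
  have -> : 0 = hdot u (limn (fun k => iter k B u)).
    by have /negP := lim0 u; rewrite negbK => /eqP ->; rewrite psd0r//; exact: hdot_psd.
  under eq_fun do rewrite hdotC.
  apply: (@continuous_cvg _ _ _ _ _ _ (hdot u)); last exact: (iter_cvg pB B1).
  exact: hdot_cts.
pose g k o := hdot (iter k B (Y o)) (Y o).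
have itB k u : `|iter k B u| <= `|u|.
  elim: k => //= k; apply: le_trans.
  by have := op_norm pB (K := 1) _ (iter k B u); rewrite mul1r; apply => v; rewrite mul1r.
have ctsB k : continuous (fun h : H => hdot (iter k B h) h : R).
  apply: hdot_comp_cts; last by move=> h; exact: cvg_id.
  apply: (@lipschitz_cts _ _ _ _ 1) => v w.
  rewrite mul1r; have <- : iter k B (v - w) = iter k B v - iter k B w.
    by elim: k => //= k ->; rewrite opB.
  exact: itB.
have gb k h : `|h| <= b -> `|hdot (iter k B h) h| <= b ^+ 2.
  move=> hb; apply: (le_trans (hdot_CS _ _)); rewrite expr2.
  by apply: ler_pM => //; apply: le_trans (itB _ _) hb.
have aebg k : aebounded P (g k) := be_aeb hY (@ctsB k) (@gb k).
have cg : mean P (g k) @[k --> \oo] --> 0.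
  rewrite -(mean_cst P 0); apply: (@mean_cvg _ _ _ _ _ _ (b ^+ 2)).
  - by move=> k; case: (aebg k).
  - by move=> k; apply: filterS (be_bnd hY) => o; exact: gb.
  - exact: measurable_cst.
  - by apply: aeW => o; exact: g0.
have low k u : `|u| <= 1 -> rho * hdot (iter k.*2.+1 B u) u <= mean P (g k).
  move=> u1.
  have -> : rho * hdot (iter k.*2.+1 B u) u
      = mean P (fun o => hdot (Y o) (iter k B u) * hdot (Y o) (iter k B u)).
    rewrite hA -addnn -addnS -iter_add// iterS; set w := iter k B u.
    by rewrite hdotC {1}/B !hdotE mulrA mulfV ?mul1r ?gt_eqF.
  apply: mean_le => //; first exact: be_hdot2 hY.
  apply: aeW => o; rewrite -expr2 hdotC iter_sym// hdotC.
  apply: (le_trans (psd_CS (iter_psd pB k) (Y o) u)).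
  rewrite ler_piMr ?(psd_ge0 (iter_psd pB k))//.
  apply: (le_trans (hdot_le _ _)); rewrite mulr_ile1 //.
  exact: le_trans (itB _ _) u1.
have [N _ hN] := cvgr_lt _ cg _ (divr_gt0 rho0 (ltr0n R 2)).
have {}hN := hN N (leqnn _).
pose k := (2 ^ N.+1)%N.
have k0 : (0 < k)%N by rewrite expn_gt0.
pose e : R := (2 * k%:R)^-1.
have e0 : 0 < e by rewrite invr_gt0 mulr_gt0 ?ltr0n.
have [_ [u u1 <-]] := sup_adherent (mulr_gt0 rho0 e0) supS.
rewrite -/rho => hu.
have hu' : 1 - e <= hdot (B u) u.
  rewrite /B hdotE ler_pdivlMl// mulrBr mulr1; exact: ltW.
have e1 : e <= 1.
  rewrite invf_le1 ?mulr_gt0 ?ltr0n//; rewrite -natrM ler1n muln_gt0 k0//.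
have : 1 / 2 <= hdot (iter N.*2.+1 B u) u.
  apply: (@le_trans _ _ (hdot (iter k B u) u)); last first.
    apply: iter_le => //; by rewrite /k expnS mul2n ltn_double ltn_expl.
  apply: le_trans (iter_dyadic pB N.+1 u1).
  apply: (@le_trans _ _ ((1 - e) ^+ k)); last first.
    by rewrite ler_pXn2r ?nnegrE ?subr_ge0//; exact: psd_ge0 pB u.
  apply: le_trans (bernoulli_ineq k (_ : 0 <= e <= 1)); last by rewrite ltW.
  have -> : e *+ k = 2^-1.
    by rewrite -[e *+ k]mulr_natr /e invfM -mulrA mulVf ?mulr1// pnatr_eq0 -lt0n.
  lra.
move=> half; have := low N u u1; apply/negP; rewrite -ltNge; apply: (lt_le_trans hN).
by apply: ler_wpM2l; [exact: ltW|rewrite -(mul1r 2^-1)].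
Qed.

End BoundedElement.

Lemma span_dependent (R : fieldType) (V : lmodType R) (m k : nat)
    (v : 'I_m -> V) (b : 'I_k -> V) : (k < m)%N ->
  (forall i, exists c : 'I_k -> R, v i = \sum_j c j *: b j) ->
  exists2 e : 'I_m -> R, (exists i, e i != 0) & \sum_i e i *: v i = 0.
Proof.
move=> km /choice[c vc].
pose C := \matrix_(i < m, j < k) c i j.
have : kermx C != 0.
  rewrite -mxrank_eq0 mxrank_ker subn_eq0 -ltnNge.
  exact: leq_ltn_trans (rank_leq_col C) km.
move=> /rowV0Pn[e /sub_kermxP eC e0].
exists (e 0).
  apply: contrapT => /forallNP h; case/negP: e0; apply/eqP/rowP => i.
  by rewrite mxE; apply/eqP/negPn/negP; exact: h.
under eq_bigr => i _ do rewrite vc scaler_sumr.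
rewrite exchange_big/= big1// => j _.
under eq_bigr => i _ do rewrite scalerA.
rewrite -scaler_suml; have := congr1 (fun M : 'rV_k => M 0 j) eC.
by rewrite !mxE; under eq_bigr => i _ do rewrite mxE; move=> ->; rewrite scale0r.
Qed.

Section Orthonormal.
Context (R : realType) (H : hilbert R).

Lemma has_dim_orthonormal (E : set H) (k : nat) : has_dim E k -> E 0 ->
  (forall t u v, E u -> E v -> E (t *: u + v)) ->
  exists o : nat -> H, [/\ forall i, (i < k)%N -> E (o i),
    forall i j, (i < k)%N -> (j < k)%N -> hdot (o i) (o j) = (i == j)%:R
  & forall v, E v -> (forall i, (i < k)%N -> hdot v (o i) = 0) -> v = 0].
Proof.
move=> [b [Eb bfree bspan]] E0 EL.
pose onb i (o : nat -> H) := (forall l, (l < i)%N -> E (o l)) /\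
    forall j l, (j < i)%N -> (l < i)%N -> hdot (o j) (o l) = (j == l)%:R.
have Esum (I : finType) (c : I -> R) (w : I -> H) : (forall i, E (w i)) ->
    E (\sum_i c i *: w i).
  move=> Ew; apply: (big_ind E) => // [x y Ex Ey|i _].
    by rewrite -(scale1r x); exact: EL.
  by rewrite -(addr0 (_ *: _)); exact: EL.
have unit (v : H) : v != 0 -> hdot (`|v|^-1 *: v) (`|v|^-1 *: v) = 1.
  by move=> v0; rewrite !hdotE hdot_norm; field; rewrite normr_eq0.
have ext i o v : onb i o -> E v -> v != 0 ->
    (forall l, (l < i)%N -> hdot v (o l) = 0) ->
    onb i.+1 (fun l => if (l < i)%N then o l else `|v|^-1 *: v).
  move=> [Eo oo] Ev v0 vo; split=> [l _|j l]; last rewrite !ltnS => ji li.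
    case: ifPn => [/Eo//|_]; rewrite -(addr0 (_ *: _)); exact: EL.
  case: ltnP => [jlt|jge]; case: ltnP => [llt|lge]; first exact: oo.
  - by rewrite hdotE hdotC vo// mulr0 ltn_eqF// (leq_trans jlt).
  - by rewrite hdotE vo// mulr0 gtn_eqF// (leq_trans llt).
  - by rewrite unit// (_ : j = l) ?eqxx//; apply/eqP; rewrite eqn_leq (leq_trans ji)//= (leq_trans li).
have [ o ho] : exists o, onb k o.
  suff : forall i, (i <= k)%N -> exists o, onb i o by apply.
  elim=> [_|i ih ik]; first by exists (fun=> 0); split.
  have [ o ho] := ih (ltnW ik).
  apply: contrapT => /forallNP no.
  have bo j : exists c : 'I_i -> R, b j = \sum_l c l *: o l.
    exists (fun l => hdot (b j) (o l)); apply/eqP; rewrite -subr_eq0.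
    set v := _ - _; apply/negPn/negP => v0; apply: (no _ (ext i o v ho _ v0 _)).
      rewrite /v addrC -scaleN1r; apply: EL => //; apply: Esum => l.
      by case: ho => + _; apply.
    move=> l li; rewrite /v !hdotE psd_suml ?hdot_psd//; last exact: hdot_psd.
    rewrite (bigD1 (Ordinal li))//= !hdotE (ho.2 l l)// eqxx mulr1 big1 ?addr0 ?subrr//.
    move=> l' l'l; rewrite hdotE ho.2//; case: eqVneq => [e|_]; last by rewrite mulr0.
    by case/eqP: l'l; apply: val_inj.
  have [e [i0 ei0] es] := span_dependent ik bo.
  by case/eqP: ei0; exact: bfree.
exists o; split=> [i ik|i j ik jk|v Ev vo]; [exact: ho.1|exact: ho.2|].
apply/eqP/negPn/negP => v0.
have [ o' [Eo' oo']] : exists o', onb k.+1 o' by eexists; exact: ext ho Ev v0 vo.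
have [i|e [i ei] es] := @span_dependent _ H k.+1 k (fun i => o' i) b (leqnn _).
  by apply: bspan; exact: Eo'.
have := congr1 (hdot^~ (o' i)) es; rewrite (psd0l (hdot_psd H)) psd_suml; last exact: hdot_psd.
rewrite (bigD1 i)//= hdotE oo'// eqxx mulr1 big1 ?addr0; first by move/eqP; exact/negP.
move=> l li; rewrite hdotE oo'//; case: eqVneq => [e'|_]; last by rewrite mulr0.
by case/eqP: li; apply: val_inj.
Qed.

Lemma eigenbasis (J : H -> H) (lambda : nat -> R) :
  psd_form (fun u v => hdot (J u) v) -> eigenvalue_seq J lambda ->
  (forall j, 0 <= lambda j) /\ exists u : nat -> H,
  [/\ forall j, J (u j) = lambda j *: u j,
      forall j, `|u j| = (lambda j != 0)%:R,
      forall i j, i != j -> hdot (u i) (u j) = 0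
    & forall rho v, rho != 0 -> J v = rho *: v ->
        (forall j, hdot v (u j) = 0) -> v = 0].
Proof.
move=> pJ hlam.
have basis rho : exists g : nat -> H, rho != 0 ->
  [/\ forall j, lambda j = rho -> J (g j) = rho *: g j /\ hdot (g j) (g j) = 1,
      forall i j, lambda i = rho -> lambda j = rho -> i != j -> hdot (g i) (g j) = 0
    & forall v, J v = rho *: v -> (forall j, lambda j = rho -> hdot v (g j) = 0) -> v = 0].
  have [->|rho0] := eqVneq rho 0; first by exists (fun=> 0).
  have [k [hk /card_set_bijP[f [f1 f2 f3]]]] := hlam rho rho0.
  have [|t u v|o [Eo oo oc]] := has_dim_orthonormal hk.
  - by rewrite /eigenvectors/= op0// scaler0.
  - by rewrite /eigenvectors/= opD// opZ// => -> ->; rewrite scalerDr !scalerA mulrC.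
  exists (fun j => o (f j)) => _; split=> [j jr|i j ir jr ij|v Jv vo].
  - have fj := f1 j jr; split; first exact: Eo.
    by rewrite oo ?eqxx.
  - rewrite oo ?(f1 i ir) ?(f1 j jr)//; case: eqVneq => // fij.
    by case/eqP: ij; apply: f2 => //; rewrite inE.
  - by apply: oc => // i ik; have [j /= jr <-] := f3 i ik; exact: vo.
have lam0 j : 0 <= lambda j.
  have [->//|lj] := eqVneq (lambda j) 0.
  have [g /(_ lj)[/(_ j erefl)[Jg gg] _ _]] := basis (lambda j).
  by have := psd_ge0 pJ (g j); rewrite Jg hdotE gg mulr1.
split=> //; have /choice[g hg] := basis.
pose u j := if lambda j == 0 then 0 else g (lambda j) j.
have Ju j : J (u j) = lambda j *: u j.
  rewrite /u; case: eqVneq => [->|lj]; first by rewrite op0// scale0r.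
  by have [/(_ j erefl)[]] := hg _ lj.
exists u; split=> // [j|i j ij|rho v rho0 Jv vu].
- rewrite /u; case: eqVneq => [_|lj]; first by rewrite normr0.
  have [/(_ j erefl)[_ + _ _]] := hg _ lj.
  by rewrite hdot_norm => /eqP; rewrite sqrf_eq1 => /orP[/eqP//|/eqP e]; have := normr_ge0 (g (lambda j) j); rewrite e ler0N1.
- have [lij|lij] := eqVneq (lambda i) (lambda j); last first.
    have := op_sym pJ (u i) (u j); rewrite !Ju !hdotE => /eqP.
    by rewrite -subr_eq0 -mulrBl mulf_eq0 subr_eq0 (negbTE lij)/= => /eqP.
  rewrite /u -lij; case: eqVneq => [_|li]; first by rewrite hdotE.
  by have [_ + _] := hg _ li; apply.
- have [_ _] := hg _ rho0; apply=> // j jr.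
  by have := vu j; rewrite /u jr (negbTE rho0).
Qed.

End Orthonormal.

Section Residual.
Context (R : realType) (H : hilbert R) (u : nat -> H).
Hypothesis u_orth : forall i j, i != j -> hdot (u i) (u j) = 0.
Hypothesis u_norm : forall j, `|u j| = (u j != 0)%:R.

Definition resid_seq k (v : H) : H := v - \sum_(j < k) hdot v (u j) *: u j.

Definition resid (v : H) : H := limn (resid_seq^~ v).

Lemma hdot_resid_seq k v w :
  hdot (resid_seq k v) w = hdot v w - \sum_(j < k) hdot v (u j) * hdot w (u j).
Proof.
rewrite /resid_seq !hdotE psd_suml; last exact: hdot_psd.
by congr (_ - _); apply: eq_bigr => j _; rewrite hdotE (hdotC (u j)).
Qed.

Lemma hdot_unit v j : hdot v (u j) * hdot (u j) (u j) = hdot v (u j).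
Proof.
rewrite hdot_norm u_norm; case: eqVneq => [->|_]; last by rewrite expr1n mulr1.
by rewrite hdotE mul0r.
Qed.

Lemma resid_seq_orth k v j : (j < k)%N -> hdot (resid_seq k v) (u j) = 0.
Proof.
move=> jk; rewrite hdot_resid_seq (bigD1 (Ordinal jk))//= hdot_unit.
rewrite big1 ?addr0 ?subrr// => i ij; rewrite u_orth ?mulr0//.
by apply: contra_neq ij => ji; apply: val_inj.
Qed.

Lemma resid_seqB k l v : (k <= l)%N ->
  `|resid_seq k v - resid_seq l v| ^+ 2
  = `|resid_seq k v| ^+ 2 - `|resid_seq l v| ^+ 2.
Proof.
move=> kl; rewrite normB_sqr.
have -> : hdot (resid_seq k v) (resid_seq l v) = `|resid_seq l v| ^+ 2.
  have -> : resid_seq k v = resid_seq l v + \sum_(k <= j < l) hdot v (u j) *: u j.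
    rewrite /resid_seq -!(big_mkord xpredT (fun j => hdot v (u j) *: u j)).
    by rewrite (big_cat_nat (leq0n _) kl)/= opprD addrA subrK.
  rewrite hdotDl hdot_norm psd_suml; last exact: hdot_psd.
  rewrite big_nat_cond big1 ?addr0// => j /andP[/andP[_ jl] _].
  by rewrite hdotZl (hdotC (u j)) resid_seq_orth// mulr0.
by ring.
Qed.

Lemma resid_cvg v : resid_seq k v @[k --> \oo] --> resid v.
Proof.
pose q k := `|resid_seq k v| ^+ 2.
have q_ni k l : (k <= l)%N -> q l <= q k.
  by move=> kl; rewrite -subr_ge0 -resid_seqB// sqr_ge0.
have q_lb : has_lbound (range q) by exists 0 => _ [k _ <-]; exact: sqr_ge0.
pose L := inf (range q).
apply: (@sqdist_cvg _ _ (fun k => resid_seq k v) (fun k => q k - L)).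
  move=> k l kl; rewrite resid_seqB// lerB//; apply: ge_inf => //; by exists l.
rewrite -(subrr L); apply: cvgB; last exact: cvg_cst.
by apply: nonincreasing_cvgn => // k l; exact: q_ni.
Qed.

Lemma hdot_resid_cvg v w : hdot (resid_seq k v) w @[k --> \oo] --> hdot (resid v) w.
Proof.
rewrite hdotC; under eq_fun do rewrite hdotC.
apply: (@continuous_cvg _ _ _ _ _ _ (hdot w)); last exact: resid_cvg.
exact: hdot_cts.
Qed.

Lemma resid_sym v w : hdot (resid v) w = hdot v (resid w).
Proof.
have h : hdot (resid_seq k v) w @[k --> \oo] --> hdot v (resid w).
  rewrite [X in _ --> X]hdotC.
  rewrite (_ : (fun k => _) = fun k => hdot (resid_seq k w) v); first exact: hdot_resid_cvg.
  apply/funext => k; rewrite !hdot_resid_seq hdotC; congr (_ - _).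
  by apply: eq_bigr => j _; rewrite mulrC.
by rewrite -(cvg_lim (@Rhausdorff R) h) (cvg_lim (@Rhausdorff R) (@hdot_resid_cvg v w)).
Qed.

Lemma resid_orth v j : hdot (resid v) (u j) = 0.
Proof.
have h : hdot (resid_seq k v) (u j) @[k --> \oo] --> 0.
  by apply: cvg_near_cst; exists j.+1 => // k /= jk; exact: resid_seq_orth.
by rewrite -(cvg_lim (@Rhausdorff R) h) (cvg_lim (@Rhausdorff R) (@hdot_resid_cvg v (u j))).
Qed.

Lemma resid_id v : (forall j, hdot v (u j) = 0) -> resid v = v.
Proof.
move=> vu; rewrite /resid (_ : resid_seq^~ v = cst v) ?lim_cst//.
apply/funext => k; rewrite /resid_seq big1 ?subr0// => j _.
by rewrite vu scale0r.
Qed.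

Lemma resid_idem v : resid (resid v) = resid v.
Proof. by apply: resid_id => j; exact: resid_orth. Qed.

Lemma hdot_resid v : hdot (resid v) v = `|resid v| ^+ 2.
Proof. by rewrite -{1}resid_idem resid_sym hdot_norm. Qed.

Lemma resid_psd : psd_form (fun v w => hdot (resid v) w).
Proof.
split=> [v w z|t v w|v w|v].
- by rewrite !resid_sym hdotE.
- by rewrite !resid_sym hdotE.
- by rewrite resid_sym hdotC.
- by rewrite hdot_resid sqr_ge0.
Qed.

Lemma resid_contr v : `|resid v| <= `|v|.
Proof.
have [->|r0] := eqVneq (resid v) 0; first by rewrite normr0.
rewrite -(@ler_pM2l _ `|resid v|) ?normr_gt0// -expr2 -hdot_resid.
exact: hdot_le.
Qed.

Lemma resid_cts : continuous resid.
Proof.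
by apply: (op_cts resid_psd (K := 1)) => v; rewrite mul1r hdot_resid ler_pXn2r ?nnegrE// resid_contr.
Qed.

Lemma resid_partial k v : `|v - resid_seq k v| <= `|v|.
Proof.
have := @resid_seqB 0 k v (leq0n k).
rewrite {1 3}/resid_seq big_ord0 subr0 => e.
by rewrite -(@ler_pXn2r _ 2) ?nnegrE// e gerBl sqr_ge0.
Qed.

End Residual.

Section MeanZero.
Context d (Omega : measurableType d) (R : realType) (P : probability Omega R).

Lemma mean_eq0_ae (f : Omega -> R) : aebounded P f -> (forall o, 0 <= f o) ->
  mean P f = 0 -> {ae P, forall o, f o = 0}.
Proof.
move=> hf f0 mf0; have mf := hf.1.
have : (\int[P]_o `|(f o)%:E| = 0)%E.
  have := meanE hf; rewrite mf0 expectation.unlock => h; apply: etrans h.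
  by apply: eq_integral => o _; rewrite /= ger0_norm.
move/(ae_eq_integral_abs _ measurableT (iffRL (measurable_EFinP _ _) mf)).
by apply: filterS => o /(_ I) [].
Qed.

Lemma bounded_element_comp (H : hilbert R) (Y : Omega -> H) (b : R) (h : H -> H) :
  bounded_element P Y b -> continuous h -> (forall v, `|h v| <= `|v|) ->
  bounded_element P (fun o => h (Y o)) b.
Proof.
move=> [mY bY] ch hn; split.
  by move=> g cg; apply: (mY (g \o h)) => v; apply: continuous_comp; [exact: ch|exact: cg].
by apply: filterS bY => o; exact: le_trans (hn _).
Qed.

(* The covariance operator of [resid u Y] is [resid J resid]: an eigenvector of
   it would be an eigenvector of [J] orthogonal to all the [u j]. *)
Lemma eigenbasis_complete (H : hilbert R) (Y : Omega -> H) (b : R) (J : H -> H)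
    (lambda : nat -> R) (u : nat -> H) (s : nat -> H) :
  bounded_element P Y b -> cov_op P Y J ->
  {ae P, forall o, forall e : R, 0 < e -> exists k, `|Y o - s k| < e} ->
  (forall i j, i != j -> hdot (u i) (u j) = 0) ->
  (forall j, `|u j| = (u j != 0)%:R) ->
  (forall j, J (u j) = lambda j *: u j) ->
  (forall rho v, rho != 0 -> J v = rho *: v ->
    (forall j, hdot v (u j) = 0) -> v = 0) ->
  {ae P, forall o, resid u (Y o) = 0}.
Proof.
move=> hY hJ sY uo un Ju uc.
have pJ := cov_psd hY hJ.
have hrY : bounded_element P (fun o => resid u (Y o)) b.
  by apply: bounded_element_comp hY _ _; [exact: resid_cts|exact: resid_contr].
have hA : cov_op P (fun o => resid u (Y o)) (fun v => resid u (J (resid u v))).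
  move=> v w; rewrite resid_sym// -hJ; congr mean; apply/funext => o.
  by rewrite !(resid_sym uo un (Y o)).
have A0 w : hdot (J (resid u w)) (resid u w) = 0.
  rewrite -(resid_sym uo un); apply/eqP/negPn/negP => wA.
  have [|rho rho0 [v v0 Av]] := cov_eigenvector hrY hA; first by exists w.
  have vE : v = rho^-1 *: resid u (J (resid u v)).
    by rewrite Av scalerA mulVf// scale1r.
  have vu j : hdot v (u j) = 0 by rewrite vE hdotE resid_orth// mulr0.
  case/eqP: v0; apply: (uc rho) => //; rewrite -Av (resid_id vu) resid_id// => j.
  by rewrite op_sym// Ju hdotE vu mulr0.
have Ys k : {ae P, forall o, hdot (Y o) (resid u (s k)) = 0}.
  have := A0 (s k); rewrite -hJ => /mean_eq0_ae; move=> /(_ (be_hdot2 _ _ hY)) h.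
  apply: filterS (h _) => [w|w]; last by rewrite -expr2 sqr_ge0.
  by move/eqP; rewrite mulf_eq0 orbb => /eqP.
apply: filterS3 (ae_foralln Ys) sY (be_bnd hY) => o Yo0 Yos Yb.
apply/eqP; rewrite -normr_eq0 -sqrf_eq0 -hdot_resid// eq_le (psd_ge0 (resid_psd uo un)) andbT.
apply/ler_addgt0Pr => e e0; rewrite add0r.
have b0 := be_bnd_ge0 hY.
have b1 : 0 < b + 1 by rewrite ltr_wpDl.
have [k ks] := Yos (e / (b + 1)) (divr_gt0 e0 b1).
have -> : hdot (resid u (Y o)) (Y o) = hdot (Y o) (resid u (Y o - s k)).
  have pr := resid_psd uo un.
  by rewrite (opB pr) !hdotE Yo0 subr0 -resid_sym.
apply: (le_trans (hdot_le _ _)).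
apply: (@le_trans _ _ ((b + 1) * (e / (b + 1)))); last by rewrite mulrC divfK ?gt_eqF.
apply: ler_pM => //; first by rewrite (le_trans Yb)// lerDl.
by apply: (le_trans (resid_contr uo un _)); exact: ltW.
Qed.

Lemma trace_bound (H : hilbert R) (Y : Omega -> H) (b K S : R) (C T : H -> H)
    (u : nat -> H) :
  bounded_element P Y b -> cov_op P Y C ->
  psd_form (fun v w => hdot (T v) w) ->
  (forall v, hdot (T v) v <= K * `|v| ^+ 2) ->
  (forall i j, i != j -> hdot (u i) (u j) = 0) ->
  (forall j, `|u j| = (u j != 0)%:R) ->
  {ae P, forall o, resid u (Y o) = 0} ->
  (forall k, \sum_(j < k) hdot (C (T (u j))) (u j) <= S) ->
  aebounded P (fun o => hdot (T (Y o)) (Y o)) /\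
  mean P (fun o => hdot (T (Y o)) (Y o)) <= S.
Proof.
move=> hY hC pT TK uo un rY hS.
have b0 := be_bnd_ge0 hY.
pose f k o := \sum_(j < k) hdot (Y o) (T (u j)) * hdot (Y o) (u j).
have hf k : aebounded P (f k) by apply: aeb_sum => j; exact: be_hdot2 hY.
have fE k o : f k o = hdot (T (Y o)) (Y o - resid_seq u k (Y o)).
  rewrite /resid_seq subKr psd_sumr; last exact: hdot_psd.
  by apply: eq_bigr => j _; rewrite hdotE mulrC op_sym.
have mf k : mean P (f k) <= S.
  rewrite mean_sum => [|j]; last exact: be_hdot2 hY.
  by apply: le_trans (hS k); under eq_bigr => j _ do rewrite hC.
have Tb o : `|Y o| <= b -> `|T (Y o)| <= `|K| * b.
  move=> Yb; apply: le_trans (op_norm pT TK _) _.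
  apply: (@le_trans _ _ (`|K| * `|Y o|)); first by rewrite ler_wpM2r// ler_norm.
  by rewrite ler_wpM2l.
have KT o : `|Y o| <= b -> `|T (Y o)| * `|Y o| <= `|K| * b * b.
  by move=> Yb; apply: ler_pM => //; exact: Tb.
have aebT : aebounded P (fun o => hdot (T (Y o)) (Y o)).
  apply: (be_aeb (g := fun h => hdot (T h) h) (c := `|K| * b * b) hY).
    have cT : continuous T := @op_cts _ _ _ pT _ TK.
    by apply: (hdot_comp_cts cT) => h; exact: cvg_id.
  move=> h hb; apply: (le_trans (hdot_CS _ _)); apply: ler_pM => //.
  apply: le_trans (op_norm pT TK _) _.
  apply: (@le_trans _ _ (`|K| * `|h|)); first by rewrite ler_wpM2r// ler_norm.
  by rewrite ler_wpM2l.
split=> //.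
have cf : mean P (f k) @[k --> \oo] --> mean P (fun o => hdot (T (Y o)) (Y o)).
  apply: (@mean_cvg _ _ _ _ _ _ (`|K| * b * b)).
  - by move=> k; case: (hf k).
  - move=> k; apply: filterS (be_bnd hY) => o Yb; rewrite fE.
    apply: le_trans (hdot_CS _ _) (le_trans _ (KT o Yb)).
    by apply: ler_wpM2l => //; exact: resid_partial.
  - by case: aebT.
  - apply: filterS rY => o Yo0; under eq_fun do rewrite fE.
    have : hdot (T (Y o)) (Y o - resid_seq u k (Y o)) @[k --> \oo]
        --> hdot (T (Y o)) (Y o - resid u (Y o)).
      apply: (@continuous_cvg _ _ _ _ _ _ (hdot (T (Y o)))); first exact: hdot_cts.
      by apply: cvgB; [exact: cvg_cst|exact: resid_cvg].
    by rewrite Yo0 subr0.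
by apply: ler_cvg_to cf (cvg_cst S) _; apply: nearW => k; exact: mf.
Qed.

End MeanZero.

(** * Resolvents and effective dimension *)

Section Resolvent.
Context (R : realType) (H : hilbert R) (C : H -> H) (K eta : R).
Hypotheses (pC : psd_form (fun u v => hdot (C u) v)) (eta0 : 0 < eta).
Hypothesis CK : forall u, hdot (C u) u <= K * `|u| ^+ 2.

Lemma regularized_psd : psd_form (fun u v : H => hdot (C u) v + eta * hdot u v).
Proof.
split=> [u v w|t u v|u v|u].
- by rewrite (psdD pC) !hdotE; ring.
- by rewrite (psdZ pC) !hdotE; ring.
- by rewrite (psdC pC) (hdotC u).
- by rewrite addr_ge0 ?(psd_ge0 pC)// mulr_ge0 ?(ltW eta0)// hdot_norm sqr_ge0.
Qed.

Lemma resolvent_exists : exists T : H -> H, forall y, C (T y) + eta *: T y = y.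
Proof.
suff /choice[T hT] : forall y, exists v, C v + eta *: v = y by exists T.
move=> y; pose a (u v : H) := hdot (C u) v + eta * hdot u v.
have pa : psd_form a := regularized_psd.
have [|||||v hv] := @lax_milgram _ _ a eta (K + eta) `|y| (hdot y) pa eta0.
- by move=> u; rewrite /a hdot_norm lerDr (psd_ge0 pC).
- by move=> u; rewrite /a hdot_norm mulrDl lerD2r.
- by move=> u v; rewrite !hdotE.
- by move=> t u; rewrite !hdotE.
- by move=> u; exact: hdot_CS.
by exists v; apply: hdot_eqP => u; rewrite -hv /a !hdotE.
Qed.

Context (T : H -> H) (TE : forall y, C (T y) + eta *: T y = y).

Lemma hdot_resolvent u v : hdot (T u) v = hdot (C (T u)) (T v) + eta * hdot (T u) (T v).
Proof. by rewrite -{1}(TE v) !hdotE (psdC pC) hdotC. Qed.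

Lemma resolvent_psd : psd_form (fun u v => hdot (T u) v).
Proof.
have sym u v : hdot (T u) v = hdot u (T v).
  by rewrite (hdotC u) (hdot_resolvent u v) (hdot_resolvent v u) (psdC pC) (hdotC (T u)).
split=> [u v w|t u v|u v|u].
- by rewrite !sym hdotE.
- by rewrite !sym hdotE.
- by rewrite sym hdotC.
- by rewrite hdot_resolvent addr_ge0 ?(psd_ge0 pC)// mulr_ge0 ?(ltW eta0)// hdot_norm sqr_ge0.
Qed.

Lemma resolvent_form_le u : hdot (C (T u)) (T u) <= hdot (T u) u.
Proof. by rewrite hdot_resolvent lerDl mulr_ge0 ?(ltW eta0)// hdot_norm sqr_ge0. Qed.

Lemma resolvent_sqr_le u : `|eta *: T u| ^+ 2 <= eta * hdot (T u) u.
Proof.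
rewrite normrZ exprMn gtr0_norm// expr2 -mulrA ler_pM2l// hdot_resolvent.
by rewrite hdot_norm lerDr (psd_ge0 pC).
Qed.

Lemma resolvent_norm_le u : `|eta *: T u| <= `|u|.
Proof.
have [->|n0] := eqVneq (eta *: T u) 0; first by rewrite normr0.
rewrite -(@ler_pM2l _ `|eta *: T u|) ?normr_gt0// -expr2.
by apply: (le_trans (resolvent_sqr_le u)); rewrite -hdotZl; exact: hdot_le.
Qed.

Lemma resolvent_bnd u : hdot (T u) u <= eta^-1 * `|u| ^+ 2.
Proof.
rewrite ler_pdivlMl// -hdotZl expr2; apply: (le_trans (hdot_le _ _)).
by rewrite ler_wpM2r// resolvent_norm_le.
Qed.

(* Cauchy-Schwarz for the form [C + eta] gives [1 <= <T u, u> (lam + eta)]. *)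
Lemma resolvent_unit u (lam : R) : 0 <= lam -> `|u| = 1 -> hdot (C u) u <= lam ->
  hdot (C (T u)) u <= lam / (lam + eta).
Proof.
move=> lam0 u1 Cu.
have e : hdot (C (T u)) u = 1 - eta * hdot (T u) u.
  have h : hdot (C (T u) + eta *: T u) u = 1 by rewrite TE hdot_norm u1 expr1n.
  by rewrite -h hdotDl hdotZl addrK.
have CS : 1 <= hdot (T u) u * (lam + eta).
  have := psd_CS regularized_psd (T u) u; rewrite /= -hdot_resolvent e subrK expr1n.
  move=> h; apply: le_trans h _; apply: ler_wpM2l; first exact: psd_ge0 resolvent_psd u.
  by rewrite hdot_norm u1 expr1n mulr1 lerD2r.
rewrite e ler_pdivlMr ?ltr_wpDl//.
have := ler_wpM2l (ltW eta0) CS; lra.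
Qed.

End Resolvent.

Section Block.
Context d (Omega : measurableType d) (R : realType) (P : probability Omega R).
Context (H : hilbert R).

Lemma weak_mean (Y : Omega -> H) (b : R) (G : set Omega) : bounded_element P Y b ->
  measurable G -> exists mu : H, forall v, hdot mu v = mean P (fun o => \1_G o * hdot (Y o) v).
Proof.
move=> hY mG; have b0 := be_bnd_ge0 hY.
have hG v := aebM (aeb_indic P mG) (be_hdot v hY).
apply: (@riesz _ _ b).
- move=> u v; rewrite -meanD//; congr mean; apply/funext => o.
  by rewrite hdotE mulrDr.
- move=> t u; rewrite -meanZ//; congr mean; apply/funext => o.
  by rewrite hdotE mulrCA.
- move=> u; apply: mean_norm_le => //; apply: filterS (be_bnd hY) => o Yb.
  rewrite normrM; apply: (@le_trans _ _ (1 * `|hdot (Y o) u|)).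
    by rewrite ler_wpM2r// indicE; case: (_ \in _); rewrite ?normr1// normr0 ler01.
  by rewrite mul1r (le_trans (hdot_CS _ _))// ler_wpM2r.
Qed.

Record block_data (Y : Omega -> H) (b c a alpha : R) (mu : H) (C T : H -> H) : Prop :=
  BlockData {
  bd_mean : forall v, hdot mu v = mean P (fun o => hdot (Y o) v);
  bd_mu : `|mu| <= b;
  bd_elt : bounded_element P (fun o => Y o - mu) (2 * b);
  bd_cov : cov_op P (fun o => Y o - mu) C;
  bd_psd : psd_form (fun u v => hdot (T u) v);
  bd_res : forall y, C (T y) + (c / a) *: T y = y;
  bd_form : forall u, hdot (C (T u)) (T u) <= hdot (T u) u;
  bd_sqr : forall u, `|(c / a) *: T u| ^+ 2 <= (c / a) * hdot (T u) u;
  bd_norm : forall u, `|(c / a) *: T u| <= `|u|;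
  bd_aeb : aebounded P (fun o => hdot (T (Y o - mu)) (Y o - mu));
  bd_trace : c * mean P (fun o => hdot (T (Y o - mu)) (Y o - mu)) <= alpha;
  bd_muc : Num.min c (a * `|mu| ^+ 2) <= alpha }.

Lemma min_sum_le (c : R) (k : nat) (f : nat -> R) : 0 <= c -> (forall j, 0 <= f j) ->
  Num.min c (\sum_(j < k) f j) <= \sum_(j < k) Num.min c (f j).
Proof.
move=> c0 f0; elim: k => [|k ih]; first by rewrite !big_ord0 ge_min lexx orbT.
rewrite !big_ord_recr/=; set s := \sum_(j < k) f j in ih *.
have s0 : 0 <= s by apply: sumr_ge0.
apply: (@le_trans _ _ (Num.min c s + Num.min c (f k))); last by rewrite lerD2r.
by have := f0 k; case: (leP c s); case: (leP c (f k)); case: (leP c (s + f k)); lra.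
Qed.

Lemma block_exists (Y : Omega -> H) (b c a alpha : R) (J : H -> H)
    (lambda : nat -> R) (s : nat -> H) : 0 < c -> 0 < a ->
  bounded_element P Y b -> cov_op P Y J -> eigenvalue_seq J lambda ->
  {ae P, forall o, forall e : R, 0 < e -> exists k, `|Y o - s k| < e} ->
  (forall k, \sum_(j < k) Num.min c (a * lambda j) <= alpha) ->
  exists mu C T, block_data Y b c a alpha mu C T.
Proof.
move=> c0 a0 hY hJ hlam sY halpha.
have pJ := cov_psd hY hJ; have b0 := be_bnd_ge0 hY.
have [lam0 [u [Ju un uo uc]]] := eigenbasis pJ hlam.
have un' j : `|u j| = (u j != 0)%:R.
  by rewrite -(normr_eq0 (u j)) !un; case: (lambda j != 0); rewrite ?eqxx ?oner_eq0.
have rY := eigenbasis_complete hY hJ sY uo un' Ju uc.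
have [mu hmu] : exists mu : H, forall v, hdot mu v = mean P (fun o => hdot (Y o) v).
  have [mu hmu] := weak_mean hY (@measurableT _ Omega).
  exists mu => v; rewrite hmu; congr mean; apply/funext => o.
  by rewrite indicT mul1r.
have mub : `|mu| <= b.
  have [->|m0] := eqVneq mu 0; first by rewrite normr0.
  rewrite -(@ler_pM2r _ `|mu|) ?normr_gt0// -expr2 -hdot_norm hmu.
  apply: le_trans (ler_norm _) _; apply: mean_norm_le; first exact: be_hdot hY.
  apply: filterS (be_bnd hY) => o Yb.
  by apply: (le_trans (hdot_CS _ _)); rewrite ler_wpM2r.
have rmu : resid u mu = 0.
  apply/eqP; rewrite -normr_eq0 -sqrf_eq0 -hdot_norm -(resid_sym uo un') (resid_idem uo un').
  rewrite (resid_sym uo un') hmu -(mean_cst P 0); apply/eqP/mean_ae_eq.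
  - exact: be_hdot hY.
  - exact: aeb_cst.
  - by apply: filterS rY => o Yo; rewrite -resid_sym// Yo hdotE.
have hYm : bounded_element P (fun o => Y o - mu) (2 * b).
  split=> [g cg|].
    apply: (be_meas hY (g := fun h => g (h - mu))) => v.
    apply: continuous_comp; last exact: cg.
    by apply: cvgB; [exact: cvg_id|exact: cvg_cst].
  apply: filterS (be_bnd hY) => o Yb; apply: (le_trans (ler_normB _ _)).
  by rewrite mulr2n mulrDl mul1r lerD.
pose C v := J v - hdot mu v *: mu.
have hC : cov_op P (fun o => Y o - mu) C.
  move=> v w; rewrite /C hdotBl hdotZl -hJ (hmu w) -meanZ; last exact: be_hdot hY.
  have e o : hdot (Y o - mu) v * hdot (Y o - mu) w
    = (hdot (Y o) v * hdot (Y o) w - hdot mu v * hdot (Y o) w)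
      + hdot mu w * (hdot mu v - hdot (Y o) v).
    by rewrite !hdotBl; ring.
  under eq_fun do rewrite e.
  rewrite meanD; last 2 first.
  - by apply: aebB; [exact: be_hdot2 hY|apply: aebZ; exact: be_hdot hY].
  - by apply: aebZ; apply: aebB; [exact: aeb_cst|exact: be_hdot hY].
  rewrite (@meanZ _ _ _ P (hdot mu w) (fun o => hdot mu v - hdot (Y o) v));
    last by apply: aebB; [exact: aeb_cst|exact: be_hdot hY].
  rewrite (meanB (aeb_cst _ _) (be_hdot _ hY)) mean_cst -hmu subrr mulr0 addr0.
  by rewrite meanB//; [exact: be_hdot2 hY|apply: aebZ; exact: be_hdot hY].
have pC := cov_psd hYm hC.
have CK := cov_bnd hYm hC.
have CJ v : hdot (C v) v <= hdot (J v) v.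
  by rewrite /C hdotBl hdotZl gerBl -expr2 sqr_ge0.
have eta0 : 0 < c / a by rewrite divr_gt0.
have [T TE] := resolvent_exists pC eta0 CK.
have pT := resolvent_psd pC eta0 TE.
have TK := resolvent_bnd pC eta0 TE.
have ryc : {ae P, forall o, resid u (Y o - mu) = 0}.
  by apply: filterS rY => o Yo; rewrite (opB (resid_psd uo un')) Yo rmu subrr.
have [|h1 h2] := trace_bound (S := c^-1 * alpha) hYm hC pT TK uo un' ryc.
  move=> k; rewrite ler_pdivlMl// mulr_sumr; apply: le_trans (halpha k).
  apply: ler_sum => j _; have [l0|l0] := eqVneq (lambda j) 0.
    have u0 : u j = 0 by apply/eqP; rewrite -normr_eq0 un l0 eqxx.
    by rewrite u0 (psd0r (hdot_psd H)) mulr0 l0 mulr0 le_min lexx ltW.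
  have lp : 0 < lambda j by rewrite lt_neqAle eq_sym l0 lam0.
  have u1 : `|u j| = 1 by rewrite un l0.
  have Cu : hdot (C (u j)) (u j) <= lambda j.
    by apply: le_trans (CJ _) _; rewrite Ju hdotZl hdot_norm u1 expr1n mulr1.
  apply: (@le_trans _ _ (c * (lambda j / (lambda j + c / a)))).
    by rewrite ler_pM2l//; exact: (resolvent_unit pC eta0 TE).
  have le0 : 0 < lambda j + c / a by rewrite addr_gt0.
  rewrite le_min; apply/andP; split.
    by rewrite (ler_piMr (ltW c0))// ler_pdivrMr// mul1r lerDl ltW.
  rewrite mulrA ler_pdivrMr//.
  have -> : a * lambda j * (lambda j + c / a) = a * lambda j * lambda j + c * lambda j.
    by field; rewrite gt_eqF.
  by rewrite lerDr !mulr_ge0 ?(ltW a0).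
exists mu, C, T; split=> //.
- exact: (resolvent_form_le pC eta0 TE).
- exact: (resolvent_sqr_le pC eta0 TE).
- exact: (resolvent_norm_le pC eta0 TE).
- by rewrite -ler_pdivlMl.
- have lmu j : hdot mu (u j) ^+ 2 <= lambda j.
    have [l0|l0] := eqVneq (lambda j) 0.
      have u0 : u j = 0 by apply/eqP; rewrite -normr_eq0 un l0 eqxx.
      by rewrite u0 hdotE expr0n l0.
    have u1 : `|u j| = 1 by rewrite un l0.
    have := psd_ge0 pC (u j); rewrite /C hdotBl hdotZl Ju hdotZl hdot_norm u1.
    by rewrite expr1n mulr1 -expr2 subr_ge0.
  have cv : Num.min c (a * \sum_(j < k) hdot mu (u j) ^+ 2) @[k --> \oo]
      --> Num.min c (a * `|mu| ^+ 2).
    have cs : \sum_(j < k) hdot mu (u j) ^+ 2 @[k --> \oo] --> `|mu| ^+ 2.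
      have e k : \sum_(j < k) hdot mu (u j) ^+ 2 = `|mu| ^+ 2 - hdot mu (resid_seq u k mu).
        rewrite -[hdot mu _]hdotC hdot_resid_seq hdot_norm opprB addrC subrK.
        by apply: eq_bigr => j _; rewrite expr2.
      under eq_fun do rewrite e.
      have : `|mu| ^+ 2 - hdot mu (resid_seq u k mu) @[k --> \oo]
          --> `|mu| ^+ 2 - hdot mu (resid u mu).
        apply: cvgB; first exact: cvg_cst.
        apply: (@continuous_cvg _ _ _ _ _ _ (hdot mu)); first exact: hdot_cts.
        exact: resid_cvg.
      by rewrite rmu (psd0r (hdot_psd H)) subr0.
    apply: (@continuous_cvg _ _ _ _ _ _ (fun x : R => Num.min c (a * x))) => //.
    move=> x; apply: continuous_min; first exact: cvg_cst.
    by apply: cvgM; [exact: cvg_cst|exact: cvg_id].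
  apply: ler_cvg_to cv (cvg_cst alpha) _; apply: nearW => k.
  apply: le_trans (halpha k); rewrite mulr_sumr.
  apply: le_trans (@min_sum_le c k (fun j => a * hdot mu (u j) ^+ 2) _ _) _.
  + exact: ltW.
  + by move=> j; rewrite mulr_ge0 ?sqr_ge0 ?ltW.
  + apply: ler_sum => j _; rewrite le_min2// ler_pM2l//.
Qed.

End Block.

(** * Moments of Rademacher sums on finite probability spaces *)

Section FiniteProduct.
Context (R : realType) (U : finType) (w : U -> R).
Hypotheses (w_ge0 : forall u, 0 <= w u) (w_sum : \sum_u w u = 1).

Definition pmass n (theta : {ffun 'I_n -> U}) : R := \prod_i w (theta i).

Definition pmean n (G : {ffun 'I_n -> U} -> R) : R :=
  \sum_theta pmass theta * G theta.

Lemma pmass_ge0 n (theta : {ffun 'I_n -> U}) : 0 <= pmass theta.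
Proof. exact: prodr_ge0. Qed.

Lemma pmean_le n (F G : {ffun 'I_n -> U} -> R) :
  (forall theta, F theta <= G theta) -> pmean F <= pmean G.
Proof. by move=> FG; apply: ler_sum => th _; rewrite ler_wpM2l ?pmass_ge0. Qed.

Lemma pmeanD n (F G : {ffun 'I_n -> U} -> R) :
  pmean (fun t => F t + G t) = pmean F + pmean G.
Proof. by rewrite -big_split/=; apply: eq_bigr => th _; rewrite mulrDr. Qed.

Lemma pmeanZ n c (F : {ffun 'I_n -> U} -> R) : pmean (fun t => c * F t) = c * pmean F.
Proof. by rewrite mulr_sumr; apply: eq_bigr => th _; rewrite mulrCA. Qed.

Lemma pmean_sum n (I : Type) (s : seq I) (F : I -> {ffun 'I_n -> U} -> R) :
  pmean (fun t => \sum_(i <- s) F i t) = \sum_(i <- s) pmean (F i).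
Proof.
rewrite /pmean exchange_big/=; apply: eq_bigr => th _.
by rewrite mulr_sumr.
Qed.

Definition fcons n (u : U) (theta : {ffun 'I_n -> U}) : {ffun 'I_n.+1 -> U} :=
  [ffun i => oapp theta u (unlift ord0 i)].

Lemma fcons0 n u (theta : {ffun 'I_n -> U}) : fcons u theta ord0 = u.
Proof. by rewrite ffunE unlift_none. Qed.

Lemma fcons_lift n u (theta : {ffun 'I_n -> U}) i :
  fcons u theta (lift ord0 i) = theta i.
Proof. by rewrite ffunE liftK. Qed.

Lemma pmeanS n (G : {ffun 'I_n.+1 -> U} -> R) :
  pmean G = \sum_u w u * pmean (fun theta => G (fcons u theta)).
Proof.
rewrite /pmean; under [RHS]eq_bigr => u _ do rewrite mulr_sumr.
rewrite pair_big/= (reindex (fun p : U * {ffun 'I_n -> U} => fcons p.1 p.2))/=.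
  apply: eq_bigr => -[u th] _ /=; rewrite /pmass big_ord_recl fcons0 mulrA.
  by congr (_ * _ * _); apply: eq_bigr => i _; rewrite fcons_lift.
exists (fun th => (th ord0, [ffun i => th (lift ord0 i)])) => [[u th] _|th _] /=.
  rewrite fcons0; congr (_, _); apply/ffunP => i.
  by rewrite ffunE fcons_lift.
apply/ffunP => i; case: (unliftP ord0 i) => [j ->|->].
  by rewrite fcons_lift ffunE.
by rewrite fcons0.
Qed.

Lemma pmean0 (G : {ffun 'I_0 -> U} -> R) : pmean G = G (ffun0 (card_ord 0)).
Proof.
rewrite /pmean (bigD1 (ffun0 (card_ord 0)))//= big1 ?addr0.
  by rewrite /pmass big_ord0 mul1r.
by move=> t /eqP[]; apply/ffunP => -[].
Qed.

Lemma pmean_mul_le (V : zmodType) (Z : U -> V) (Phi : V -> R) (A : R) n v : 0 <= A ->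
  (forall v, \sum_u w u * Phi (v + Z u) <= A * Phi v) ->
  pmean (fun th : {ffun 'I_n -> U} => Phi (v + \sum_i Z (th i))) <= A ^+ n * Phi v.
Proof.
move=> A0 hA; elim: n v => [|n ih] v.
  by rewrite pmean0 big_ord0 addr0 mul1r.
rewrite pmeanS exprSr -mulrA.
apply: (@le_trans _ _ (\sum_u w u * (A ^+ n * Phi (v + Z u)))).
  apply: ler_sum => u _; rewrite ler_wpM2l//; apply: le_trans (ih (v + Z u)).
  apply: pmean_le => th; rewrite big_ord_recl fcons0 addrA.
  by under eq_bigr do rewrite fcons_lift.
under eq_bigr do rewrite mulrCA.
by rewrite -mulr_sumr ler_wpM2l ?exprn_ge0.
Qed.

Lemma pmean_add (V : zmodType) (Z : U -> V) (Phi : V -> R) (B : R) n v :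
  (forall v, \sum_u w u * Phi (v + Z u) = Phi v + B) ->
  pmean (fun th : {ffun 'I_n -> U} => Phi (v + \sum_i Z (th i))) = Phi v + n%:R * B.
Proof.
move=> hB; elim: n v => [|n ih] v.
  by rewrite pmean0 big_ord0 addr0 mul0r addr0.
rewrite pmeanS; transitivity (\sum_u w u * (Phi (v + Z u) + n%:R * B)).
  apply: eq_bigr => u _; rewrite -ih; congr (_ * _); apply: eq_bigr => th _.
  rewrite big_ord_recl fcons0 addrA.
  by under eq_bigr do rewrite fcons_lift.
under eq_bigr do rewrite mulrDr.
rewrite big_split/= hB -mulr_suml w_sum mul1r -addrA; congr (_ + _).
by rewrite -[in RHS]natr1; ring.
Qed.

Lemma pmean_cst n (c : R) : pmean (fun _ : {ffun 'I_n -> U} => c) = c.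
Proof.
have := @pmean_add R (fun=> 0) (fun=> c) 0 n 0.
by rewrite mulr0 addr0; apply => _; rewrite -mulr_suml w_sum mul1r ?addr0.
Qed.

Lemma pmean_sum_coord n (g : U -> R) :
  pmean (fun th : {ffun 'I_n -> U} => \sum_i g (th i)) = n%:R * \sum_u w u * g u.
Proof.
have := @pmean_add R g id (\sum_u w u * g u) n 0.
rewrite add0r => <-; first by apply: eq_bigr => th _; rewrite add0r.
by move=> v; under eq_bigr do rewrite mulrDr; rewrite big_split/= -mulr_suml w_sum mul1r.
Qed.

End FiniteProduct.

Lemma powR_tangent (R : realType) (y q : R) : 0 <= y -> 0 < q <= 1 ->
  y `^ q <= q * y + (1 - q).
Proof.
move=> y0 /andP[q0]; rewrite le_eqVlt => /predU1P[->|q1].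
  by rewrite powRr1// mul1r subrr addr0.
have h : (q^-1)^-1 + ((1 - q)^-1)^-1 = 1 by rewrite !invrK addrC subrK.
have q1' : 0 < 1 - q by rewrite subr_gt0.
have := @conjugate_powR R (y `^ q) 1 q^-1 (1 - q)^-1 (powR_ge0 _ _) ler01 _ _ h.
by rewrite !invrK !invr_gt0 q0 q1' mulr1 powR1 mul1r -powRrM mulfV ?gt_eqF// powRr1// (mulrC y); apply.
Qed.

Lemma jensen_powR (R : realType) (I : finType) (p g : I -> R) (q : R) :
  (forall i, 0 <= p i) -> \sum_i p i = 1 -> (forall i, 0 <= g i) -> 0 < q <= 1 ->
  \sum_i p i * (g i `^ q) <= (\sum_i p i * g i) `^ q.
Proof.
move=> p0 p1 g0 /[dup] q01 /andP[q0 _].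
set m := \sum_i p i * g i.
have m0 : 0 <= m by apply: sumr_ge0 => i _; rewrite mulr_ge0.
have [mz|mz] := eqVneq m 0.
  rewrite mz powR0 ?gt_eqF// big1// => i _.
  have : p i * g i == 0.
    have := psumr_eq0P (P := xpredT) (F := fun i => p i * g i).
    by move=> h; apply/eqP; apply: h => // j _; rewrite mulr_ge0.
  by rewrite mulf_eq0 => /orP[]/eqP ->; rewrite ?mul0r// powR0 ?mulr0// gt_eqF.
have mp : 0 < m by rewrite lt_neqAle eq_sym mz.
apply: (@le_trans _ _ (\sum_i p i * (m `^ q * (q * (g i / m) + (1 - q))))).
  apply: ler_sum => i _; rewrite ler_wpM2l//.
  have -> : g i `^ q = m `^ q * (g i / m) `^ q.
    by rewrite -powRM ?divr_ge0// mulrC divfK.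
  by rewrite ler_wpM2l ?powR_ge0// powR_tangent ?divr_ge0.
have -> : \sum_i p i * (m `^ q * (q * (g i / m) + (1 - q)))
  = m `^ q * (q / m * \sum_i p i * g i + (1 - q) * \sum_i p i).
  by rewrite !mulr_sumr -big_split/= mulr_sumr; apply: eq_bigr => i _; ring.
by rewrite -/m p1 -mulrA mulVf// !mulr1 addrC subrK mulr1.
Qed.

Section ExpBounds.
Context (R : realType).
Implicit Types x y : R.

Lemma expR_le_inv x : x < 1 -> expR x <= (1 - x)^-1.
Proof.
move=> x1; rewrite -[x in expR x]opprK expRN lef_pV2 ?posrE ?expR_gt0 ?subr_gt0//.
exact: expR_ge1Dx.
Qed.

Lemma expR_le_lin x : 0 <= x <= 2^-1 -> expR x <= 1 + 2 * x.
Proof.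
move=> /andP[x0 x1]; have x1' : 0 < 1 - x by lra.
apply: (le_trans (expR_le_inv _)); first by lra.
by rewrite -div1r ler_pdivrMr//; nra.
Qed.

Lemma expR_cosh_le x : -1 <= x <= 1 -> expR x + expR (- x) <= 2 + 4 * x ^+ 2.
Proof.
move=> /andP[x0 x1].
have e2 y : expR y = expR (y / 2) ^+ 2 by rewrite -expRM_natr divfK// pnatr_eq0.
have ab : expR (x / 2) * expR (- x / 2) = 1.
  by rewrite -expRD mulNr subrr expR0.
have a1 := @expR_le_inv (x / 2) ltac:(lra).
have b1 := @expR_le_inv (- x / 2) ltac:(lra).
have -> : expR x + expR (- x) = (expR (x / 2) + expR (- x / 2)) ^+ 2 - 2.
  by rewrite (e2 x) (e2 (- x)) sqrrD ab; ring.
set y := x ^+ 2; have y0 : 0 <= y <= 1 by rewrite /y; nra.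
have yp : 0 < 1 - y / 4 by lra.
have s1 : expR (x / 2) + expR (- x / 2) <= 2 / (1 - y / 4).
  apply: le_trans (lerD a1 b1) _.
  rewrite le_eqVlt; apply/orP; left; apply/eqP; rewrite /y; field.
  by apply/andP; split; [|apply/andP; split]; apply/eqP; nra.
have s0 : 0 <= expR (x / 2) + expR (- x / 2) by rewrite addr_ge0 ?expR_ge0.
have : (expR (x / 2) + expR (- x / 2)) ^+ 2 <= (2 / (1 - y / 4)) ^+ 2.
  by rewrite ler_pXn2r ?nnegrE// divr_ge0// ltW.
have : (2 / (1 - y / 4)) ^+ 2 <= 4 + 4 * y.
  rewrite expr_div_n ler_pdivrMr ?exprn_gt0//; case/andP: y0; clearbody y; nra.
lra.
Qed.

Lemma expR32_ge4 : 4 <= expR (3 / 2) :> R.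
Proof.
have -> : expR (3 / 2) = expR (8^-1) ^+ 12 :> R.
  by rewrite -expRM_natr; congr expR; field.
apply: (@le_trans _ _ ((1 + 8^-1) ^+ 12)); first by rewrite !exprS expr0; lra.
by rewrite ler_pXn2r ?nnegrE ?expR_ge0 ?addr_ge0//; exact: expR_ge1Dx.
Qed.

Lemma powR_le_exp x (s : R) : 0 <= x -> 0 < s ->
  x `^ s <= (s * expR (- 1)) `^ s * expR x.
Proof.
move=> x0 s0; apply: (@le_trans _ _ ((s * expR (x / s - 1)) `^ s)).
  apply: ge0_ler_powR; rewrite ?nnegrE ?(ltW s0) ?mulr_ge0 ?expR_ge0 ?(ltW s0)//.
  rewrite -ler_pdivrMl// mulrC; apply: le_trans (expR_ge1Dx _).
  by rewrite addrC subrK.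
rewrite expRD [expR _ * _]mulrC mulrA powRM ?mulr_ge0 ?expR_ge0 ?(ltW s0)//.
by rewrite -[X in _ * X]expRM divfK ?gt_eqF.
Qed.

End ExpBounds.

Section Moment.
Context (R : realType) (H : hilbert R).

Let Phi (v : H) : R := expR (Num.sqrt (1 + `|v| ^+ 2)).

(* [Phi] is a smooth substitute for [exp `|v|] whose growth under a symmetric
   step does not depend on the dimension. *)
Lemma smooth_step (v z : H) : `|z| <= 1 ->
  Phi (v + z) + Phi (v - z) <= 2 * (Phi v * (1 + 5 * `|z| ^+ 2)).
Proof.
move=> z1; pose A : R := Num.sqrt (1 + `|v| ^+ 2); pose th : R := hdot v z / A.
have A2 : A ^+ 2 = 1 + `|v| ^+ 2 by rewrite sqr_sqrtr// addr_ge0 ?sqr_ge0.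
have A0 : 0 < A by rewrite sqrtr_gt0 ltr_wpDr ?sqr_ge0.
have vA : `|v| <= A.
  by rewrite -(@ler_pXn2r _ 2) ?nnegrE ?(ltW A0)// A2 lerDr.
have th1 : `|th| <= `|z|.
  rewrite normrM normfV (gtr0_norm A0) ler_pdivrMr// mulrC.
  by apply: (le_trans (hdot_CS _ _)); rewrite ler_wpM2r.
have A1 : 1 <= A by rewrite -(@ler_pXn2r _ 2) ?nnegrE ?(ltW A0)// A2 expr1n lerDl sqr_ge0.
set V := `|z| ^+ 2.
have V0 : 0 <= V by exact: sqr_ge0.
have bnd (e : R) : e ^+ 2 = 1 -> Num.sqrt (1 + `|v + e *: z| ^+ 2) <= A + (V / 2 + e * th).
  move=> e1.
  have nE : 1 + `|v + e *: z| ^+ 2 = A ^+ 2 + (2 * e * hdot v z + V).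
    rewrite A2 -hdot_norm !hdotE !hdot_norm (hdotC z v) -/V.
    have -> : e * (e * V) = V by rewrite mulrA -expr2 e1 mul1r.
    by ring.
  set dl := 2 * e * hdot v z + V in nE.
  have d0 : 0 <= A ^+ 2 + dl by rewrite -nE addr_ge0 ?sqr_ge0.
  apply: (@le_trans _ _ (A + dl / (2 * A))); last first.
    rewrite lerD2l /dl /th mulrDl addrC; apply: lerD.
      by rewrite ler_pdivrMr ?mulr_gt0//; nra.
    by rewrite le_eqVlt; apply/orP; left; apply/eqP; field; rewrite gt_eqF.
  have r0 : 0 <= A + dl / (2 * A).
    have -> : A + dl / (2 * A) = (A ^+ 2 + (A ^+ 2 + dl)) / (2 * A) by field; rewrite gt_eqF.
    by apply: divr_ge0; [exact: addr_ge0 (sqr_ge0 _) d0|rewrite mulr_ge0 ?(ltW A0)].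
  rewrite -(@ler_pXn2r _ 2) ?nnegrE ?sqrtr_ge0// sqr_sqrtr ?nE//.
  have -> : (A + dl / (2 * A)) ^+ 2 = A ^+ 2 + dl + (dl / (2 * A)) ^+ 2.
    by field; rewrite gt_eqF.
  by rewrite lerDl sqr_ge0.
have Vle : V <= 1 by rewrite /V expr_le1.
have P1 : Phi (v + z) <= Phi v * (expR (V / 2) * expR th).
  rewrite /Phi -!expRD ler_expR.
  by have := bnd 1 (expr1n _ _); rewrite scale1r mul1r.
have P2 : Phi (v - z) <= Phi v * (expR (V / 2) * expR (- th)).
  rewrite /Phi -!expRD ler_expR.
  by have := bnd (-1) ltac:(by rewrite sqrrN expr1n); rewrite scaleN1r mulN1r.
apply: (le_trans (lerD P1 P2)).
rewrite -!mulrDr [leRHS]mulrCA ler_wpM2l ?expR_ge0//.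
have th2 : th ^+ 2 <= V.
  by rewrite -(real_normK (num_real th)) ler_pXn2r ?nnegrE.
have c1 := @expR_cosh_le R th ltac:(by rewrite -ler_norml; exact: le_trans th1 z1).
have c2 := @expR_le_lin R (V / 2) ltac:(by apply/andP; split; lra).
apply: (@le_trans _ _ ((1 + V) * (2 + 4 * V))).
  apply: ler_pM; rewrite ?expR_ge0 ?addr_ge0 ?expR_ge0//; lra.
clearbody V; nra.
Qed.

(* The sums over [bool * T] are expectations over the sign and the value of a
   symmetric variable [+- z c]. *)
Definition sgn (e : bool) : R := if e then 1 else -1.

Context (T : finType) (q : T -> R).
Hypotheses (q_ge0 : forall c, 0 <= q c) (q_sum : \sum_c q c = 1).

Definition signw (u : bool * T) : R := 2^-1 * q u.2.

Lemma signw_ge0 u : 0 <= signw u. Proof. by rewrite mulr_ge0 ?invr_ge0. Qed.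

Lemma sum_signw (F : bool -> T -> R) :
  \sum_u signw u * F u.1 u.2 = \sum_c q c * (2^-1 * (F true c + F false c)).
Proof.
rewrite -(pair_big xpredT xpredT (fun e c => signw (e, c) * F e c))/= big_bool/=.
rewrite -big_split/=; apply: eq_bigr => c _; rewrite /signw/=; ring.
Qed.

Lemma signw_sum : \sum_u signw u = 1.
Proof.
rewrite -[RHS]q_sum; transitivity (\sum_u signw u * 1).
  by apply: eq_bigr => u _; rewrite mulr1.
by rewrite (sum_signw (fun _ _ => 1)); apply: eq_bigr => c _; field.
Qed.

Lemma moment_bound n (z : T -> H) (v T2 s : R) : 0 < v -> 2 <= s ->
  (forall c, `|z c| <= v) -> \sum_c q c * `|z c| ^+ 2 <= T2 ->
  16 * n%:R * T2 <= v ^+ 2 ->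
  pmean signw (fun th : {ffun 'I_n -> bool * T} =>
      `|\sum_i sgn (th i).1 *: z (th i).2| `^ s)
  <= (s * expR (2^-1) / 2 * v) `^ s.
Proof.
move=> v0 s2 zv zT T2v; have s0 : 0 < s by lra.
pose Z (u : bool * T) := v^-1 *: (sgn u.1 *: z u.2).
have sc (th : {ffun 'I_n -> bool * T}) :
    `|\sum_i sgn (th i).1 *: z (th i).2| = v * `|0 + \sum_i Z (th i)|.
  by rewrite add0r -scaler_sumr normrZ ger0_norm ?invr_ge0 ?ltW// mulVKf ?gt_eqF.
have -> : (s * expR (2^-1) / 2 * v) `^ s = v `^ s * (s * expR (2^-1) / 2) `^ s.
  have c0 : 0 <= s * expR (2^-1) / 2 by rewrite divr_ge0 ?mulr_ge0 ?expR_ge0 ?(ltW s0).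
  by rewrite [LHS]powRM ?(ltW v0)// mulrC.
under [X in X <= _]eq_bigr => th _ do rewrite sc powRM ?(ltW v0)//.
rewrite -/(pmean signw (fun th => v `^ s * `|0 + \sum_i Z (th i)| `^ s)) pmeanZ.
rewrite ler_wpM2l ?powR_ge0//.
pose B := 5 * (T2 / v ^+ 2).
have B0 : 0 <= B.
  have : 0 <= T2 by apply: le_trans zT; apply: sumr_ge0 => c _; rewrite mulr_ge0 ?sqr_ge0.
  by move=> t0; rewrite /B mulr_ge0// divr_ge0 ?sqr_ge0.
have step (h : H) : \sum_u signw u * Phi (h + Z u) <= (1 + B) * Phi h.
  rewrite (sum_signw (fun e c => Phi (h + v^-1 *: (sgn e *: z c)))).
  apply: (@le_trans _ _ (\sum_c q c * (Phi h * (1 + 5 * (`|z c| ^+ 2 / v ^+ 2))))).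
    apply: ler_sum => c _; rewrite ler_wpM2l//.
    rewrite /sgn scale1r scaleN1r scalerN ler_pdivrMl//.
    have nz : `|v^-1 *: z c| = `|z c| / v.
      by rewrite normrZ ger0_norm ?invr_ge0 ?ltW// mulrC.
    have := @smooth_step h (v^-1 *: z c); rewrite nz ler_pdivrMr// mul1r => /(_ (zv c)).
    by rewrite expr_div_n.
  have -> : \sum_c q c * (Phi h * (1 + 5 * (`|z c| ^+ 2 / v ^+ 2)))
     = Phi h * (\sum_c q c + 5 / v ^+ 2 * \sum_c q c * `|z c| ^+ 2).
    by rewrite !mulr_sumr -big_split/= mulr_sumr; apply: eq_bigr => c _; ring.
  rewrite q_sum mulrC ler_wpM2r ?expR_ge0// lerD2l /B -mulrA ler_wpM2l//.
  by rewrite mulrC ler_wpM2r ?invr_ge0 ?sqr_ge0.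
have B1 : 0 <= 1 + B by rewrite addr_ge0.
have := @pmean_mul_le R _ signw signw_ge0 H Z Phi (1 + B) n 0 B1 step.
have -> : Phi 0 = expR 1 by rewrite /Phi normr0 expr0n addr0 sqrtr1.
move=> hP.
have Bn : (1 + B) ^+ n <= expR (5 / 16).
  apply: (@le_trans _ _ (expR B ^+ n)).
    by apply: lerXn2r; rewrite ?nnegrE ?expR_ge0//; exact: expR_ge1Dx.
  rewrite -expRM_natl ler_expR /B.
  have : 16 * n%:R * T2 / v ^+ 2 <= 1 by rewrite ler_pdivrMr ?exprn_gt0// mul1r.
  by lra.
apply: (@le_trans _ _ ((s * expR (- 1)) `^ s * pmean signw (fun th : {ffun 'I_n -> bool * T} => Phi (0 + \sum_i Z (th i))))).
  rewrite -pmeanZ; apply: pmean_le => [u|th]; first exact: signw_ge0.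
  apply: le_trans (powR_le_exp _ s0) _ => //; rewrite ler_wpM2l ?powR_ge0// ler_expR.
  by rewrite -(@ler_pXn2r _ 2) ?nnegrE ?sqrtr_ge0// sqr_sqrtr ?lerDr ?addr_ge0 ?sqr_ge0.
have -> : s * expR 2^-1 / 2 = s * expR (- 1) * (expR (3 / 2) / 2).
  have -> : expR 2^-1 = expR (- 1) * expR (3 / 2) :> R.
    by rewrite -expRD; congr expR; field.
  by ring.
rewrite [leRHS]powRM ?mulr_ge0 ?expR_ge0 ?(ltW s0)//.
rewrite ler_wpM2l ?powR_ge0//; apply: (le_trans hP).
apply: (@le_trans _ _ (expR (5 / 16) * expR 1)); first by rewrite ler_wpM2r ?expR_ge0.
rewrite -expRD; have e4 := expR32_ge4 R.
apply: (@le_trans _ _ ((expR (3 / 2) / 2) `^ 2)); last first.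
  by apply: ler_powR => //; lra.
rewrite powR_mulrn ?divr_ge0 ?expR_ge0//.
apply: (@le_trans _ _ (expR (3 / 2))); first by rewrite ler_expR; lra.
by move: e4; move: (expR _) => x x4; nra.
Qed.

Lemma second_moment_sum n (V : lmodType R) (a : V -> V -> R) (z : T -> V) : psd_form a ->
  pmean signw (fun th : {ffun 'I_n -> bool * T} =>
     a (\sum_i sgn (th i).1 *: z (th i).2) (\sum_i sgn (th i).1 *: z (th i).2))
  = n%:R * \sum_c q c * a (z c) (z c).
Proof.
move=> pa.
have := @pmean_add R _ signw signw_sum V (fun u => sgn u.1 *: z u.2)
  (fun v => a v v) (\sum_c q c * a (z c) (z c)) n 0.
rewrite (psd0l pa) add0r => <-; first by apply: eq_bigr => th _; rewrite add0r.
move=> v; rewrite (sum_signw (fun e c => a (v + sgn e *: z c) (v + sgn e *: z c))).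
transitivity (\sum_c (q c * a v v + q c * a (z c) (z c))).
  apply: eq_bigr => c _; rewrite /sgn scale1r scaleN1r !(psdE pa) (psdC pa (z c) v).
  by field.
by rewrite big_split/= -mulr_suml q_sum mul1r.
Qed.

End Moment.

Section PowerSums.
Context (R : realType) (I : finType).

Lemma hoelder_sum (x y : I -> R) (t s D Y : R) : 0 < t -> 0 < s -> t^-1 + s^-1 = 1 ->
  (forall i, 0 <= x i) -> (forall i, 0 <= y i) -> 0 < D -> 0 <= Y ->
  \sum_i x i `^ t <= D `^ t -> \sum_i y i `^ s <= Y `^ s ->
  \sum_i x i * y i <= D * Y.
Proof.
move=> t0 s0 ts x0 y0 D0 Y0 xD yY.
have [Yz|Yn] := eqVneq Y 0.
  rewrite Yz mulr0 big1// => i _.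
  have : y i `^ s == 0.
    apply/eqP; move: i isT; apply: psumr_eq0P => [i _|]; first exact: powR_ge0.
    apply/eqP; rewrite eq_le sumr_ge0 ?andbT => [|i _]; last exact: powR_ge0.
    by move: yY; rewrite Yz powR0 ?gt_eqF.
  by move/eqP/powR_eq0_eq0 => ->; rewrite mulr0.
have Yp : 0 < Y by rewrite lt_neqAle eq_sym Yn.
have DY : 0 < D * Y by rewrite mulr_gt0.
rewrite -[leRHS]mulr1 -ler_pdivrMl// mulr_sumr.
apply: (@le_trans _ _ (\sum_i ((D `^ t)^-1 * x i `^ t / t + (Y `^ s)^-1 * y i `^ s / s))).
  apply: ler_sum => i _.
  have := @conjugate_powR R (x i / D) (y i / Y) t s _ _ t0 s0 ts.
  rewrite !divr_ge0 ?(ltW D0) ?(ltW Yp)// => /(_ isT isT).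
  have pd (u v p : R) : 0 <= u -> 0 < v -> (u / v) `^ p = (v `^ p)^-1 * u `^ p.
    by move=> u0 v0; rewrite powRM ?invr_ge0 ?(ltW v0)// -powR_inv1 ?(ltW v0)// -powRrM mulN1r powRN mulrC.
  rewrite !pd//; apply: le_trans; rewrite le_eqVlt; apply/orP; left; apply/eqP.
  by field; rewrite !gt_eqF.
rewrite big_split/= -!mulr_suml -!mulr_sumr -[leRHS]ts; apply: lerD.
  by rewrite ler_piMl ?invr_ge0 ?(ltW t0)// ler_pdivrMl ?powR_gt0// mulr1.
by rewrite ler_piMl ?invr_ge0 ?(ltW s0)// ler_pdivrMl ?powR_gt0// mulr1.
Qed.

Lemma powR_subadd (a b p : R) : 0 <= a -> 0 <= b -> 0 < p <= 1 ->
  (a + b) `^ p <= a `^ p + b `^ p.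
Proof.
move=> a0 b0 /andP[p0 p1].
have [e|ne] := eqVneq (a + b) 0; first by rewrite e powR0 ?gt_eqF// addr_ge0 ?powR_ge0.
have s0 : 0 < a + b by rewrite lt_neqAle eq_sym ne addr_ge0.
have h u : 0 <= u -> u <= a + b -> u / (a + b) * (a + b) `^ p <= u `^ p.
  rewrite le_eqVlt => /predU1P[<- _|u0 us]; first by rewrite !mul0r powR_ge0.
  have -> : u `^ p = (u / (a + b)) `^ p * (a + b) `^ p.
    by rewrite -powRM ?divr_ge0 ?ltW// divfK.
  rewrite ler_wpM2r ?powR_ge0// ger1_powR// divr_gt0//= ler_pdivrMr// mul1r//.
have := lerD (h a a0 _) (h b b0 _); rewrite lerDl lerDr a0 b0 => /(_ isT isT).
by rewrite -mulrDl -mulrDl mulfV// mul1r.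
Qed.

Lemma sum_le_power_mean (x : I -> R) (p : R) : (0 < #|I|)%N -> 1 <= p ->
  (forall i, 0 <= x i) ->
  \sum_i x i <= #|I|%:R `^ (1 - p^-1) * (\sum_i x i `^ p) `^ p^-1.
Proof.
move=> I0 p1 x0; have p0 : 0 < p by exact: lt_le_trans p1.
have N0 : 0 < #|I|%:R :> R by rewrite ltr0n.
have -> : \sum_i x i = #|I|%:R * \sum_i #|I|%:R^-1 * (x i `^ p) `^ p^-1.
  rewrite mulr_sumr; apply: eq_bigr => i _.
  by rewrite mulrA mulfV ?gt_eqF// mul1r -powRrM mulfV ?gt_eqF// powRr1.
have pI : \sum_(i : I) #|I|%:R^-1 = 1 :> R.
  by rewrite sumr_const -[LHS]mulr_natl mulfV// gt_eqF.
apply: le_trans (ler_wpM2l (ltW N0) (@jensen_powR R I (fun=> #|I|%:R^-1)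
  (fun i => x i `^ p) p^-1 _ pI _ _)) _.
- by move=> _; rewrite invr_ge0 ltW.
- by move=> i; exact: powR_ge0.
- by rewrite invr_gt0 p0 invf_le1.
rewrite -mulr_sumr powRM ?invr_ge0 ?(ltW N0) ?sumr_ge0//; last first.
  by move=> i _; exact: powR_ge0.
rewrite mulrA powRB ?(gt_eqF N0) ?implybT// powRr1 ?(ltW N0)//.
by rewrite -[in leLHS]powR_inv1 ?(ltW N0)// -powRrM mulN1r powRN.
Qed.

End PowerSums.

(* [q] is the law of the discretised inputs [y]; [alpha m] stands for the m-th
   spectral sum, [N m] for the effective dimension of the m-th block. *)
Section FiniteBound.
Context (R : realType) (M n : nat) (H : 'I_M -> hilbert R).
Context (T : finType) (q : T -> R) (y : T -> forall m, H m).
Context (S : forall m, H m -> H m) (N alpha : 'I_M -> R) (b r D s a c eta : R).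
Context (f : forall m, H m -> H m -> R).
Arguments f : clear implicits.
Arguments S : clear implicits.
Hypotheses (M_gt0 : (0 < M)%N) (n_gt0 : (0 < n)%N).
Hypotheses (q_ge0 : forall k, 0 <= q k) (q_sum : \sum_k q k = 1).
Hypotheses (b_ge0 : 0 <= b) (r_ge0 : 0 <= r) (D_gt0 : 0 < D) (s_ge2 : 2 <= s).
Hypotheses (eta_gt0 : 0 < eta) (aE : a = expR 1 * D ^+ 2 * s ^+ 2).
Hypotheses (cE : c = r * M%:R `^ (1 - 2 / s)) (etaE : c = a * eta).
Hypothesis f_psd : forall m, psd_form (f m).
Hypothesis f_mean : forall m, \sum_k q k * f m (y k m) (y k m) <= N m.
Hypothesis S_lin : forall m (I : finType) (g : I -> R) (v : I -> H m),
  S m (\sum_i g i *: v i) = \sum_i g i *: S m (v i).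
Hypothesis S_norm : forall m k, `|S m (y k m)| <= 2 * b.
Hypothesis S_mean : forall m, \sum_k q k * `|S m (y k m)| ^+ 2 <= eta * N m.
Hypothesis N_alpha : forall m, c * N m <= alpha m.

Let zeta (th : {ffun 'I_n -> bool * T}) m : H m := \sum_i sgn R (th i).1 *: y (th i).2 m.

Let pE := pmean (signw q) (n := n).

Let n0 : 0 < n%:R :> R. Proof. by rewrite ltr0n. Qed.

Let s0 : 0 < s. Proof. exact: lt_le_trans s_ge2. Qed.

Let N0 m : 0 <= N m.
Proof. by apply: le_trans (f_mean m); apply: sumr_ge0 => k _; rewrite mulr_ge0// psd_ge0. Qed.

Let a0 : 0 < a. Proof. by rewrite aE !mulr_gt0 ?expR_gt0 ?exprn_gt0. Qed.

Let c0 : 0 < c. Proof. by rewrite etaE mulr_gt0. Qed.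

Lemma pE_powR (p : R) (F : {ffun 'I_n -> bool * T} -> R) : 0 < p <= 1 ->
  (forall th, 0 <= F th) -> pE (fun th => F th `^ p) <= (pE F) `^ p.
Proof.
move=> p01 F0; apply: jensen_powR => //.
  by move=> th; apply: pmass_ge0 => u; exact: signw_ge0.
have := @pmean_cst R _ (signw q) (signw_sum q_sum) n 1.
by rewrite /pmean; under eq_bigr do rewrite mulr1.
Qed.

Lemma pE_ge0 (F : {ffun 'I_n -> bool * T} -> R) : (forall th, 0 <= F th) -> 0 <= pE F.
Proof.
move=> F0; apply: sumr_ge0 => th _; rewrite mulr_ge0//.
by apply: pmass_ge0 => u; exact: signw_ge0.
Qed.

Lemma pE_sqrt (F : {ffun 'I_n -> bool * T} -> R) :
  (forall th, 0 <= F th) -> pE (fun th => Num.sqrt (F th)) <= Num.sqrt (pE F).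
Proof.
move=> F0; rewrite -powR12_sqrt ?pE_ge0//.
under [X in pE X]eq_fun => th do rewrite -powR12_sqrt ?F0//.
apply: pE_powR => //; lra.
Qed.

Lemma pE_signs : pE (fun th => `|\sum_i sgn R (th i).1|) <= Num.sqrt n%:R.
Proof.
under [X in pE X]eq_fun => th do rewrite -sqrtr_sqr.
apply: (le_trans (pE_sqrt _)); first by move=> th; exact: sqr_ge0.
have pR : psd_form (fun u v : R^o => u * v).
  split=> [u v w|t u v|u v|u]; [exact: mulrDl|by rewrite -scalerAl|exact: mulrC|].
  by rewrite -expr2 sqr_ge0.
have := @second_moment_sum R T q q_sum n R^o _ (fun=> 1) pR.
rewrite -mulr_suml q_sum !mul1r mulr1 => <-.
rewrite le_eqVlt; apply/orP; left; apply/eqP; congr Num.sqrt.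
apply: eq_bigr => th _; congr (_ * _); rewrite expr2.
by congr (_ * _); apply: eq_bigr => i _; rewrite -[LHS]mulr1.
Qed.

Lemma pE_form : pE (fun th => Num.sqrt (\sum_m f m (zeta th m) (zeta th m)))
  <= Num.sqrt (n%:R * \sum_m N m).
Proof.
apply: (le_trans (pE_sqrt _)).
  by move=> th; apply: sumr_ge0 => m _; exact: psd_ge0.
rewrite ler_wsqrtr// /pE pmean_sum mulr_sumr; apply: ler_sum => m _.
apply: le_trans (ler_wpM2l (ltW n0) (f_mean m)).
by rewrite -(second_moment_sum q_sum n (y^~ m) (f_psd m)).
Qed.

Lemma pE_block m : pE (fun th => `|S m (zeta th m)| `^ s)
  <= (s * expR (2^-1) * b) `^ s
     + (2 * s * expR (2^-1) * Num.sqrt (n%:R * (eta * N m))) `^ s.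
Proof.
set V := Num.sqrt (n%:R * (eta * N m)).
have V0 : 0 <= V by exact: sqrtr_ge0.
have e0 : 0 < expR (2^-1) :> R by exact: expR_gt0.
have mom v : 0 < v -> 2 * b <= v -> 4 * V <= v ->
    pE (fun th => `|S m (zeta th m)| `^ s) <= (s * expR (2^-1) / 2 * v) `^ s.
  move=> v0 bv Vv.
  have := @moment_bound R (H m) T q q_ge0 q_sum n (fun k => S m (y k m)) v (eta * N m) s v0 s_ge2.
  move=> /(_ (fun k => le_trans (S_norm m k) bv) (S_mean m)).
  have -> : 16 * n%:R * (eta * N m) = (4 * V) ^+ 2.
    by rewrite exprMn sqr_sqrtr ?mulr_ge0 ?(ltW eta_gt0)//; ring.
  rewrite ler_pXn2r ?nnegrE ?(ltW v0) ?mulr_ge0// => /(_ Vv).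
  apply: le_trans; rewrite le_eqVlt; apply/orP; left; apply/eqP.
  by apply: eq_bigr => th _; rewrite /zeta S_lin.
have P0 x : 0 <= x -> 0 <= s * expR 2^-1 * x by move=> ?; rewrite !mulr_ge0// ltW.
have [bV|Vb] := leP (4 * V) (2 * b).
- have [b1|b1] := eqVneq b 0.
    rewrite /pE /pmean big1 ?addr_ge0 ?powR_ge0// => th _.
    rewrite /zeta S_lin big1 ?normr0 ?powR0 ?gt_eqF ?mulr0// => i _.
    apply/eqP; rewrite scaler_eq0; apply/orP; right; rewrite -normr_eq0 eq_le normr_ge0 andbT.
    by have := S_norm m (th i).2; rewrite b1 mulr0.
  have bp : 0 < 2 * b by rewrite mulr_gt0// lt_neqAle eq_sym b1.
  apply: le_trans (mom _ bp (lexx _) bV) _.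
  rewrite (_ : s * expR 2^-1 / 2 * (2 * b) = s * expR 2^-1 * b); last by field.
  by rewrite lerDl powR_ge0.
- have Vp : 0 < 4 * V by apply: le_lt_trans Vb; rewrite mulr_ge0.
  apply: le_trans (mom _ Vp (ltW Vb) (lexx _)) _.
  rewrite (_ : s * expR 2^-1 / 2 * (4 * V) = 2 * s * expR 2^-1 * V); last by field.
  by rewrite lerDr powR_ge0.
Qed.

Let qs : s / 2 * (s / 2)^-1 = 1. Proof. by rewrite mulfV// gt_eqF// divr_gt0. Qed.

Let A := (\sum_m alpha m `^ (s / 2)) `^ s^-1.

Lemma sum_alpha_ge0 : 0 <= \sum_m alpha m `^ (s / 2).
Proof. by apply: sumr_ge0 => m _; exact: powR_ge0. Qed.

Lemma pE_tail : pE (fun th => (\sum_m `|S m (zeta th m)| `^ s) `^ s^-1)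
  <= M%:R `^ s^-1 * (s * expR (2^-1) * b)
     + 2 * s * expR (2^-1) * Num.sqrt (n%:R * eta) * (\sum_m N m `^ (s / 2)) `^ s^-1.
Proof.
have is1 : 0 < s^-1 <= 1 by rewrite invr_gt0 s0 invf_le1//= (le_trans _ s_ge2)// ler1n.
have sn0 : s != 0 by rewrite gt_eqF.
apply: (le_trans (pE_powR is1 _)).
  by move=> th; apply: sumr_ge0 => m _; exact: powR_ge0.
have K0 : 0 <= s * expR 2^-1 * b by rewrite !mulr_ge0 ?expR_ge0 ?(ltW s0).
have L0 : 0 <= 2 * s * expR (2^-1) * Num.sqrt (n%:R * eta).
  by rewrite !mulr_ge0 ?expR_ge0 ?(ltW s0) ?sqrtr_ge0.
set K := s * expR 2^-1 * b in K0 *; set L := 2 * s * _ * _ in L0 *.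
have SN : 0 <= \sum_m N m `^ (s / 2) by apply: sumr_ge0 => m _; exact: powR_ge0.
apply: (@le_trans _ _ ((M%:R * K `^ s + L `^ s * \sum_m N m `^ (s / 2)) `^ s^-1)).
  apply: ge0_ler_powR; rewrite ?nnegrE ?invr_ge0 ?(ltW s0)//.
  - by apply: pE_ge0 => th; apply: sumr_ge0 => m _; exact: powR_ge0.
  - by rewrite addr_ge0 ?mulr_ge0 ?powR_ge0.
  rewrite /pE pmean_sum -[X in X%:R](card_ord M) mulr_natl -sumr_const mulr_sumr -big_split/=.
  apply: ler_sum => m _; apply: le_trans (pE_block m) _; rewrite lerD2l.
  rewrite (_ : _ * Num.sqrt _ = L * Num.sqrt (N m)); last first.
    by rewrite /L mulrA sqrtrM ?mulr_ge0 ?(ltW eta_gt0)// mulrA.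
  by rewrite powRM ?sqrtr_ge0// -powR12_sqrt ?N0// -powRrM (mulrC 2^-1).
apply: (le_trans (powR_subadd _ _ is1)); rewrite ?mulr_ge0 ?powR_ge0//.
by clearbody K L; rewrite !powRM ?powR_ge0// -!powRrM !mulfV// !powRr1.
Qed.

Lemma sum_N_le : r * \sum_m N m <= A ^+ 2.
Proof.
have q1 : 1 <= s / 2 by rewrite ler_pdivlMr// mul1r.
have := @sum_le_power_mean R 'I_M N (s / 2) _ q1 N0; rewrite card_ord => /(_ M_gt0) h.
apply: (@le_trans _ _ (c * (\sum_m N m `^ (s / 2)) `^ (s / 2)^-1)).
  by rewrite cE -mulrA ler_wpM2l//; rewrite invf_div in h *.
have -> : A ^+ 2 = (\sum_m alpha m `^ (s / 2)) `^ (s / 2)^-1.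
  by rewrite -powR_mulrn ?powR_ge0// /A -powRrM invf_div; congr (_ `^ _); rewrite mulrC.
have -> : c = (c `^ (s / 2)) `^ (s / 2)^-1 by rewrite -powRrM qs powRr1 ?ltW.
have SN : 0 <= \sum_m N m `^ (s / 2) by apply: sumr_ge0 => m _; exact: powR_ge0.
rewrite -powRM ?powR_ge0//; apply: ge0_ler_powR.
- by rewrite invr_ge0 divr_ge0// ltW.
- by rewrite nnegrE mulr_ge0 ?powR_ge0.
- by rewrite nnegrE sum_alpha_ge0.
rewrite mulr_sumr; apply: ler_sum => m _; rewrite -powRM ?(ltW c0)//.
apply: ge0_ler_powR; rewrite ?nnegrE ?mulr_ge0 ?(ltW c0) ?divr_ge0 ?(ltW s0)//.
by apply: le_trans (N_alpha m); rewrite mulr_ge0 ?(ltW c0).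
Qed.

Lemma sum_N_powR_le : Num.sqrt c * (\sum_m N m `^ (s / 2)) `^ s^-1 <= A.
Proof.
have sn0 : s != 0 by rewrite gt_eqF.
have SN : 0 <= \sum_m N m `^ (s / 2) by apply: sumr_ge0 => m _; exact: powR_ge0.
have -> : Num.sqrt c = (c `^ (s / 2)) `^ s^-1.
  by rewrite -powR12_sqrt ?(ltW c0)// -powRrM; congr (_ `^ _); field.
rewrite -powRM ?powR_ge0//; apply: ge0_ler_powR.
- by rewrite invr_ge0 ltW.
- by rewrite nnegrE mulr_ge0 ?powR_ge0.
- by rewrite nnegrE sum_alpha_ge0.
rewrite mulr_sumr; apply: ler_sum => m _; rewrite -powRM ?(ltW c0)//.
apply: ge0_ler_powR; rewrite ?nnegrE ?mulr_ge0 ?(ltW c0) ?divr_ge0 ?(ltW s0)//.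
by apply: le_trans (N_alpha m); rewrite mulr_ge0 ?(ltW c0).
Qed.

Lemma finite_bound (err : R) (e : T -> R) :
  pE (fun th => A * (n%:R^-1 * `|\sum_i sgn R (th i).1|)
     + Num.sqrt r * (n%:R^-1 * Num.sqrt (\sum_m f m (zeta th m) (zeta th m)))
     + D * (n%:R^-1 * (\sum_m `|S m (zeta th m)| `^ s) `^ s^-1)
     + err * \sum_i e (th i).2)
  <= 4 * (A / Num.sqrt n%:R)
     + Num.sqrt (b ^+ 2 * expR 1) * D * M%:R `^ s^-1 * s / n%:R
     + err * (n%:R * \sum_k q k * e k).
Proof.
have A0 : 0 <= A by exact: powR_ge0.
have sn : Num.sqrt n%:R ^+ 2 = n%:R :> R by rewrite sqr_sqrtr.
have snp : 0 < Num.sqrt n%:R :> R by rewrite sqrtr_gt0.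
rewrite /pE !pmeanD !pmeanZ; apply: lerD; last first.
  have -> : pmean (signw q) (fun th : {ffun 'I_n -> bool * T} => \sum_i e (th i).2)
      = n%:R * \sum_u signw q u * e u.2.
    exact: pmean_sum_coord (signw_sum q_sum) n (fun u => e u.2).
  rewrite (sum_signw q (fun _ k => e k)) le_eqVlt; apply/orP; left; apply/eqP.
  by congr (_ * (_ * _)); apply: eq_bigr => k _; congr (_ * _); field.
set u := A / Num.sqrt n%:R.
have t0 : A * (n%:R^-1 * pE (fun th => `|\sum_i sgn R (th i).1|)) <= u.
  rewrite /u ler_wpM2l// ler_pdivrMl//; apply: (le_trans pE_signs).
  by rewrite -[in X in X / _]sn expr2 mulfK ?gt_eqF.
have t1 : Num.sqrt r * (n%:R^-1 * pE (fun th => Num.sqrt (\sum_m f m (zeta th m) (zeta th m)))) <= u.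
  apply: (@le_trans _ _ (Num.sqrt r * (n%:R^-1 * Num.sqrt (n%:R * \sum_m N m)))).
    by rewrite ler_wpM2l ?sqrtr_ge0// ler_wpM2l ?invr_ge0// pE_form.
  have -> : Num.sqrt r * (n%:R^-1 * Num.sqrt (n%:R * \sum_m N m))
      = Num.sqrt (r * \sum_m N m) / Num.sqrt n%:R.
    rewrite !sqrtrM// -[in n%:R^-1]sn; field; rewrite gt_eqF//.
  rewrite /u ler_wpM2r ?invr_ge0 ?sqrtr_ge0//.
  by rewrite -[leRHS](ger0_norm A0) -sqrtr_sqr ler_wsqrtr// sum_N_le.
have t2 : D * (n%:R^-1 * pE (fun th => (\sum_m `|S m (zeta th m)| `^ s) `^ s^-1))
    <= 2 * u + Num.sqrt (b ^+ 2 * expR 1) * D * M%:R `^ s^-1 * s / n%:R.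
  apply: (le_trans (ler_wpM2l (ltW D_gt0) (ler_wpM2l _ pE_tail))); first by rewrite invr_ge0.
  have e2 : Num.sqrt (expR 1) = expR (2^-1) :> R.
    rewrite -[RHS](ger0_norm (expR_ge0 _)) -sqrtr_sqr; congr Num.sqrt.
    by rewrite -expRM_natl; congr expR; field.
  have -> : Num.sqrt (b ^+ 2 * expR 1) = b * expR (2^-1).
    by rewrite sqrtrM ?sqr_ge0// sqrtr_sqr ger0_norm// e2.
  set G := (\sum_m N m `^ (s / 2)) `^ s^-1.
  have Ga : D * s * expR 2^-1 * Num.sqrt eta * G <= A.
    apply: le_trans sum_N_powR_le; rewrite -/G ler_wpM2r ?powR_ge0//.
    rewrite etaE sqrtrM ?(ltW a0)// ler_wpM2r ?sqrtr_ge0//.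
    rewrite (_ : a = expR 1 * (D * s) ^+ 2); last by rewrite aE; ring.
    rewrite sqrtrM ?expR_ge0// sqrtr_sqr e2.
    by rewrite ger0_norm ?mulr_ge0 ?(ltW D_gt0) ?(ltW s0)// mulrC.
  have u1 : n%:R^-1 * Num.sqrt n%:R = (Num.sqrt n%:R)^-1 :> R.
    by rewrite -[in n%:R^-1]sn; field; rewrite gt_eqF.
  rewrite sqrtrM// /u.
  have -> : D * (n%:R^-1 * (M%:R `^ s^-1 * (s * expR 2^-1 * b)
      + 2 * s * expR 2^-1 * (Num.sqrt n%:R * Num.sqrt eta) * G))
    = 2 * (D * s * expR 2^-1 * Num.sqrt eta * G * (n%:R^-1 * Num.sqrt n%:R))
      + b * expR 2^-1 * D * M%:R `^ s^-1 * s / n%:R by ring.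
  rewrite u1 lerD2r ler_wpM2l// ler_wpM2r// invr_ge0 ltW//.
move: t0 t1 t2; rewrite /pE; set X0 := A * _; set X1 := Num.sqrt r * _; set X2 := D * _.
by set X3 := Num.sqrt _ * _ * _ * _ / _; lra.
Qed.

End FiniteBound.

(** * Discretisation of the sample *)

Section Borel.
Context (T : topologicalType).

Let sT : sigma_algebra setT (@borel T) := smallest_sigma_algebra setT (@open T).

Lemma borel_open (A : set T) : open A -> borel A.
Proof. exact: sub_sigma_algebra. Qed.

Lemma borelC (A : set T) : borel A -> borel (~` A).
Proof. by case: sT => _ h _ /h; rewrite setTD. Qed.

Lemma borel_bigcup (A : nat -> set T) : (forall i, borel (A i)) -> borel (\bigcup_i A i).
Proof. by case: sT => _ _; apply. Qed.

Lemma borel_bigcap (A : nat -> set T) : (forall i, borel (A i)) -> borel (\bigcap_i A i).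
Proof.
move=> bA; rewrite -[X in borel X]setCK setC_bigcap; apply: borelC.
by apply: (@borel_bigcup (fun i => ~` A i)) => i; apply: borelC.
Qed.

Lemma borelT : borel (@setT T).
Proof. exact: borel_open openT. Qed.

End Borel.

Section RandomElement.
Context d (Omega : measurableType d) (R : realType) (P : probability Omega R).

Lemma borel_measurable_comp (T : topologicalType) (Y : Omega -> T) (g : T -> R) :
  (forall A, borel A -> measurable (Y @^-1` A)) -> continuous g ->
  measurable_fun setT (fun o => g (Y o)).
Proof.
move=> mY cg; apply: (measurability _ (RGenOInfty.measurableE R)) => //.
move=> _ [_ [a ->] <-]; rewrite setTI -[X in measurable X]/(Y @^-1` (g @^-1` _)).
by apply: mY; apply: borel_open; apply: open_comp => // x _; exact: cg.
Qed.

Lemma countable_dense_seq (T : topologicalType) (Y : Omega -> T) :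
  (exists2 S : set T, countable S & {ae P, forall o, closure S (Y o)}) ->
  exists s : nat -> T, {ae P, forall o, closure (range s) (Y o)}.
Proof.
move=> [S cS YS]; have [S0|/set0P[x Sx]] := eqVneq S set0.
  have [w] := ae_witness YS; rewrite S0 => /(_ _ filterT)[? []].
  by [].
have /pfcard_geP[S0|/unsquash s] := cS; first by move: Sx; rewrite S0.
exists s; apply: filterS YS => o; apply: closure_subset => z /(@surj _ _ _ _ s)[k _ <-].
by exists k.
Qed.

Context (M : nat) (H : 'I_M -> hilbert R).

Lemma closure_prod_ball (s : nat -> prod_space H) (z : prod_space H) (e : R) :
  closure (range s) z -> 0 < e -> exists k, forall m, `|z m - s k m| < e.
Proof.
move=> cz e0.
have nb : nbhs z [set y : prod_space H | forall m, `|z m - y m| < e].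
  apply: (@filter_forall _ _ (fun m (y : prod_space H) => `|z m - y m| < e) _ (nbhs_filter z)) => m.
  have := @proj_continuous _ H m z _ (@nbhsx_ballx _ _ (proj m z) e e0).
  by rewrite nbhs_filterE /= -ball_normE.
by have [_ [[k _ <-] h]] := cz _ nb; exists k.
Qed.

Lemma random_element_block (Y : Omega -> prod_space H) (m : 'I_M) (b : R) :
  random_element P Y -> {ae P, forall o, `|Y o m| <= b} ->
  bounded_element P (fun o => Y o m) b.
Proof.
move=> [mY _] bY; split=> // g cg.
apply: (@borel_measurable_comp _ Y (g \o proj m)) => // z.
by apply: continuous_comp; [exact: proj_continuous|exact: cg].
Qed.

Section Cells.
Context (s : nat -> prod_space H) (e : R) (N : nat).

Definition cell_ball k : set (prod_space H) :=
  [set y | forall m, `|y m - s k m| < e].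

Lemma open_cell_ball k : open (cell_ball k).
Proof.
rewrite openE => z zk; apply: (@filter_forall _ _ (fun m (y : prod_space H) => `|y m - s k m| < e) _ (nbhs_filter z)) => m.
have r0 : 0 < e - `|z m - s k m| by rewrite subr_gt0; exact: zk.
have := @proj_continuous _ H m z _ (@nbhsx_ballx _ _ (proj m z) _ r0).
rewrite nbhs_filterE /=; apply: (@filterS _ _ (nbhs_filter z)) => y; rewrite /= -ball_normE /ball_/= => h.
rewrite -(subrK (z m) (y m)) -addrA; apply: (le_lt_trans (ler_normD _ _)).
by rewrite -ltrBrDr distrC.
Qed.

(* The first [k < N] whose ball contains [y], and [N] when there is none. *)
Definition cell (y : prod_space H) : 'I_N.+1 :=
  inord (find (fun k => `[< cell_ball k y >]) (iota 0 N)).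

Lemma cell_val (y : prod_space H) :
  cell y = find (fun k => `[< cell_ball k y >]) (iota 0 N) :> nat.
Proof.
by rewrite /cell inordK// ltnS (leq_trans (find_size _ _))// size_iota.
Qed.

Lemma cellP (y : prod_space H) : (cell y < N)%N -> cell_ball (cell y) y.
Proof.
rewrite cell_val => lt.
have /(nth_find 0%N) : has (fun k => `[< cell_ball k y >]) (iota 0 N).
  by rewrite has_find size_iota.
by rewrite nth_iota// add0n => /asboolP.
Qed.

Lemma cell_before (y : prod_space H) k : (k < cell y)%N -> ~ cell_ball k y.
Proof.
move=> kc; have kN : (k < N)%N by rewrite (leq_trans kc)// -ltnS.
move: kc; rewrite cell_val => /(before_find 0%N).
by rewrite nth_iota// add0n => /asboolP.
Qed.

Lemma borel_cell (c : 'I_N.+1) : borel (cell @^-1` [set c]).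
Proof.
pose U k := if (k < c)%N then ~` cell_ball k else
  if (k == c) && (c < N)%N then cell_ball k else setT.
have -> : cell @^-1` [set c] = \bigcap_k U k.
  apply/seteqP; split=> [y /= yc k _|y Uy /=].
    rewrite /U; case: ltnP => [kc|_]; first by apply: cell_before; rewrite yc.
    by case: andP => // -[/eqP -> cN]; rewrite -{1}yc; apply: cellP; rewrite yc.
  apply: val_inj => /=; apply/eqP; rewrite eqn_leq; apply/andP; split.
    have [cN|Nc] := ltnP c N; last by apply: leq_trans Nc; rewrite -ltnS.
    rewrite leqNgt; apply/negP => /cell_before; apply.
    by have := Uy c I; rewrite /U ltnn eqxx cN.
  rewrite leqNgt; apply/negP => fc.
  have := Uy (cell y) I; rewrite /U fc; apply; apply: cellP.
  by apply: leq_trans fc _; rewrite -ltnS.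
apply: borel_bigcap => k; rewrite /U; case: ifP => _.
  by apply: borelC; apply: borel_open; exact: open_cell_ball.
case: ifP => _; [by apply: borel_open; exact: open_cell_ball|exact: borelT].
Qed.

End Cells.

Lemma rest_cell_small (Y : Omega -> prod_space H) (s : nat -> prod_space H) (e : R) :
  random_element P Y -> {ae P, forall o, closure (range s) (Y o)} -> 0 < e ->
  exists N, fine (P [set o | cell s e N (Y o) = ord_max]) <= e.
Proof.
move=> [mY _] cY e0.
pose G N := [set o | cell s e N (Y o) = ord_max].
have mG N : measurable (G N) by apply: (mY (cell s e N @^-1` [set ord_max])); exact: borel_cell.
have : mean P (\1_(G N) : Omega -> R) @[N --> \oo] --> mean P (fun=> 0 : R).
  apply: (@mean_cvg _ _ _ _ _ _ 1).
  - by move=> N; exact: measurable_indic.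
  - by move=> N; apply: aeW => o; rewrite indicE; case: (_ \in _); rewrite ?normr1// normr0 ler01.
  - exact: measurable_cst.
  apply: filterS cY => o co; have [k kb] := closure_prod_ball co e0.
  apply: cvg_near_cst; exists k.+1 => // N /= kN.
  rewrite indicE memNset// => h; have : (cell s e N (Y o) < N)%N.
    rewrite cell_val -[X in (_ < X)%N](size_iota 0) -has_find; apply/hasP; exists k.
      by rewrite mem_iota.
    by apply/asboolP => m.
  by rewrite h /= ltnn.
rewrite mean_cst => /cvgr_le /(_ e e0)[N _ /(_ N (leqnn N))].
by rewrite mean_indic//; exists N.
Qed.

End RandomElement.

Section Conditional.
Context d (Omega : measurableType d) (R : realType) (P : probability Omega R).
Context (H : hilbert R) (Y : Omega -> H) (b : R) (hY : bounded_element P Y b).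
Context (G : set Omega) (mG : measurable G) (rho : H).
Hypothesis hrho : forall v, hdot rho v = mean P (fun o => \1_G o * hdot (Y o) v).

Let p := fine (P G).
Let yG := p^-1 *: rho.

Let aG : aebounded P (\1_G : Omega -> R) := aeb_indic P mG.

Let p0 : 0 <= p. Proof. by rewrite fine_ge0. Qed.

Lemma mean_indic_norm_le (f : Omega -> R) (c : R) : aebounded P f ->
  {ae P, forall o, G o -> `|f o| <= c} -> `|mean P (fun o => \1_G o * f o)| <= p * c.
Proof.
move=> hf fc; have cG : aebounded P (fun o => \1_G o * c) by apply: aebM => //; exact: aeb_cst.
have -> : p * c = mean P (fun o => \1_G o * c).
  by rewrite /p -mean_indic// mulrC -meanZ//; congr mean; apply/funext => o; rewrite mulrC.
have hGf : aebounded P (fun o => \1_G o * f o) by exact: aebM.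
rewrite ler_norml -meanN//; apply/andP; split; apply: mean_le => //; try exact: aebN.
  apply: filterS fc => o; rewrite indicE; case: (boolP (o \in G)) => [/set_mem Go /(_ Go)|_ _].
    by rewrite !mul1r ler_norml => /andP[].
  by rewrite !mul0r oppr0.
apply: filterS fc => o; rewrite indicE; case: (boolP (o \in G)) => [/set_mem Go /(_ Go)|_ _].
  by rewrite !mul1r ler_norml => /andP[].
by rewrite !mul0r.
Qed.

Lemma cond_rhoE : rho = p *: yG.
Proof.
rewrite /yG scalerA; have [pz|pn] := eqVneq p 0; last by rewrite mulfV// scale1r.
rewrite pz mul0r scale0r; apply/eqP; rewrite -normr_eq0 -sqrf_eq0 -hdot_norm hrho -normr_le0.
have [c hc] := (be_hdot rho hY).2.
apply: (le_trans (mean_indic_norm_le (c := c) (be_hdot rho hY) _)).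
  by apply: filterS hc => o.
by rewrite pz mul0r.
Qed.

Lemma cond_dist (h : H) (e : R) : p != 0 -> 0 <= e ->
  {ae P, forall o, G o -> `|Y o - h| <= e} -> `|yG - h| <= e.
Proof.
move=> pn e0 Yh; set v := yG - h.
have [->|v0] := eqVneq v 0; first by rewrite normr0.
have pp : 0 < p by rewrite lt_neqAle eq_sym pn.
rewrite -(@ler_pM2r _ `|v|) ?normr_gt0// -(ler_pM2l pp) -expr2 -hdot_norm.
have -> : p * hdot v v = mean P (fun o => \1_G o * hdot (Y o - h) v).
  have -> : (fun o => \1_G o * hdot (Y o - h) v)
      = fun o => \1_G o * hdot (Y o) v - hdot h v * \1_G o.
    by apply/funext => o; rewrite hdotBl; ring.
  rewrite meanB; [|exact: aebM (be_hdot v hY)|exact: aebZ].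
  by rewrite meanZ// mean_indic// -/p -hrho cond_rhoE hdotZl {1}/v hdotBl; ring.
apply: le_trans (ler_norm _) _; apply: mean_indic_norm_le.
  under eq_fun do rewrite hdotBl.
  by apply: aebB; [exact: be_hdot v hY|exact: aeb_cst].
apply: filterS Yh => o Yh Go; apply: (le_trans (hdot_CS _ _)).
by rewrite ler_wpM2r// Yh.
Qed.

Lemma cond_norm : `|yG| <= b.
Proof.
have [pz|pn] := eqVneq p 0; first by rewrite /yG pz invr0 scale0r normr0 (be_bnd_ge0 hY).
rewrite -(subr0 yG); apply: cond_dist => //; first exact: be_bnd_ge0 hY.
by apply: filterS (be_bnd hY) => o Yb _; rewrite subr0.
Qed.

Lemma cond_jensen (f : H -> H) : psd_form (fun u v => hdot (f u) v) ->
  aebounded P (fun o => hdot (f (Y o)) (Y o)) ->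
  p * hdot (f yG) yG <= mean P (fun o => \1_G o * hdot (f (Y o)) (Y o)).
Proof.
move=> pf hf.
have e' o z : \1_G o * hdot (f (Y o - z)) (Y o - z)
    = \1_G o * hdot (f (Y o)) (Y o) - (2 * (\1_G o * hdot (Y o) (f z)) - hdot (f z) z * \1_G o).
  rewrite (opB pf) !hdotE (op_sym pf (Y o) z) (hdotC (f z) (Y o)).
  by ring.
have e o := e' o yG.
have h1 := aebM aG hf.
have h2 := aebZ 2 (aebM aG (be_hdot (f yG) hY)).
have h3 := aebZ (hdot (f yG) yG) aG.
have : 0 <= mean P (fun o => \1_G o * hdot (f (Y o - yG)) (Y o - yG)).
  apply: mean_ge0.
    by under eq_fun do rewrite e; exact: aebB h1 (aebB h2 h3).
  apply: aeW => o; by rewrite mulr_ge0 ?(psd_ge0 pf)// indicE ler0n.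
under eq_fun do rewrite e.
rewrite (meanB h1 (aebB h2 h3)) (meanB h2 h3) meanZ; last exact: aebM (be_hdot _ hY).
rewrite meanZ// mean_indic// -/p -hrho cond_rhoE hdotZl (hdotC yG).
by set X := hdot _ _; set Z := mean P _; lra.
Qed.

End Conditional.

Section SupIntegral.
Context d (Omega : measurableType d) (R : realType) (P : probability Omega R).

(* [f] need not be measurable: the supremum over the class may fail to be. *)
Lemma integral_le_discrete (F : finType) (theta : Omega -> F) (Psi : F -> R)
    (f : Omega -> \bar R) :
  (forall k, measurable [set o | theta o = k]) -> (forall k, 0 <= Psi k) ->
  (forall o, 0 <= f o)%E -> {ae P, forall o, (f o <= (Psi (theta o))%:E)%E} ->
  (\int[P]_o f o <= (\sum_k fine (P [set o | theta o = k]) * Psi k)%:E)%E.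
Proof.
move=> mth Psi0 f0 [B [mB B0 fB]].
pose G k := [set o | theta o = k].
have PE o : Psi (theta o) = \sum_k Psi k * \1_(G k) o.
  rewrite (bigD1 (theta o))//= indicE mem_set// mulr1 big1 ?addr0// => k kt.
  by rewrite indicE memNset ?mulr0// => /= e; rewrite -e eqxx in kt.
have hG k : aebounded P (fun o => Psi k * \1_(G k) o).
  by apply: aebZ; exact: (aeb_indic P (mth k)).
have hP : aebounded P (fun o => Psi (theta o)).
  by under eq_fun do rewrite PE; exact: aeb_sum.
have mP : mean P (fun o => Psi (theta o)) = \sum_k fine (P (G k)) * Psi k.
  under eq_fun do rewrite PE.
  rewrite mean_sum//; apply: eq_bigr => k _.
  by rewrite (meanZ _ (aeb_indic P (mth k))) (mean_indic P (mth k)) mulrC.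
pose g o : \bar R := if o \in B then +oo%E else (Psi (theta o))%:E.
have fg o : (f o <= g o)%E.
  rewrite /g; case: ifPn => [_|/negP oB]; first exact: leey.
  by apply: contrapT => h; apply: oB; rewrite inE; exact: fB.
have g0 o : (0 <= g o)%E := le_trans (f0 o) (fg o).
have mg : measurable_fun setT g.
  apply: measurable_fun_ifT => //.
  - by apply: (measurable_fun_bool true); rewrite setTI (_ : _ @^-1` _ = B)//; apply/seteqP; split=> z /=; [exact: set_mem|exact: mem_set].
  - by apply/measurable_EFinP; case: hP.
rewrite -mP -meanE// expectation.unlock.
have <- : (\int[P]_o g o = \int[P]_o (Psi (theta o))%:E)%E.
  apply: ae_eq_integral => //; first by apply/measurable_EFinP; case: hP.
  exists B; split=> // o; apply: contra_notP => oB _.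
  by rewrite /g memNset.
rewrite !ge0_integralTE//; apply: ereal_sup_le => _ [h hf <-]; exists h => // o.
exact: le_trans (hf o) (fg o).
Qed.

End SupIntegral.

Section Pointwise.
Context (R : realType) (M n : nat) (H : 'I_M -> hilbert R).
Context (mu : forall m, H m) (C T : forall m, H m -> H m) (p t s D r A eta : R).
Arguments C : clear implicits.
Arguments T : clear implicits.
Hypotheses (p_ge1 : 1 <= p) (t_ge : p <= t) (s_gt0 : 0 < s) (ts : t^-1 + s^-1 = 1).
Hypotheses (D_gt0 : 0 < D).
Hypothesis pC : forall m, psd_form (fun u v => hdot (C m u) v).
Hypothesis TE : forall m u, C m (T m u) + eta *: T m u = u.

Lemma norm2p_sum (w : prod_space H) : (norm2p p w <= D%:E)%E ->
  \sum_m `|w m| `^ p <= D `^ p.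
Proof.
have p0 : 0 < p by exact: lt_le_trans p_ge1.
rewrite /norm2p /lpnorm.
under eq_bigr => m _ do rewrite gee0_abs ?lee_fin// poweR_EFin.
rewrite sumEFin poweR_EFin lee_fin => h.
have S0 : 0 <= \sum_m `|w m| `^ p by apply: sumr_ge0 => m _; exact: powR_ge0.
have := ge0_ler_powR (ltW p0) _ _ h; rewrite !nnegrE powR_ge0 (ltW D_gt0).
by rewrite -powRrM mulVf ?gt_eqF// powRr1//; apply.
Qed.

Lemma norm_le_of_sum (w : forall m, H m) : \sum_m `|w m| `^ p <= D `^ p ->
  forall m, `|w m| <= D.
Proof.
move=> wp m; have p0 : 0 < p by exact: lt_le_trans p_ge1.
rewrite leNgt; apply/negP => Dw; have := gt0_ltr_powR p0 _ _ Dw.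
rewrite !nnegrE normr_ge0 (ltW D_gt0) => /(_ isT isT); apply/negP; rewrite -leNgt.
apply: le_trans wp; rewrite (bigD1 m)//= lerDl.
by apply: sumr_ge0 => i _; exact: powR_ge0.
Qed.

Lemma sum_powR_mono (w : forall m, H m) : \sum_m `|w m| `^ p <= D `^ p ->
  \sum_m `|w m| `^ t <= D `^ t.
Proof.
move=> wp; have wD := norm_le_of_sum wp.
have p0 : 0 < p by exact: lt_le_trans p_ge1.
have t0 : 0 < t by exact: lt_le_trans t_ge.
apply: (@le_trans _ _ (\sum_m D `^ (t - p) * `|w m| `^ p)).
  apply: ler_sum => m _; have [->|w0] := eqVneq (w m) 0.
    by rewrite normr0 !powR0 ?gt_eqF// mulr0.
  have wp0 : 0 < `|w m| by rewrite normr_gt0.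
  have -> : `|w m| `^ t = `|w m| `^ (t - p) * `|w m| `^ p.
    by rewrite -powRD ?subrK// (gt_eqF wp0) implybT.
  rewrite ler_wpM2r ?powR_ge0//; apply: ge0_ler_powR; rewrite ?nnegrE ?subr_ge0 ?(ltW D_gt0)//.
rewrite -mulr_sumr; apply: (le_trans (ler_wpM2l (powR_ge0 _ _) wp)).
by rewrite -powRD ?subrK// (gt_eqF D_gt0) implybT.
Qed.

Lemma sum_hdot_le (w v : forall m, H m) (Y : R) : 0 <= Y ->
  \sum_m `|w m| `^ p <= D `^ p -> \sum_m `|v m| `^ s <= Y `^ s ->
  `|\sum_m hdot (w m) (v m)| <= D * Y.
Proof.
move=> Y0 wp vY; apply: (le_trans (ler_norm_sum _ _ _)).
apply: (@le_trans _ _ (\sum_m `|w m| * `|v m|)).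
  by apply: ler_sum => m _; exact: hdot_CS.
apply: (@hoelder_sum R _ _ _ t s) => //; last exact: sum_powR_mono.
by apply: lt_le_trans t_ge; exact: lt_le_trans p_ge1.
Qed.

Lemma sum_form_CS (w v : forall m, H m) : \sum_m hdot (C m (w m)) (w m) <= r ->
  \sum_m hdot (C m (v m)) (w m)
    <= Num.sqrt r * Num.sqrt (\sum_m hdot (C m (v m)) (v m)).
Proof.
move=> wr; have F0 : 0 <= \sum_m hdot (C m (v m)) (v m).
  by apply: sumr_ge0 => m _; exact: psd_ge0 (pC m) _.
have r0 : 0 <= r.
  by apply: le_trans wr; apply: sumr_ge0 => m _; exact: psd_ge0 (pC m) _.
apply: le_trans (ler_norm _) _.
rewrite -sqrtrM// -sqrtr_sqr ler_wsqrtr// mulrC.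
apply: le_trans (ler_wpM2l F0 wr); apply: quad_discr => // x.
have -> : (\sum_m hdot (C m (v m)) (v m)) * x ^+ 2 + 2 * (\sum_m hdot (C m (v m)) (w m)) * x
   + \sum_m hdot (C m (w m)) (w m)
   = \sum_m hdot (C m (x *: v m + w m)) (x *: v m + w m).
  rewrite mulr_suml mulr_sumr mulr_suml -!big_split/=; apply: eq_bigr => m _.
  by rewrite (psdD (pC m)) (psdZ (pC m)) !(psdDr (pC m)) !(psdZr (pC m)) (psdC (pC m) (w m) (v m)); ring.
by apply: sumr_ge0 => m _; exact: psd_ge0 (pC m) _.
Qed.

(* Since [C T + eta T = id], [<w, zeta>] splits into [<w, C T zeta>], bounded via
   the variance constraint, and [<w, eta T zeta>], bounded via the norm. *)
Lemma sup_pointwise (w : prod_space H) (xs : 'I_n -> prod_space H) (sg : 'I_n -> bool)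
    (y : 'I_n -> forall m, H m) (e : 'I_n -> R) (zeta : forall m, H m) :
  (forall m, zeta m = \sum_i sgn R (sg i) *: y i m) ->
  \sum_m `|w m| `^ p <= D `^ p ->
  \sum_m hdot (C m (w m)) (w m) <= r ->
  `|\sum_m hdot (w m) (mu m)| <= A ->
  (forall i m, `|xs i m - mu m - y i m| <= e i) ->
  \sum_m hdot (w m) (n%:R^-1 *: \sum_i sgn R (sg i) *: xs i m)
  <= A * (n%:R^-1 * `|\sum_i sgn R (sg i)|)
     + Num.sqrt r * (n%:R^-1 * Num.sqrt (\sum_m hdot (C m (T m (zeta m))) (T m (zeta m))))
     + D * (n%:R^-1 * (\sum_m `|eta *: T m (zeta m)| `^ s) `^ s^-1)
     + D * M%:R / n%:R * \sum_i e i.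
Proof.
move=> zetaE wp wr wmu xe.
have in0 : 0 <= n%:R^-1 :> R by rewrite invr_ge0.
pose er i m := xs i m - mu m - y i m.
have split m : hdot (w m) (n%:R^-1 *: \sum_i sgn R (sg i) *: xs i m)
  = n%:R^-1 * ((\sum_i sgn R (sg i)) * hdot (w m) (mu m) + hdot (C m (T m (zeta m))) (w m)
    + hdot (w m) (eta *: T m (zeta m)) + \sum_i sgn R (sg i) * hdot (w m) (er i m)).
  have -> : \sum_i sgn R (sg i) *: xs i m = (\sum_i sgn R (sg i)) *: mu m
       + (C m (T m (zeta m)) + eta *: T m (zeta m)) + \sum_i sgn R (sg i) *: er i m.
    rewrite TE zetaE scaler_suml -!big_split/=; apply: eq_bigr => i _.
    by rewrite -!scalerDr /er addrAC -addrA subrK addrC subrK.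
  rewrite hdotZr; congr (_ * _); rewrite !(psdDr (hdot_psd _)) hdotZr (hdotC (w m) (C m _)).
  rewrite (psd_sumr (hdot_psd _)) addrA; congr (_ + _).
  by apply: eq_bigr => i _; rewrite hdotZr.
rewrite (eq_bigr _ (fun m _ => split m)) -mulr_sumr !big_split/= -mulr_sumr !mulrDr.
apply: lerD; [apply: lerD; [apply: lerD|]|].
- rewrite [leRHS]mulrCA ler_wpM2l//; apply: (le_trans (ler_norm _)).
  by rewrite normrM mulrC ler_wpM2r.
- by rewrite [leRHS]mulrCA ler_wpM2l//; exact: sum_form_CS.
- rewrite [leRHS]mulrCA ler_wpM2l//; apply: le_trans (ler_norm _) _.
  have SS : 0 <= \sum_m `|eta *: T m (zeta m)| `^ s.
    by apply: sumr_ge0 => m _; exact: powR_ge0.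
  apply: sum_hdot_le => //; first exact: powR_ge0.
  by rewrite -powRrM mulVf ?gt_eqF// powRr1.
- rewrite mulrAC (mulrC _ n%:R^-1) ler_wpM2l//.
  apply: (@le_trans _ _ (\sum_(m < M) \sum_i D * e i)).
    apply: ler_sum => m _; apply: ler_sum => i _; apply: (le_trans (ler_norm _)).
    rewrite normrM; have -> : `|sgn R (sg i)| = 1.
      by rewrite /sgn; case: (sg i); rewrite ?normrN normr1.
    rewrite mul1r; apply: (le_trans (hdot_CS _ _)); apply: ler_pM => //.
      exact: norm_le_of_sum.
    exact: xe.
  rewrite (eq_bigr (fun=> D * \sum_i e i)) => [|m _]; last by rewrite mulr_sumr.
  by rewrite sumr_const card_ord -[X in X <= _]mulr_natr mulrAC.
Qed.

Context (alpha : 'I_M -> R) (a c : R).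
Hypotheses (r_ge0 : 0 <= r) (M_gt0 : (0 < M)%N) (s_ge2 : 2 <= s).
Hypotheses (aE : a = expR 1 * D ^+ 2 * s ^+ 2) (cE : c = r * M%:R `^ (1 - 2 / s)).
Hypotheses (c_gt0 : 0 < c).
Hypothesis mu_alpha : forall m, Num.min c (a * `|mu m| ^+ 2) <= alpha m.

Lemma mean_part_le (w : prod_space H) : \sum_m `|w m| `^ p <= D `^ p ->
  (\sum_m hdot (w m) (mu m)) ^+ 2 <= r ->
  `|\sum_m hdot (w m) (mu m)| <= (\sum_m alpha m `^ (s / 2)) `^ s^-1.
Proof.
move=> wp wr.
have a0 : 0 < a by rewrite aE !mulr_gt0 ?expR_gt0 ?exprn_gt0.
have al0 m : 0 <= alpha m.
  by apply: le_trans (mu_alpha m); rewrite le_min (ltW c_gt0) mulr_ge0 ?sqr_ge0 ?(ltW a0).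
have s20 : 0 < s / 2 by rewrite divr_gt0.
have rc : r <= c.
  rewrite cE ler_peMr// -[X in X <= _](powRr0 M%:R); apply: ler_powR; rewrite ?ler1n//.
  by rewrite subr_ge0 ler_pdivrMr// mul1r.
have [[m cm]|/forallNP nm] := pselect (exists m, c <= a * `|mu m| ^+ 2).
  have ca : r <= alpha m by apply: (le_trans rc); apply: le_trans (mu_alpha m); rewrite min_l.
  apply: (@le_trans _ _ (Num.sqrt r)).
    by rewrite -sqrtr_sqr ler_wsqrtr.
  apply: (@le_trans _ _ ((alpha m `^ (s / 2)) `^ s^-1)).
    rewrite -powRrM (_ : s / 2 / s = 2^-1); last by field; rewrite gt_eqF.
    by rewrite powR12_sqrt// ler_wsqrtr.
  apply: ge0_ler_powR; rewrite ?nnegrE ?invr_ge0 ?(ltW s_gt0) ?powR_ge0//.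
    by apply: sumr_ge0 => i _; exact: powR_ge0.
  by rewrite (bigD1 m)//= lerDl; apply: sumr_ge0 => i _; exact: powR_ge0.
set Z := (\sum_m alpha m `^ (s / 2)) `^ s^-1.
have Z0 : 0 <= Z by exact: powR_ge0.
have := @sum_hdot_le w mu (Z / D) _ wp _.
rewrite mulrCA mulfV ?gt_eqF// mulr1; apply; first by rewrite divr_ge0 ?(ltW D_gt0).
have -> : (Z / D) `^ s = \sum_m (alpha m / D ^+ 2) `^ (s / 2).
  have e : D `^ s = (D ^+ 2) `^ (s / 2).
    by rewrite -powR_mulrn ?(ltW D_gt0)// -powRrM; congr (_ `^ _); field.
  rewrite powRM ?invr_ge0 ?(ltW D_gt0)// /Z -powRrM mulVf ?gt_eqF// powRr1; last first.
    by apply: sumr_ge0 => i _; exact: powR_ge0.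
  rewrite mulr_suml; apply: eq_bigr => m _.
  rewrite powRM ?invr_ge0 ?sqr_ge0//; congr (_ * _).
  have iv (u k : R) : 0 <= u -> (u^-1) `^ k = (u `^ k)^-1.
    by move=> u0; rewrite -[in LHS]powR_inv1// -powRrM mulN1r powRN.
  by rewrite !iv ?sqr_ge0 ?(ltW D_gt0)// e.
apply: ler_sum => m _.
have -> : `|mu m| `^ s = (`|mu m| ^+ 2) `^ (s / 2).
  by rewrite -powR_mulrn// -powRrM; congr (_ `^ _); field.
apply: ge0_ler_powR; rewrite ?nnegrE ?divr_ge0 ?sqr_ge0 ?(ltW s_gt0)//.
rewrite ler_pdivlMr ?exprn_gt0//; have := mu_alpha m.
have /negP := nm m; rewrite -ltNge => /ltW h; rewrite min_r//.
apply: le_trans; rewrite mulrC ler_wpM2r ?sqr_ge0// aE.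
rewrite -mulrA mulrCA ler_peMr ?sqr_ge0//.
apply: (@le_trans _ _ (1 * 1)); first by rewrite mulr1.
apply: ler_pM => //; first by rewrite -(expR0 R) ler_expR.
by rewrite expr_ge1// (le_trans _ s_ge2)// ler1n.
Qed.

End Pointwise.

Section SecondMoment.
Context d (Omega : measurableType d) (R : realType) (P : probability Omega R).
Context (M : nat) (H : 'I_M -> hilbert R) (x : Omega -> prod_space H).
Context (mu : forall m, H m) (C : forall m, H m -> H m) (b : R).
Arguments C : clear implicits.
Hypothesis hx : forall m, bounded_element P (fun o => x o m) b.
Hypothesis hmu : forall m v, hdot (mu m) v = mean P (fun o => hdot (x o m) v).
Hypothesis hxm : forall m, bounded_element P (fun o => x o m - mu m) (2 * b).
Hypothesis hC : forall m, cov_op P (fun o => x o m - mu m) (C m).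
Hypothesis hU : pairwise_uncorrelated P x.

(* Bias-variance decomposition; by (U) the covariances across blocks vanish. *)
Lemma second_moment_split (w : prod_space H) :
  second_moment P x (pdot w)
  = ((\sum_m hdot (w m) (mu m)) ^+ 2 + \sum_m hdot (C m (w m)) (w m))%:E.
Proof.
pose f m o := hdot (x o m - mu m) (w m).
pose k := \sum_m hdot (w m) (mu m).
have hf m : aebounded P (f m) := be_hdot (w m) (hxm m).
have f0 m : mean P (f m) = 0.
  rewrite /f; under eq_fun do rewrite hdotBl.
  by rewrite meanB ?mean_cst -?hmu ?subrr//; [exact: be_hdot _ (hx m)|exact: aeb_cst].
have pE o : pdot w (x o) ^+ 2
    = (\sum_m \sum_m' f m o * f m' o) + (2 * k * (\sum_m f m o) + k ^+ 2).
  have -> : pdot w (x o) = \sum_m f m o + k.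
    rewrite /pdot /k -big_split/=; apply: eq_bigr => m _.
    by rewrite /f hdotBl (hdotC (mu m)) subrK hdotC.
  have -> : \sum_m \sum_m' f m o * f m' o = (\sum_m f m o) * (\sum_m f m o).
    by rewrite mulr_suml; apply: eq_bigr => m _; rewrite mulr_sumr.
  by ring.
have h1 : aebounded P (fun o => \sum_m \sum_m' f m o * f m' o).
  by apply: aeb_sum => m; apply: aeb_sum => m'; exact: aebM.
have h2 : aebounded P (fun o => 2 * k * (\sum_m f m o)).
  by apply: aebZ; exact: aeb_sum.
have h3 : aebounded P (fun o => 2 * k * (\sum_m f m o) + k ^+ 2).
  by apply: aebD => //; exact: aeb_cst.
rewrite /second_moment; under eq_fun do rewrite pE.
rewrite meanE ?meanD//; [|exact: aeb_cst|exact: aebD].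
rewrite meanZ; last exact: aeb_sum.
rewrite [X in 2 * k * X]mean_sum// big1 ?mulr0 ?add0r => [|m _]; last exact: f0.
rewrite mean_cst addrC; congr (_ + _)%:E.
rewrite mean_sum => [|m]; last by apply: aeb_sum => m'; exact: aebM.
apply: eq_bigr => m _; rewrite mean_sum => [|m']; last exact: aebM.
rewrite (bigD1 m)//= -(@hC m) big1 ?addr0// => m' mm'.
have := hU (w m) (w m') (_ : m != m'); rewrite eq_sym mm' => /(_ isT).
have mX m1 : fine 'E_P[fun o => hdot (w m1) (x o m1)]%E = hdot (mu m1) (w m1).
  by rewrite hmu /mean; congr (fine _); congr expectation; apply/funext => o; rewrite hdotC.
rewrite covariance.unlock !mX => h; rewrite /mean.
have -> : (fun o => f m o * f m' o) = ((fun o => hdot (w m) (x o m)) \- cst (hdot (mu m) (w m)))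
   * ((fun o => hdot (w m') (x o m')) \- cst (hdot (mu m') (w m'))).
  by apply/funext => o; rewrite /f !hdotBl !(hdotC (x o _)).
by rewrite h.
Qed.

End SecondMoment.

(** * The local Rademacher complexity *)

Section Conclusion.
Context (R : realType).

Lemma hoelder_conjugate_EFin (t : R) : 1 < t ->
  hoelder_conjugate t%:E = (t / (t - 1))%:E.
Proof.
move=> t1; rewrite /hoelder_conjugate /= eqe gt_eqF ?(lt_trans ltr01)//.
by rewrite -EFinB inver subr_eq0 gt_eqF// EFinM.
Qed.

Lemma lpnorm_EFin (M : nat) (q : R) (f : 'I_M -> R) : (forall m, 0 <= f m) ->
  lpnorm q (fun m => (f m)%:E) = ((\sum_m f m `^ q) `^ q^-1)%:E.
Proof.
move=> f0; rewrite /lpnorm -poweR_EFin -sumEFin; congr (_ `^ _)%E.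
by apply: eq_bigr => m _; rewrite gee0_abs ?lee_fin// poweR_EFin.
Qed.

Lemma lpnorm_eqy (M : nat) (q : R) (f : 'I_M -> \bar R) m : 0 < q -> f m = +oo%E ->
  lpnorm q f = +oo%E.
Proof.
move=> q0 fm; have qn : q != 0 by rewrite gt_eqF.
have iqn : q^-1 != 0 by rewrite invr_eq0.
rewrite /lpnorm (bigD1 m)//= fm; set Y := (\sum_(i < M | _) _)%E.
have Y0 : (0 <= Y)%E by apply: sume_ge0 => i _; exact: poweR_ge0.
have -> : (`|+oo| `^ q + Y = +oo)%E.
  by rewrite gee0_abs ?leey// poweRyr// addye// gt_eqF// (lt_le_trans _ Y0)// ltNyr.
by rewrite poweRyr.
Qed.

Lemma spectral_sum_ge (c a : R) (lambda : nat -> R) k : 0 <= c -> 0 <= a ->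
  (forall j, 0 <= lambda j) ->
  ((\sum_(j < k) Num.min c (a * lambda j))%:E <= spectral_sum c a lambda)%E.
Proof.
move=> c0 a0 l0; rewrite /spectral_sum -(big_mkord xpredT (fun j => Num.min c (a * lambda j))) -sumEFin.
by apply: nneseries_lim_ge => j _ _; rewrite lee_fin le_min c0 mulr_ge0.
Qed.

End Conclusion.

Section Assembly.
Context (R : realType) (M n : nat) (M_gt0 : (0 < M)%N) (n_gt0 : (0 < n)%N).
Context (H : 'I_M -> hilbert R) d (Omega : measurableType d) (P : probability Omega R).
Context (x : Omega -> prod_space H) (x_random : random_element P x).
Context (xs : 'I_n -> Omega -> prod_space H).
Context (xs_random : forall i, random_element P (xs i)).
Context (xs_law : forall i, same_law P (xs i) x).
Context (sigma : 'I_n -> {RV P >-> R}).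
Context (sigma_rademacher : forall i, is_rademacher (sigma i)).
Context (sample_indep : mutually_independent P (sample_algebras xs sigma)).
Context (b : R) (xb : forall m, {ae P, forall o, `|x o m| <= b}).
Context (s : nat -> prod_space H) (x_dense : {ae P, forall o, closure (range s) (x o)}).

Let b0 : 0 <= b.
Proof. by have [w] := ae_witness (xb (Ordinal M_gt0)); apply: le_trans. Qed.

Lemma ae_sample_norm : {ae P, forall o, forall i m, `|xs i o m| <= b}.
Proof.
apply: filter_forall => i; apply: filter_forall => m.
pose B := [set z : prod_space H | b < `|z m|].
have oB : open B.
  rewrite (_ : B = proj m @^-1` [set v : H m | b < `|v|])//.
  apply: open_comp => [z _|]; first exact: proj_continuous.
  have -> : [set v : H m | b < `|v|] = (fun v => `|v|) @^-1` [set r : R | b < r] by [].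
  by apply: open_comp => [z _|]; [exact: norm_continuous|exact: open_gt].
have bB := borel_open oB.
have mB (Y : Omega -> prod_space H) : random_element P Y -> measurable (Y @^-1` B).
  by move=> [mY _]; exact: mY.
have xB0 : P (x @^-1` B) = 0%E.
  apply/negligibleP; first exact: mB.
  by apply: negligibleS (xb m) => o /= h; apply/negP; rewrite -ltNge.
exists (xs i @^-1` B); split; [exact: mB|by rewrite (xs_law i)|].
by move=> o /= /negP; rewrite -ltNge.
Qed.

Lemma ae_sample_sign : {ae P, forall o, forall i, sigma i o = sgn R (sigma i o == 1)}.
Proof.
apply: filter_forall => i; have [h1 h2] := sigma_rademacher i.
have m1 r : measurable (sigma i @^-1` [set r]).
  by rewrite -[X in measurable X]setTI; exact: measurable_funP.
exists (~` (sigma i @^-1` [set 1] `|` sigma i @^-1` [set -1])); split.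
- by apply: measurableC; exact: measurableU.
- have PU : P (sigma i @^-1` [set 1] `|` sigma i @^-1` [set -1]) = 1%E.
    rewrite measureU//; last first.
      apply/seteqP; split=> // o [/= -> /eqP].
      by rewrite -subr_eq0 opprK -(natrD _ 1 1) pnatr_eq0.
    apply: (etrans (congr2 _ h1 h2)).
    by rewrite -EFinD; congr EFin; lra.
  by rewrite probability_setC ?PU ?subee//; exact: measurableU.
- move=> o /= h [w1|w2]; apply: h; rewrite /sgn.
    by rewrite w1 eqxx.
  by rewrite w2 -subr_eq0 -opprD oppr_eq0 -(natrD _ 1 1) pnatr_eq0.
Qed.

Section Cells.
Context (e : R) (N : nat).
Let cel := cell s e N.

Definition cell_prob (c : 'I_N.+1) : R := fine (P [set o | cel (x o) = c]).

Definition sample_code (o : Omega) : {ffun 'I_n -> bool * 'I_N.+1} :=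
  [ffun i => (sigma i o == 1, cel (xs i o))].

Lemma measurable_cell c : measurable [set o | cel (x o) = c].
Proof. by case: x_random => mx _; apply: (mx (cel @^-1` [set c])); exact: borel_cell. Qed.

Lemma cell_prob_ge0 c : 0 <= cell_prob c. Proof. exact: fine_ge0. Qed.

Lemma sum_cell_indic o : \sum_c \1_[set o | cel (x o) = c] o = 1 :> R.
Proof.
rewrite (bigD1 (cel (x o)))//= indicE mem_set// big1 ?addr0// => c cx.
by rewrite indicE memNset// => /= e'; rewrite -e' eqxx in cx.
Qed.

Lemma sum_cell_prob : \sum_c cell_prob c = 1.
Proof.
have ac c : aebounded P (\1_[set o | cel (x o) = c] : Omega -> R).
  exact: (aeb_indic P (measurable_cell c)).
transitivity (\sum_c mean P (\1_[set o | cel (x o) = c] : Omega -> R)).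
  by apply: eq_bigr => c _; rewrite (mean_indic P (measurable_cell c)).
rewrite -mean_sum// -(mean_cst P 1); congr mean; apply/funext => o.
exact: sum_cell_indic.
Qed.

Lemma sample_code_law th : measurable [set o | sample_code o = th] /\
  fine (P [set o | sample_code o = th]) = pmass (signw cell_prob) th.
Proof.
pose sg (i : 'I_n) : set R := if (th i).1 then [set 1] else ~` [set 1].
pose A (i : 'I_n + 'I_n) : set Omega := match i with
  | inl i => xs i @^-1` (cel @^-1` [set (th i).2])
  | inr i => sigma i @^-1` sg i end.
have msg i : measurable (sg i).
  by rewrite /sg; case: (th i).1 => //; apply: measurableC.
have E : [set o | sample_code o = th] = \bigcap_i A i.
  apply/seteqP; split=> [w /= wth [i|i] _ /=|o oA /=].
  - by rewrite -wth ffunE.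
  - by rewrite /sg/= -wth ffunE/=; case: eqVneq => //= /eqP.
  - apply/ffunP => i; rewrite ffunE; apply: injective_projections => /=.
      have := oA (inr i) I; rewrite /A /sg/=; case: (th i).1 => /=.
        by move=> ->; rewrite eqxx.
      by move=> h; apply/negbTE/eqP.
    exact: oA (inl i) I.
have mA i : measurable (A i).
  case: i => i /=.
    by case: (xs_random i) => mx _; apply: mx; exact: borel_cell.
  by rewrite -[X in measurable X]setTI; exact: measurable_funP.
have hA i : sample_algebras xs sigma i (A i).
  case: i => i /=.
    by exists (cel @^-1` [set (th i).2]); [exact: borel_cell|rewrite setTI].
  by exists (sg i) => //; rewrite setTI.
rewrite E; split.
  by apply: fin_bigcap_measurable => // i _; exact: mA.
rewrite (sample_indep hA)/= big_sumType/= -big_split/=.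
apply: eq_bigr => i _; rewrite /signw mulrC; congr (_ * _).
  have [h1 _] := sigma_rademacher i.
  rewrite /sg; case: (th i).1; first by rewrite h1.
  rewrite -preimage_setC probability_setC; last first.
    by rewrite -[X in measurable X]setTI; exact: measurable_funP.
  by rewrite h1 -EFinB/=; lra.
by congr fine; apply: xs_law; exact: borel_cell.
Qed.

End Cells.

Context (mu : forall m, H m) (C T : forall m, H m -> H m) (alpha : 'I_M -> R).
Arguments C : clear implicits.
Arguments T : clear implicits.
Context (p D r t q a c : R).
Hypotheses (p_ge1 : 1 <= p) (t_ge : p <= t) (q_ge2 : 2 <= q) (tq : t^-1 + q^-1 = 1).
Hypotheses (D_gt0 : 0 < D) (r_gt0 : 0 < r).
Hypotheses (aE : a = expR 1 * D ^+ 2 * q ^+ 2) (cE : c = r * M%:R `^ (1 - 2 / q)).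
Hypothesis hb : forall m,
  block_data P (fun o => x o m) b c a (alpha m) (mu m) (C m) (T m).
Hypothesis hU : pairwise_uncorrelated P x.

Let q0 : 0 < q. Proof. exact: lt_le_trans q_ge2. Qed.

Let a0 : 0 < a. Proof. by rewrite aE !mulr_gt0 ?expR_gt0 ?exprn_gt0. Qed.

Let c0 : 0 < c. Proof. by rewrite cE mulr_gt0// powR_gt0// ltr0n. Qed.

Let A := (\sum_m alpha m `^ (q / 2)) `^ q^-1.

Let hC m : cov_op P (fun o => x o m - mu m) (C m). Proof. by case: (hb m). Qed.

Let pC m : psd_form (fun u v => hdot (C m u) v).
Proof. exact (cov_psd (bd_elt (hb m)) (@hC m)). Qed.

Lemma smoothed_form_psd m : psd_form (fun u v => hdot (C m (T m u)) (T m v)).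
Proof.
have pT := bd_psd (hb m).
split=> [u v w|l u v|u v|u].
- by rewrite (opD pT) (psdD (pC m)).
- by rewrite (opZ pT) (psdZ (pC m)).
- exact: psdC (pC m) _ _.
- exact: psd_ge0 (pC m) _.
Qed.

Lemma second_momentE (w : prod_space H) : second_moment P x (pdot w)
  = ((\sum_m hdot (w m) (mu m)) ^+ 2 + \sum_m hdot (C m (w m)) (w m))%:E.
Proof.
apply: (@second_moment_split _ _ _ P M H x mu C b) => // m.
- exact: random_element_block.
- by move=> v; exact: bd_mean (hb m) v.
- exact: bd_elt (hb m).
Qed.

Let supr o := ereal_sup
  [set (pdot w (rademacher_mean xs (fun i o => sigma i o) o))%:E
    | w in [set w | hclass p D (pdot w) /\ (second_moment P x (pdot w) <= r%:E)%E]].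

Lemma supr_ge0 o : (0 <= supr o)%E.
Proof.
pose w0 : prod_space H := fun m => 0.
have w00 m v : hdot (w0 m) v = 0 by exact: psd0l (hdot_psd _) _.
apply: ereal_sup_ubound; exists w0; last first.
  by rewrite /pdot big1// => m _; rewrite w00.
split.
  exists w0 => //=; rewrite /norm2p lpnorm_EFin// lee_fin big1 => [|m _].
    by rewrite powR0 ?(ltW D_gt0)// invr_eq0 gt_eqF// (lt_le_trans _ p_ge1).
  by rewrite /w0 normr0 powR0// gt_eqF// (lt_le_trans _ p_ge1).
rewrite second_momentE lee_fin big1 => [|m _]; last by rewrite w00.
by rewrite expr0n add0r big1 ?(ltW r_gt0)// => m _; rewrite hdotC w00.
Qed.

Lemma local_rademacher_le :
  (local_rademacher P x xs (fun i o => sigma i o) (hclass p D) r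
   <= (4 * (A / Num.sqrt n%:R)
       + Num.sqrt (b ^+ 2 * expR 1) * D * M%:R `^ q^-1 * q / n%:R)%:E)%E.
Proof.
apply/lee_addgt0Pr => eps eps0.
have MR : 0 < M%:R :> R by rewrite ltr0n.
have nR : 0 < n%:R :> R by rewrite ltr0n.
have K0 : 0 < D * M%:R * (2 + 4 * b) by rewrite !mulr_gt0// ltr_pwDl// mulr_ge0.
pose de := eps / (D * M%:R * (2 + 4 * b)).
have de0 : 0 < de by rewrite divr_gt0.
have [N hN] := rest_cell_small x_random x_dense de0.
pose cel := cell s de N; pose G k := [set o | cel (x o) = k].
have mG k : measurable (G k) := measurable_cell de k.
pose Q := cell_prob de (N := N).
pose rho k m := projT1 (cid (weak_mean (bd_elt (hb m)) (mG k))).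
have hrho k m : forall v, hdot (rho k m) v = mean P (fun o => \1_(G k) o * hdot (x o m - mu m) v).
  exact: projT2 (cid (weak_mean (bd_elt (hb m)) (mG k))).
pose y k m : H m := (Q k)^-1 *: rho k m.
have yb k m : `|y k m| <= 2 * b := cond_norm (bd_elt (hb m)) (mG k) (@hrho k m).
have yd k m : Q k != 0 -> (k < N)%N -> `|y k m - (s k m - mu m)| <= de.
  move=> Qk kN; apply: (cond_dist (bd_elt (hb m)) (mG k) (@hrho k m) Qk (ltW de0)).
  apply: aeW => o ok; have := @cellP _ _ _ s de N (x o).
  rewrite -/cel (ok : cel (x o) = k) => /(_ kN m) h.
  by rewrite opprB addrA subrK ltW.
pose Nn m := mean P (fun o => hdot (T m (x o m - mu m)) (x o m - mu m)).
have yj m : \sum_k Q k * hdot (T m (y k m)) (y k m) <= Nn m.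
  have aT := bd_aeb (hb m).
  have aGT k : aebounded P (fun o => \1_(G k) o * hdot (T m (x o m - mu m)) (x o m - mu m)).
    by apply: aebM aT; exact: aeb_indic.
  apply: (@le_trans _ _ (\sum_k mean P (fun o => \1_(G k) o * hdot (T m (x o m - mu m)) (x o m - mu m)))).
    apply: ler_sum => k _.
    exact: (cond_jensen (bd_elt (hb m)) (mG k) (@hrho k m) (bd_psd (hb m)) aT).
  rewrite -mean_sum//; under eq_fun do rewrite -mulr_suml (sum_cell_indic de N) mul1r.
  by [].
pose e k := if (k == ord_max) || (Q k == 0) then 4 * b else 2 * de.
have Q0 k : 0 <= Q k by exact: cell_prob_ge0.
have Q1 : \sum_k Q k = 1 by exact: sum_cell_prob.
have Qe : D * M%:R / n%:R * (n%:R * \sum_k Q k * e k) <= eps.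
  have -> : eps = D * M%:R * ((2 + 4 * b) * de).
    by rewrite /de mulrA mulrC divfK// gt_eqF.
  have -> : D * M%:R / n%:R * (n%:R * \sum_k Q k * e k) = D * M%:R * \sum_k Q k * e k.
    by field; rewrite gt_eqF.
  rewrite ler_wpM2l ?mulr_ge0 ?(ltW D_gt0) ?(ltW MR)//.
  apply: (@le_trans _ _ (\sum_k Q k * (2 * de) + 4 * b * Q ord_max)); last first.
    rewrite -mulr_suml Q1 mul1r [leRHS]mulrDl lerD2l ler_wpM2l// mulr_ge0//.
  rewrite (bigD1 ord_max)//= [X in _ <= X + _](bigD1 ord_max)//= addrAC.
  apply: lerD.
    rewrite {1}/e eqxx/= (mulrC _ (Q ord_max)) -mulrDr ler_wpM2l// lerDr.
    by rewrite mulr_ge0// ltW.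
  apply: ler_sum => k kN; rewrite /e (negbTE kN)/=; case: eqVneq => [->|_//].
  by rewrite !mul0r.
have eta0 : 0 < c / a by rewrite divr_gt0.
pose S m u := (c / a) *: T m u.
have Slin m (I : finType) (g : I -> R) (v : I -> H m) :
    S m (\sum_i g i *: v i) = \sum_i g i *: S m (v i).
  have pT := bd_psd (hb m); rewrite /S.
  rewrite (big_morph (T m) (opD pT) (op0 pT)) scaler_sumr.
  by apply: eq_bigr => i _; rewrite (opZ pT) !scalerA mulrC.
pose f m (u v : H m) : R := hdot (C m (T m u)) (T m v).
have etaE : c = a * (c / a) by rewrite mulrC divfK ?gt_eqF.
have fm m : \sum_k Q k * f m (y k m) (y k m) <= Nn m.
  apply: le_trans (yj m); apply: ler_sum => k _; rewrite ler_wpM2l//.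
  exact: bd_form (hb m) _.
have Sn m k : `|S m (y k m)| <= 2 * b.
  exact: le_trans (bd_norm (hb m) _) (yb k m).
have Sm m : \sum_k Q k * `|S m (y k m)| ^+ 2 <= c / a * Nn m.
  apply: le_trans (ler_wpM2l (ltW eta0) (yj m)); rewrite mulr_sumr.
  by apply: ler_sum => k _; rewrite [leRHS]mulrCA ler_wpM2l//; exact: bd_sqr (hb m) _.
have Na m : c * Nn m <= alpha m by exact: bd_trace (hb m).
pose zeta (th : {ffun 'I_n -> bool * 'I_N.+1}) m : H m :=
  \sum_i sgn R (th i).1 *: y (th i).2 m.
pose Psi (th : {ffun 'I_n -> bool * 'I_N.+1}) : R :=
  A * (n%:R^-1 * `|\sum_i sgn R (th i).1|)
  + Num.sqrt r * (n%:R^-1 * Num.sqrt (\sum_m f m (zeta th m) (zeta th m)))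
  + D * (n%:R^-1 * (\sum_m `|S m (zeta th m)| `^ q) `^ q^-1)
  + D * M%:R / n%:R * \sum_i e (th i).2.
have fin : pmean (signw Q) Psi
    <= 4 * (A / Num.sqrt n%:R) + Num.sqrt (b ^+ 2 * expR 1) * D * M%:R `^ q^-1 * q / n%:R
       + D * M%:R / n%:R * (n%:R * \sum_k Q k * e k).
  exact: (finite_bound M_gt0 n_gt0 Q0 Q1 b0 (ltW r_gt0) D_gt0 q_ge2 eta0 aE cE etaE
    smoothed_form_psd fm Slin Sn Sm Na).
have e_ge0 k : 0 <= e k.
  by rewrite /e; case: ifP => _; rewrite mulr_ge0 ?(ltW de0).
have Psi0 th : 0 <= Psi th.
  rewrite /Psi !addr_ge0 ?mulr_ge0 ?powR_ge0 ?sqrtr_ge0 ?invr_ge0 ?(ltW D_gt0) ?(ltW nR)//.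
  exact: sumr_ge0.
have law (th : {ffun 'I_n -> bool * 'I_N.+1}) : measurable [set o | sample_code de N o = th] /\
    fine (P [set o | sample_code de N o = th]) = pmass (signw Q) th.
  exact: sample_code_law.
rewrite /local_rademacher -/(supr _).
apply: le_trans (integral_le_discrete (theta := sample_code de N) (Psi := Psi) _ Psi0 supr_ge0 _) _.
- by move=> th; case: (law th).
- apply: filterS2 ae_sample_norm ae_sample_sign => o xsb sgE.
  apply: ub_ereal_sup => _ [w [[w' wD <-] wr] <-]; rewrite lee_fin.
  have wp := norm2p_sum p_ge1 D_gt0 wD.
  move: wr; rewrite second_momentE lee_fin => wr.
  set k2 := _ ^+ 2 in wr; set F := \sum_m hdot (C m _) _ in wr.
  have k20 : 0 <= k2 by exact: sqr_ge0.
  have F0 : 0 <= F by apply: sumr_ge0 => m _; exact: psd_ge0 (pC m) _.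
  have Fr : F <= r by apply: le_trans wr; rewrite lerDr.
  have k2r : k2 <= r by apply: le_trans wr; rewrite lerDl.
  have wmu : `|\sum_m hdot (w' m) (mu m)| <= A.
    apply: (mean_part_le p_ge1 t_ge q0 tq D_gt0 (ltW r_gt0) M_gt0 q_ge2 aE cE c0 _ wp k2r).
    by move=> m; exact: bd_muc (hb m).
  have TE m u : C m (T m u) + (c / a) *: T m u = u by exact: bd_res (hb m) u.
  pose th := sample_code de N o.
  have xe i m : `|xs i o m - mu m - y (th i).2 m| <= e (th i).2.
    rewrite /th ffunE /=; set k := cell s de N (xs i o).
    rewrite /e; case: ifPn => [_|]; last first.
      rewrite negb_or => /andP[kN Qk].
      have kN' : (k < N)%N by rewrite ltn_neqAle -ltnS ltn_ord andbT.
      have := @cellP _ _ _ s de N (xs i o) kN' m; rewrite -/k => xsk.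
      rewrite (_ : _ - _ - _ = (xs i o m - s k m) - (y k m - (s k m - mu m))); last first.
        by rewrite opprB addrA addrA subrK addrAC.
      apply: (le_trans (ler_normB _ _)).
      by rewrite mulr2n mulrDl mul1r lerD ?(ltW xsk)// yd.
    apply: (le_trans (ler_normB _ _)).
    have h1 : `|xs i o m - mu m| <= 2 * b.
      apply: (le_trans (ler_normB _ _)).
      by rewrite mulr2n mulrDl mul1r lerD//; exact: bd_mu (hb m).
    have -> : 4 * b = 2 * b + 2 * b by ring.
    by rewrite lerD.
  have := @sup_pointwise R M n H mu C T p t q D r A (c / a) p_ge1 t_ge q0 tq D_gt0 pC TE
    w' (fun i => xs i o) (fun i => (th i).1) (fun i => y (th i).2) (fun i => e (th i).2)
    (zeta th) (fun m => erefl) wp Fr wmu xe.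
  apply: le_trans; rewrite le_eqVlt; apply/orP; left; apply/eqP.
  rewrite /pdot /rademacher_mean; apply: eq_bigr => m _; congr (hdot _ (_ *: _)).
  by apply: eq_bigr => i _; rewrite /th ffunE /= -sgE.
- rewrite lee_fin; apply: (@le_trans _ _ (pmean (signw Q) Psi)).
    by apply: ler_sum => th _; rewrite (law th).2.
  by apply: le_trans fin _; rewrite lerD2l.
Qed.

End Assembly.


Theorem theorem5 (R : realType) (M n : nat) (M_gt0 : (0 < M)%N)
  (n_gt0 : (0 < n)%N)
  (dX : measure_display) (S : measurableType dX) (k : 'I_M -> S -> S -> R)
  (H : 'I_M -> hilbert R) (H_rkhs : forall m, is_rkhs (k m) (H m))
  (phi : forall m, S -> H m)
  (phi_feature : forall m, is_feature_map (k m) (phi m))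
  (d : measure_display) (Omega : measurableType d) (P : probability Omega R)
  (X : {RV P >-> S}) (x : Omega -> prod_space H)
  (xE : forall omega m, x omega m = phi m (X omega))
  (x_random : random_element P x)
  (x_moment : ('E_P[fun omega => pdot (x omega) (x omega)] < +oo)%E)
  (xs : 'I_n -> Omega -> prod_space H)
  (xs_random : forall i, random_element P (xs i))
  (xs_law : forall i, same_law P (xs i) x)
  (sigma : 'I_n -> {RV P >-> R})
  (sigma_rademacher : forall i, is_rademacher (sigma i))
  (sample_indep : mutually_independent P (sample_algebras xs sigma))
  (J : forall m, H m -> H m)
  (J_cov : forall m, is_covariance_operator P (fun omega => x omega m) (J m))
  (lambda : 'I_M -> nat -> R)
  (lambda_eig : forall m, eigenvalue_seq (J m) (lambda m))
  (p D r B t : R) (p_ge1 : 1 <= p) (p_le2 : p <= 2) (D_gt0 : 0 < D)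
  (r_gt0 : 0 < r)
  (x_bounded : forall m, {ae P, forall omega, `|x omega m| ^+ 2 <= B})
  (x_uncorrelated : pairwise_uncorrelated P x)
  (t_ge : p <= t) (t_le2 : t <= 2) :
  (local_rademacher P x xs (fun i omega => sigma i omega) (hclass p D) r
   <= rademacher_bound n D r B t lambda)%E.
Proof.
have [t1|t1] := eqVneq t 1; first by rewrite /rademacher_bound t1 hoelder_conjugate1 leey.
have {}t1 : 1 < t by rewrite lt_neqAle eq_sym t1 (le_trans p_ge1).
have t0 : 0 < t by exact: lt_trans t1.
have t10 : 0 < t - 1 by rewrite subr_gt0.
rewrite /rademacher_bound hoelder_conjugate_EFin//.
set s := t / (t - 1).
have s2 : 2 <= s by rewrite ler_pdivlMr//; lra.
have s0 : 0 < s by exact: lt_le_trans s2.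
have ts : t^-1 + s^-1 = 1 by rewrite /s; field; rewrite !gt_eqF.
clearbody s.
set c := r * _; set a := expR 1 * _ * _; set tail := _ / n%:R.
have MR : 0 < M%:R :> R by rewrite ltr0n.
have nR : 0 < n%:R :> R by rewrite ltr0n.
have c0 : 0 < c by rewrite mulr_gt0// powR_gt0.
have a0 : 0 < a by rewrite !mulr_gt0 ?expR_gt0 ?exprn_gt0.
have B0 : 0 <= B.
  by have [w] := ae_witness (x_bounded (Ordinal M_gt0)); apply: le_trans; exact: sqr_ge0.
pose b := Num.sqrt B.
have bB : b ^+ 2 = B by rewrite sqr_sqrtr.
have xb m : {ae P, forall o, `|x o m| <= b}.
  apply: filterS (x_bounded m) => o; rewrite -bB ler_pXn2r ?nnegrE// sqrtr_ge0//.
have hx m := random_element_block x_random (xb m).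
have hJ m : cov_op P (fun o => x o m) (J m).
  move=> u v; apply: EFin_inj; rewrite -(J_cov m) -meanE; last exact: be_hdot2 (hx m).
  by congr expectation; apply/funext => o; rewrite /tensor hdotZl.
have l0 m j : 0 <= lambda m j.
  exact: (eigenbasis (cov_psd (hx m) (@hJ m)) (lambda_eig m)).1.
have [sq x_dense] := countable_dense_seq x_random.2.
have sp0 m : (0 <= spectral_sum c a (lambda m))%E.
  by have := spectral_sum_ge 0 (ltW c0) (ltW a0) (l0 m); rewrite big_ord0.
have in0 : 0 < 16 / n%:R :> R by rewrite divr_gt0.
have [fin|/existsNP[m /negP nfin]] :=
    pselect (forall m, spectral_sum c a (lambda m) \is a fin_num); last first.
  have sy : spectral_sum c a (lambda m) = +oo%E.
    by apply/eqP; move: nfin; rewrite ge0_fin_numE// -leNgt leye_eq.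
  have q0 : 0 < s / 2 by rewrite divr_gt0.
  by rewrite (lpnorm_eqy q0 sy) gt0_muley ?lte_fin// poweRyr ?invr_eq0 ?pnatr_eq0// addye// leey.
pose alpha m := fine (spectral_sum c a (lambda m)).
have alphaE m : spectral_sum c a (lambda m) = (alpha m)%:E by rewrite fineK.
have alpha0 m : 0 <= alpha m by exact: fine_ge0.
have alpha_ge m k' : \sum_(j < k') Num.min c (a * lambda m j) <= alpha m.
  by rewrite -lee_fin -alphaE; exact: spectral_sum_ge (ltW c0) (ltW a0) (l0 m).
have block m : exists z : H m * (H m -> H m) * (H m -> H m),
    block_data P (fun o => x o m) b c a (alpha m) z.1.1 z.1.2 z.2.
  have xm : {ae P, forall o, forall e : R, 0 < e -> exists j, `|x o m - sq j m| < e}.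
    apply: filterS x_dense => o co e e0.
    by have [j hj] := closure_prod_ball co e0; exists j.
  have [mu [C [T h]]] := block_exists (s := fun j => sq j m) c0 a0 (hx m) (@hJ m) (lambda_eig m) xm (alpha_ge m).
  by exists (mu, C, T).
pose z m := projT1 (cid (block m)); have hz m := projT2 (cid (block m)).
have main := local_rademacher_le M_gt0 n_gt0 x_random xs_random xs_law sigma_rademacher
  sample_indep xb x_dense p_ge1 t_ge s2 ts D_gt0 r_gt0 (erefl a) (erefl c) hz x_uncorrelated.
apply: le_trans main _; rewrite bB -/tail.
rewrite (_ : (fun m => spectral_sum c a (lambda m)) = fun m => (alpha m)%:E); last first.
  by apply/funext => m; exact: alphaE.
rewrite lpnorm_EFin// -EFinM poweR_EFin -EFinD lee_fin lerD2r.
set Z := \sum_m _; have Z0 : 0 <= Z by apply: sumr_ge0 => m _; exact: powR_ge0.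
rewrite powRM ?powR_ge0 ?(ltW in0)// powR12_sqrt ?(ltW in0)// -powRrM.
have -> : (s / 2)^-1 / 2 = s^-1 by field; rewrite gt_eqF.
have -> : Num.sqrt (16 / n%:R) = 4 / Num.sqrt n%:R :> R.
  rewrite sqrtrM// sqrtrV//; congr (_ / _).
  by rewrite (_ : 16 = 4 ^+ 2) ?sqrtr_sqr ?ger0_norm//; ring.
by rewrite mulrAC mulrA.
Qed.
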